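(* Let $n\ge1$, let $\mu,\nu$ be partitions, and let $A,A',B,B'$ be finite ordered alphabets with total orders $\prec_A$ on $A\sqcup A'$ and $\prec_B$ on $B\sqcup B'$ respecting the individual orders. Let $I_A$ be the total order on $A\sqcup A'\sqcup B\sqcup B'$ extending $\prec_A,\prec_B$ in which every element of $A\sqcup A'$ is smaller than every element of $B\sqcup B'$, and let $I_B$ be the one in which every element of $A\sqcup A'$ is larger than every element of $B\sqcup B'$. Then the partition functions of the Cauchy systems satisfy $$Z\big(\mathcal C_{\mu,\nu,I_A}(X/Y,W/Z)\big)=\sum_\lambda\mathcal G^{(n)}_{\lambda/\mu}(X/Y;q)\cdot\mathcal G^{(n)}_{\lambda/\nu}(W/Z;q),$$ $$Z\big(\mathcal C_{\mu,\nu,I_B}(X/Y,W/Z)\big)=\sum_\lambda\mathcal G^{(n)}_{\nu/\lambda}(X/Y;q)\cdot\mathcal G^{(n)}_{\mu/\lambda}(W/Z;q),$$ where both sums run over all partitions $\lambda$.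
   Context: **Super LLT polynomials.** Partitions are identified with Young diagrams (left-justified rows, the $i$-th row from the top having $\lambda_i$ boxes). An $n$-ribbon is a connected skew shape with $n$ boxes containing no $2\times2$ square; its spin is its number of rows minus one. A tiling of a skew shape by $n$-ribbons is a horizontal $n$-ribbon strip if the top-right-most square of each ribbon touches the northern boundary of the shape (the square directly above it is not in the shape); it is a vertical $n$-ribbon strip if its reflection in the main diagonal is a horizontal $n$-ribbon strip. Given alphabets $A,A'$ with total order $\prec$ on $A\sqcup A'$, a super $n$-ribbon tableau $T$ of shape $\lambda/\mu$ is a tiling of $\lambda/\mu$ by $n$-ribbons labelled by $A\sqcup A'$ such that, for each label $i$, $\mu$ together with the ribbons with labels $\preceq i$ is a Young diagram, the ribbons with any label $a\in A$ form a horizontal strip and the ribbons with any label $b\in A'$ form a vertical strip. Then $\mathcal G^{(n)}_{\lambda/\mu}(X/Y;q)=\sum_Tq^{\operatorname{spin}(T)}x^{\operatorname{wt}(T)}(-y)^{\operatorname{wt}'(T)}$, where $\operatorname{spin}(T)$ is the total spin and $\operatorname{wt}(T),\operatorname{wt}'(T)$ record the multiplicities of the labels in $A,A'$; it is $0$ if $\mu\not\subset\lambda$ or if there is no such tableau, and it is known not to depend on $\prec$. $\mathcal G^{(n)}_{\lambda/\mu}(W/Z;q)$ is defined in the same way from the alphabets $B,B'$ with variables $w_i$ ($i\in B$), $z_{i'}$ ($i'\in B'$). **Vertices and weights.** Vertical edges carry labels in $\{\wedge,\vee\}$ (arrows up/down), horizontal edges carry $n$-tuples of labels in $\{<,>\}$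 (arrows left/right). A vertex $v$ has labels $v_N,v_S$ above and below and tuples $v_W,v_E$ on its left and right (for horizontally adjacent vertices $u,v$, $u$ on the left, $u_E(k)=v_W(k)$ for all $k$). It is admissible if the number of arrows pointing in equals the number pointing out and $v_E(k)=v_W(k+1)$ for $1\le k\le n-1$; then it has one of the types, given by $(v_N,v_S,v_W(1),v_E(n))$: SW: $(\wedge,\wedge,>,>)$; NS: $(\vee,\wedge,<,>)$; SE: $(\wedge,\wedge,<,<)$; NW: $(\vee,\vee,>,>)$; EW: $(\wedge,\vee,>,<)$; NE: $(\vee,\vee,<,<)$. Let $s$ (resp. $t$) be the number of left arrows (resp. right arrows) among $v_E(1),\dots,v_E(n-1)$. The weights, in the order (SW, NS, SE, NW, EW, NE), are: $wt_H$ (parameter $x$): $(q^s,\ q^s,\ 0,\ 1,\ q^sx,\ q^sx)$; $wt_V$ (parameter $y$): $(q^s,\ 1,\ -y,\ 1,\ -y,\ 0)$; $wt_{\widetilde H}$ (parameter $x$): $(0,\ q^tx,\ q^t,\ q^tx,\ q^t,\ 1)$; $wt_{\widetilde V}$ (parameter $y$): $(-y,\ -y,\ q^t,\ 0,\ 1,\ 1)$. Non-admissible vertices have weight $0$. **Cauchy system** $\mathcal C_{\mu,\nu,I}(X/Y,W/Z)$, for a total order $I$ on $A\sqcup A'\sqcup B\sqcup B'$ extending $\prec_A$ and $\prec_B$. Columns are indexed from left to right by $\mathbb Z$, and rows are labelled from top to bottom by $A\sqcup A'\sqcup B\sqcup B'$ in increasing order for $I$. Pad $\mu,\nu$ with zeros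 to a common length $r$ and put $\rho=(r,r-1,\dots,1)$. The top boundary edge in column $c$ is $\wedge$ if $c\le0$ or $c$ is a part of $\mu+\rho$, and $\vee$ otherwise; the bottom boundary edges are labelled in the same way with $\nu+\rho$. Rows labelled $i\in A$ use $wt_H$ with parameter $x_i$; rows $i'\in A'$ use $wt_V$ with parameter $y_{i'}$; rows $i\in B$ use $wt_{\widetilde H}$ with parameter $w_i$; rows $i'\in B'$ use $wt_{\widetilde V}$ with parameter $z_{i'}$. The side boundary labels are $>$ in rows of $A\sqcup A'$ and $<$ in rows of $B\sqcup B'$, i.e. in each state the horizontal edges sufficiently far to the left and to the right carry this label in all $n$ components. The weight of a state (assignment of labels to all edges compatible with the boundary conditions) is the product of its vertex weights (all but finitely many equal $1$ in a state with no weight-$0$ vertex), and $Z$ is the sum over all states. The spectral parameters are formal variables and the identities are identities of formal power series. *)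

(* Defs.v *)
From HB Require Import structures.
From mathcomp Require Import all_boot all_order all_algebra.
From mathcomp Require Import boolp classical_sets cardinality fsbigop.
From mathcomp Require Import mpoly.

Set Implicit Arguments.
Unset Strict Implicit.
Unset Printing Implicit Defensive.

Import Order.TTheory GRing.Theory.

Local Open Scope nat_scope.

Record intpart := IntPart {
  parts :> seq nat;
  _ : sorted geq parts && (0 \notin parts) }.

HB.instance Definition _ := [isSub for parts].
HB.instance Definition _ := [Countable of intpart by <:].

(* [nth 0 la i] is the (i+1)-st part, and 0 beyond the length. *)
Definition part_included (mu la : intpart) : Prop :=
  forall i, nth 0 mu i <= nth 0 la i.

(* Cells are (row, column), numbered from 0 at the top left, in a bounding box
   with [h] rows and [w] columns. *)
Section Ribbons.
Variables h w : nat.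
Implicit Types (c d : 'I_h * 'I_w) (D R : {set 'I_h * 'I_w}).
Implicit Type P : {set {set 'I_h * 'I_w}}.

(* The cells of [mu] that lie in the box. *)
Definition diagram (mu : intpart) : {set 'I_h * 'I_w} :=
  [set c : 'I_h * 'I_w | c.2 < nth 0 mu c.1].

Definition is_young D : Prop :=
  exists al : intpart, [/\ size al <= h, nth 0 al 0 <= w & D = diagram al].

Definition is_skew D : Prop :=
  exists U V, [/\ is_young U, is_young V, V \subset U & D = U :\: V].

Definition adjacent c d : bool :=
  (c.1 == d.1) && ((c.2.+1 == d.2 :> nat) || (d.2.+1 == c.2 :> nat))
  || (c.2 == d.2) && ((c.1.+1 == d.1 :> nat) || (d.1.+1 == c.1 :> nat)).

Definition cells_connected R : Prop :=
  {in R &, forall c d,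
    connect [rel u v | [&& u \in R, v \in R & adjacent u v]] c d}.

Definition contains_2x2 R : Prop :=
  exists c d, [/\ c.1.+1 = d.1 :> nat, c.2.+1 = d.2 :> nat
                & [set c; (c.1, d.2); (d.1, c.2); d] \subset R].

Definition is_ribbon (n : nat) R : Prop :=
  [/\ is_skew R, #|R| = n, cells_connected R & ~ contains_2x2 R].

Definition ribbon_spin R : nat := #|[set c.1 | c in R]|.-1.

Definition is_top_right R c : Prop :=
  c \in R /\ {in R, forall d, c.1 <= d.1 /\ d.2 <= c.2}.

(* The tiled shape is [cover P]. *)
Definition horizontal_strip P : Prop :=
  forall R c, R \in P -> is_top_right R c ->
  forall d, d.1.+1 = c.1 :> nat -> d.2 = c.2 -> d \notin finset.cover P.

End Ribbons.

Definition transpose_cells h w (R : {set 'I_h * 'I_w}) : {set 'I_w * 'I_h} :=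
  [set (c.2, c.1) | c in R].

Definition vertical_strip h w (P : {set {set 'I_h * 'I_w}}) : Prop :=
  horizontal_strip [set transpose_cells R | R : {set 'I_h * 'I_w} in P].

Section SuperLLT.
Variables (n : nat) (la mu : intpart) (A A' : finType).
(* The non-strict total order on A + A'. *)
Variable prec : rel (A + A').

Notation box := ('I_(size la) * 'I_(nth 0 la 0))%type.

(* [T R = Some l] when the set of cells [R] is a tile with label [l], and
   [T R = None] when [R] is not a tile. *)
Definition labelled_tiles := {ffun {set box} -> option (A + A')}.

Definition tiles (T : labelled_tiles) : {set {set box}} :=
  [set R | T R != None].
Definition tiles_with (T : labelled_tiles) (l : A + A') : {set {set box}} :=
  [set R | T R == Some l].
Definition tiles_upto (T : labelled_tiles) (l : A + A') : {set {set box}} :=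
  [set R | if T R is Some l' then prec l' l else false].

Record is_super_tableau (T : labelled_tiles) : Prop := IsSuperTableau {
  st_included : part_included mu la;
  st_tiling : finset.partition (tiles T) (diagram _ _ la :\: diagram _ _ mu);
  st_ribbons : {in tiles T, forall R, is_ribbon n R};
  st_young : forall l, is_young (diagram _ _ mu :|: finset.cover (tiles_upto T l));
  st_horizontal : forall a : A, horizontal_strip (tiles_with T (inl a));
  st_vertical : forall b : A', vertical_strip (tiles_with T (inr b)) }.

Definition tableau_spin (T : labelled_tiles) : nat :=
  \sum_(R in tiles T) ribbon_spin R.

Definition super_LLT (R : comNzRingType) (q : R) (x : A -> R) (y : A' -> R) : R :=
  (\sum_(T : labelled_tiles | `[< is_super_tableau T >])
     q ^+ tableau_spin T
     * (\prod_(a : A) x a ^+ #|tiles_with T (inl a)|)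
     * (\prod_(b : A') (- y b) ^+ #|tiles_with T (inr b)|))%R.

End SuperLLT.

Variant varrow := Up | Down.
Variant harrow := Lft | Rgt.

Definition is_up a := if a is Up then true else false.
Definition is_down a := ~~ is_up a.
Definition is_left a := if a is Lft then true else false.
Definition is_right a := ~~ is_left a.

Record vertex (n : nat) := Vertex {
  vN : varrow; vS : varrow; vW : n.-tuple harrow; vE : n.-tuple harrow }.

Variant vertex_kind := SW | NS | SE | NW | EW | NE.

Section Vertices.
Variable n : nat.
Implicit Type v : vertex n.

(* Tuples are indexed from 0, so v_W(k) is [nth Lft (vW v) k.-1]; the default
   value [Lft] is never reached when n > 0. *)
Definition arrows_in v : nat :=
  is_down (vN v) + is_up (vS v) + count is_right (vW v) + count is_left (vE v).
Definition arrows_out v : nat :=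
  is_up (vN v) + is_down (vS v) + count is_left (vW v) + count is_right (vE v).

Definition admissible v : Prop :=
  arrows_in v = arrows_out v /\
  forall k, k.+1 < n -> nth Lft (vE v) k = nth Lft (vW v) k.+1.

Definition kind_of v : option vertex_kind :=
  if `[< admissible v >] then
    match vN v, vS v, nth Lft (vW v) 0, nth Lft (vE v) n.-1 with
    | Up, Up, Rgt, Rgt => Some SW
    | Down, Up, Lft, Rgt => Some NS
    | Up, Up, Lft, Lft => Some SE
    | Down, Down, Rgt, Rgt => Some NW
    | Up, Down, Rgt, Lft => Some EW
    | Down, Down, Lft, Lft => Some NE
    | _, _, _, _ => None
    end
  else None.

Definition num_left v : nat := count is_left (take n.-1 (vE v)).
Definition num_right v : nat := count is_right (take n.-1 (vE v)).

Local Open Scope ring_scope.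
Variables (R : comNzRingType) (q : R).

Definition wt_H (x : R) v : R :=
  let s := num_left v in
  match kind_of v with
  | Some SW => q ^+ s
  | Some NS => q ^+ s
  | Some SE => 0
  | Some NW => 1
  | Some EW => q ^+ s * x
  | Some NE => q ^+ s * x
  | None => 0
  end.

Definition wt_V (y : R) v : R :=
  let s := num_left v in
  match kind_of v with
  | Some SW => q ^+ s
  | Some NS => 1
  | Some SE => - y
  | Some NW => 1
  | Some EW => - y
  | Some NE => 0
  | None => 0
  end.

Definition wt_Ht (x : R) v : R :=
  let t := num_right v in
  match kind_of v with
  | Some SW => 0
  | Some NS => q ^+ t * x
  | Some SE => q ^+ t
  | Some NW => q ^+ t * x
  | Some EW => q ^+ t
  | Some NE => 1
  | None => 0
  end.

Definition wt_Vt (y : R) v : R :=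
  let t := num_right v in
  match kind_of v with
  | Some SW => - y
  | Some NS => - y
  | Some SE => q ^+ t
  | Some NW => 0
  | Some EW => 1
  | Some NE => 1
  | None => 0
  end.

End Vertices.

(* Formal power series in k variables over Z[q], given by their coefficients;
   sums of families of polynomials are taken coefficientwise.  [fps_sum] is
   meaningful for [fps_summable] families only: the finitely supported sum
   [\sum_(t \in D)] is 0 by convention on infinite supports. *)
Section PowerSeries.
Local Open Scope ring_scope.
Local Open Scope classical_set_scope.
Variables (k : nat) (T : Type).
Variables (D : set {classic T}) (F : {classic T} -> {mpoly {poly int}[k]}).

Definition fps_summable : Prop :=
  forall m : 'X_{1..k}, finite_set [set t | D t /\ (F t)@_m != 0].

Definition fps_sum : 'X_{1..k} -> {poly int} :=
  fun m => \sum_(t \in D) (F t)@_m.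

End PowerSeries.

Definition is_total_order (T : Type) (le : rel T) : Prop :=
  [/\ reflexive le, antisymmetric le, transitive le & total le].

Definition respects_orders (dA dA' : Order.disp_t)
    (A : finOrderType dA) (A' : finOrderType dA') (prec : rel (A + A')) : Prop :=
  (forall a1 a2 : A, (a1 <= a2)%O -> prec (inl a1) (inl a2)) /\
  (forall b1 b2 : A', (b1 <= b2)%O -> prec (inr b1) (inr b2)).

Definition rows (A A' B B' : finType) : finType := ((A + A') + (B + B'))%type.

Section Cauchy.
Variables (n : nat) (mu nu : intpart) (A A' B B' : finType).

Notation L := (rows A A' B B').
Notation N := #|{: L}|.

Section System.
Variable I : rel L.

(* The label of the row at position [k], counted from the top. *)
Definition row_label (k : 'I_N) : L := tnth (sort_tuple I (enum_tuple L)) k.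

(* [vedge j c] is the vertical edge of column [c] above row [j] (below the last
   row for the largest [j]); [hedge k c] is the horizontal edge of row [k]
   between the columns [c - 1] and [c]. *)
Record state := State {
  vedge : 'I_N.+1 -> int -> varrow;
  hedge : 'I_N -> int -> n.-tuple harrow }.

Definition vertex_at (s : state) (k : 'I_N) (c : int) : vertex n :=
  {| vN := vedge s (widen_ord (leqnSn N) k) c;
     vS := vedge s (lift ord0 k) c;
     vW := hedge s k c;
     vE := hedge s k (c + 1)%R |}.

(* [r] is the common length to which the partitions are padded; with rows
   numbered from 0, the [i]-th entry of rho is [r - i]. *)
Definition boundary (r : nat) (ka : intpart) (c : int) : varrow :=
  if (c <= 0)%R || [exists i : 'I_r, c == Posz (nth 0 ka i + (r - i))]
  then Up else Down.

Definition side (l : L) : harrow := if l is inl _ then Rgt else Lft.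

Record compatible (r : nat) (s : state) : Prop := Compatible {
  compat_top : forall c, vedge s ord0 c = boundary r mu c;
  compat_bottom : forall c, vedge s ord_max c = boundary r nu c;
  compat_sides : forall k, exists M : nat, forall c : int, M <= absz c ->
    forall j, tnth (hedge s k c) j = side (row_label k) }.

Section Weights.
Local Open Scope ring_scope.
Variables (R : comNzRingType) (q : R).
Variables (x : A -> R) (y : A' -> R) (w : B -> R) (z : B' -> R).

Definition row_weight (l : L) : vertex n -> R :=
  match l with
  | inl (inl a) => wt_H q (x a)
  | inl (inr a') => wt_V q (y a')
  | inr (inl b) => wt_Ht q (w b)
  | inr (inr b') => wt_Vt q (z b')
  end.

Definition vertex_weight (s : state) (p : 'I_N * int) : R :=
  row_weight (row_label p.1) (vertex_at s p.1 p.2).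

(* The product is over the vertices of weight different from 1.  The vanishing
   of a vertex weight is tested first because a state may also have infinitely
   many vertices of weight 0, when the finitely supported product would be 1. *)
Definition state_weight (s : state) : R :=
  if `[< forall p, vertex_weight s p != 0 >]
  then \big[*%R/1]_(p \in [set: 'I_N * int]%classic) vertex_weight s p
  else 0.

End Weights.
End System.

Section Variables.
Local Open Scope ring_scope.

(* One formal variable for each row: x_i, y_i, w_i, z_i according to the
   alphabet of the label. *)
Definition var (l : L) : {mpoly {poly int}[N]} := 'X_(enum_rank l).
Definition var_x (a : A) := var (inl (inl a)).
Definition var_y (a' : A') := var (inl (inr a')).
Definition var_w (b : B) := var (inr (inl b)).
Definition var_z (b' : B') := var (inr (inr b')).
Definition var_q : {mpoly {poly int}[N]} := ('X : {poly int})%:MP.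

Definition cauchy_weight (I : rel L) (s : state) : {mpoly {poly int}[N]} :=
  state_weight I var_q var_x var_y var_w var_z s.

Definition cauchy_summable (I : rel L) (r : nat) : Prop :=
  fps_summable [set s | compatible I r s]%classic (cauchy_weight I).

Definition cauchy_Z (I : rel L) (r : nat) : 'X_{1..N} -> {poly int} :=
  fps_sum [set s | compatible I r s]%classic (cauchy_weight I).

Definition LLT_XY (precA : rel (A + A')) (la ka : intpart) :
    {mpoly {poly int}[N]} :=
  super_LLT n la ka precA var_q var_x var_y.

Definition LLT_WZ (precB : rel (B + B')) (la ka : intpart) :
    {mpoly {poly int}[N]} :=
  super_LLT n la ka precB var_q var_w var_z.

End Variables.

Section Orders.
Variables (precA : rel (A + A')) (precB : rel (B + B')).

Definition order_IA : rel L := fun u v =>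
  match u, v with
  | inl a1, inl a2 => precA a1 a2
  | inr b1, inr b2 => precB b1 b2
  | inl _, inr _ => true
  | inr _, inl _ => false
  end.

Definition order_IB : rel L := fun u v =>
  match u, v with
  | inl a1, inl a2 => precA a1 a2
  | inr b1, inr b2 => precB b1 b2
  | inl _, inr _ => false
  | inr _, inl _ => true
  end.

End Orders.

End Cauchy.

(* Main.v *)
(* Encode a partition by its Maya diagram, a word of particles (up arrows) and
   holes; adding an n-ribbon makes one particle jump over n - 1 places to a hole
   n places further, and the spin is the number of particles jumped over.  Let
   u_c be the operator that makes the particle at c jump, with weight q^spin.

   A row of vertices with weights wt_H is the product H(x) of the factors
   1 + x u_c in the order of the columns c, because tiles of a horizontal strip
   can be added in the order of their contents.  A row with weights wt_V is the
   product V(y) of the factors 1 - y u_c in the reverse order; since u_c^2 = 0,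
   V(y) is the inverse of H(y).  So a super tableau sum is a matrix coefficient
   of a product of operators H and V, one for each label.  A row of B or B' is a
   row with weights wt_H or wt_V turned upside down; hence the rows of the
   Cauchy system split at the level between the two alphabets into two such
   matrix coefficients, the rows of B and B' being read from the bottom up, and
   lambda is the configuration at that level.  The reading order does not matter
   because the operators commute.

   It suffices that H(x) and H(y) commute.  In two consecutive rows, the two
   outer configurations determine how many of the two paths cross each column,
   so that only the columns crossed by one path leave a choice; the partial sums
   over these choices for the two orders of x and y satisfy a linear relation
   that is preserved when the rows are extended by a column.

   A given monomial m has nonzero coefficient only in states where the paths in
   the rows of A and A' are bounded, because each of their steps costs a factor
   x or y; the rows of B and B' only move particles back to the left.  So every
   state and every partition that contributes to m fits in a finite window,
   where the sums are finite. *)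
Require Import Defs.
From mathcomp Require Import all_boot all_order all_algebra.
From mathcomp Require Import ring zify.
From mathcomp Require boolp.

Set Implicit Arguments.
Unset Strict Implicit.
Unset Printing Implicit Defensive.

Import Order.TTheory GRing.Theory Num.Theory.

(** * Commutation of two rows *)

(** In the commutation of two rows, the terms for the various ways of sharing out the single paths
    do not match one by one when [x] and [y] are exchanged; only suitable sums do. A sharing is
    therefore a binary word, newest edge first, and the relation [Rel] between two coefficient
    functions is generated by what a column can prepend to the word. A column also consumes the
    oldest edge, so the relation must be readable from the other end ([Rel_pop]). There one term is
    related only after multiplication by a power of [q], which is why commutation is proved over an
    integral domain with [q] nonzero.

    On the side of the tableaux, all pairs (label, tail content) form one list and a tableau is
    taken apart from the end of this list. The point is that removing the ribbon with the last pair
    leaves a Young diagram: in a horizontal strip two ribbons keep their order along common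
    diagonals, and vertical strips follow by transposition, which reverses contents. Each pair thus
    stands for one factor [1 + z u_c]. *)

Section RowOperators.
Local Open Scope ring_scope.
Variables (R : comNzRingType) (q : R).
Implicit Types (x y z : R) (t b v w : seq bool) (phi : seq bool -> R).

(* [rowH x v t phi] is the sum of [phi b] weighted by the row of vertices with
   weights [wt_H] between the columns [t] (above) and [b] (below), where [true]
   is an up arrow; [v] holds the next [n] horizontal edges, [true] being a left
   arrow.  [rowV] is the same for [wt_V]. *)
Fixpoint rowH x v t phi {struct t} : R :=
  if t is a :: t' then
    let g := head false v in let v' := behead v in
    if a && g then 0
    else if a || g then
      q ^+ count id v' * (rowH x (rcons v' false) t' (phi \o cons true)
                          + x * rowH x (rcons v' true) t' (phi \o cons false))
    else rowH x (rcons v' false) t' (phi \o cons false)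
  else if has id v then 0 else phi [::].

Fixpoint rowV y v t phi {struct t} : R :=
  if t is a :: t' then
    let g := head false v in let v' := behead v in
    if a then
      (if g then 0 else q ^+ count id v' * rowV y (rcons v' false) t' (phi \o cons true))
      - y * rowV y (rcons v' true) t' (phi \o cons g)
    else rowV y (rcons v' false) t' (phi \o cons g)
  else if has id v then 0 else phi [::].

Lemma rowH_eq x v t phi psi :
  (forall b, size b = size t -> phi b = psi b) -> rowH x v t phi = rowH x v t psi.
Proof.
elim: t v phi psi => [|a t IH] v phi psi E /=; first by rewrite E.
have E1 c : forall b, size b = size t -> (phi \o cons c) b = (psi \o cons c) b.
  by move=> b sb; apply: E; rewrite /= sb.
by rewrite !(IH _ _ _ (E1 _)).
Qed.

Lemma rowHD x v t phi psi :
  rowH x v t (fun b => phi b + psi b) = rowH x v t phi + rowH x v t psi.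
Proof.
elim: t v phi psi => [|a t IH] v phi psi /=; first by case: has; rewrite ?addr0.
have E c w : rowH x w t ((fun b => phi b + psi b) \o cons c)
           = rowH x w t (phi \o cons c) + rowH x w t (psi \o cons c) by rewrite -IH.
rewrite !E; case: ifP => _; first by rewrite addr0.
by case: ifP => _ //; ring.
Qed.

Lemma rowHZ x v t k phi : rowH x v t (fun b => k * phi b) = k * rowH x v t phi.
Proof.
elim: t v phi => [|a t IH] v phi /=; first by case: has; rewrite ?mulr0.
have E c w : rowH x w t ((fun b => k * phi b) \o cons c)
           = k * rowH x w t (phi \o cons c) by rewrite -IH.
rewrite !E; case: ifP => _; first by rewrite mulr0.
by case: ifP => _ //; ring.
Qed.

Lemma rowH0 x v t : rowH x v t (fun=> 0) = 0.
Proof.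
rewrite -[RHS](mul0r (rowH x v t (fun=> 0))) -rowHZ.
by apply: rowH_eq => b _; rewrite mul0r.
Qed.

Lemma rowV_eq y v t phi psi :
  (forall b, size b = size t -> phi b = psi b) -> rowV y v t phi = rowV y v t psi.
Proof.
elim: t v phi psi => [|a t IH] v phi psi E /=; first by rewrite E.
have E1 c : forall b, size b = size t -> (phi \o cons c) b = (psi \o cons c) b.
  by move=> b sb; apply: E; rewrite /= sb.
by rewrite !(IH _ _ _ (E1 _)).
Qed.

End RowOperators.

Section Words.
Local Open Scope ring_scope.
Variable R : comNzRingType.
Implicit Types (F G : seq bool -> R) (w : seq bool).

Fixpoint wsum (m : nat) F : R :=
  if m is m'.+1 then wsum m' (F \o cons true) + wsum m' (F \o cons false) else F [::].

Lemma eq_wsum m F G : (forall w, size w = m -> F w = G w) -> wsum m F = wsum m G.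
Proof.
elim: m F G => [|m IH] F G E /=; first exact: E.
by congr (_ + _); apply: IH => w sw; apply: E; rewrite /= sw.
Qed.

Lemma wsumD m F G : wsum m (fun w => F w + G w) = wsum m F + wsum m G.
Proof.
elim: m F G => [|m IH] F G //=.
rewrite -[LHS]/(wsum m (fun w => F (true :: w) + G (true :: w))
               + wsum m (fun w => F (false :: w) + G (false :: w))) !IH /comp.
by ring.
Qed.

Lemma wsumZ m k F : wsum m (fun w => k * F w) = k * wsum m F.
Proof.
elim: m F => [|m IH] F //=.
rewrite -[LHS]/(wsum m (fun w => k * F (true :: w))
               + wsum m (fun w => k * F (false :: w))) !IH /comp.
by ring.
Qed.

Lemma wsum_rcons m F :
  wsum m.+1 F = wsum m (fun w => F (rcons w true)) + wsum m (fun w => F (rcons w false)).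
Proof.
elim: m F => [|m IH] F //.
rewrite -[LHS]/(wsum m.+1 (F \o cons true) + wsum m.+1 (F \o cons false)) (IH (F \o cons true)) (IH (F \o cons false)) /comp /=.
by ring.
Qed.

Lemma wsum_cons m F : wsum m.+1 F = wsum m (F \o cons true) + wsum m (F \o cons false).
Proof. by []. Qed.

End Words.

(** * Exchanging the parameters of two consecutive rows *)

Section Commutation.
Local Open Scope ring_scope.
Variables (R : idomainType) (q : R).
Hypothesis q0 : q != 0.
Implicit Types (x y : R) (f g : seq bool -> R) (w : seq bool).

Notation N1 w := (count id w).
Notation N2 w := (count negb w).

Lemma N12 w : (N1 w + N2 w)%N = size w.
Proof. by rewrite -(count_predC id w); congr addn; apply: eq_count. Qed.

Lemma sqr_exp k : (q ^+ 2) ^+ k = q ^+ k * q ^+ k.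
Proof. by rewrite -exprM mulnC exprM expr2. Qed.

(* [f w] and [f' w] are coefficients of the configurations in which the columns
   crossed by a single path are shared out as in the word [w] between the upper
   row and the lower one, when the rows have parameters [x, y] and [y, x]. *)
Fixpoint Rel x y (m : nat) f f' : Prop :=
  if m is m'.+1 then
    exists a a' b b', [/\ Rel x y m' a a', Rel x y m' b b' &
      forall w, size w = m' ->
        [/\ f (true :: w) = q ^+ N2 w * a w + x * q ^+ N1 w * b w,
            f (false :: w) = y * q ^+ m' * b w,
            f' (true :: w) = q ^+ N2 w * a' w + y * q ^+ N1 w * b' w
          & f' (false :: w) = x * q ^+ m' * b' w]]
  else f [::] = f' [::].

Lemma eq_Rel x y m f f' g g' :
  (forall w, size w = m -> f w = g w /\ f' w = g' w) ->
  Rel x y m f f' -> Rel x y m g g'.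
Proof.
case: m => [|m] E /=; first by have [<- <-] := E [::] erefl.
move=> [a [a' [b [b' [Ra Rb H]]]]]; exists a, a', b, b'; split=> // w sw.
have [<- <-] := E (true :: w) (congr1 S sw).
have [<- <-] := E (false :: w) (congr1 S sw).
exact: H.
Qed.

Lemma RelD x y m f f' g g' : Rel x y m f f' -> Rel x y m g g' ->
  Rel x y m (fun w => f w + g w) (fun w => f' w + g' w).
Proof.
elim: m f f' g g' => [|m IH] f f' g g' /=; first by move=> -> ->.
move=> [a [a' [b [b' [Ra Rb H]]]]] [c [c' [d [d' [Rc Rd K]]]]].
exists (fun w => a w + c w), (fun w => a' w + c' w),
       (fun w => b w + d w), (fun w => b' w + d' w).
split; [exact: IH | exact: IH | move=> w sw].
have [-> -> -> ->] := H w sw; have [-> -> -> ->] := K w sw.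
by split=> /=; ring.
Qed.

Lemma RelZ x y m k f f' : Rel x y m f f' ->
  Rel x y m (fun w => k * f w) (fun w => k * f' w).
Proof.
elim: m f f' => [|m IH] f f' /=; first by move=> ->.
move=> [a [a' [b [b' [Ra Rb H]]]]].
exists (fun w => k * a w), (fun w => k * a' w), (fun w => k * b w), (fun w => k * b' w).
split; [exact: IH | exact: IH | move=> w sw].
have [-> -> -> ->] := H w sw.
by split=> /=; ring.
Qed.

(** The two generators of [Rel]: functions related on words of length [m.+1] are sums of a
    [single_a] and a [single_b] of functions related on words of length [m]. In [single_a] the path
    on the new edge is in the upper row; in [single_b] it may be in either row, at the cost of that
    row's parameter. *)
Definition single_a f w := if w is true :: w' then q ^+ N2 w' * f w' else 0.
Definition single_b x y f w :=
  match w with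
  | true :: w' => x * q ^+ N1 w' * f w'
  | false :: w' => y * q ^+ size w' * f w'
  | [::] => 0
  end.

Lemma Rel_a x y m f f' : Rel x y m f f' ->
  Rel x y m.+1 (single_a f) (single_a f').
Proof.
move=> H; exists f, f', (fun=> 0), (fun=> 0); split=> //.
  suff: Rel x y m (fun w => 0 * f w) (fun w => 0 * f' w).
    by apply: eq_Rel => w _; rewrite !mul0r.
  exact: RelZ.
by move=> w sw; split=> /=; ring.
Qed.

Lemma Rel_b x y m f f' : Rel x y m f f' ->
  Rel x y m.+1 (single_b x y f) (single_b y x f').
Proof.
move=> H; exists (fun=> 0), (fun=> 0), f, f'; split=> //.
  suff: Rel x y m (fun w => 0 * f w) (fun w => 0 * f' w).
    by apply: eq_Rel => w _; rewrite !mul0r.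
  exact: RelZ.
by move=> w sw; split=> /=; rewrite ?sw; ring.
Qed.

(** [Rel] is built from the newest edge, the first letter, but the edge that reaches the next column
    is the oldest one, the last letter. Read from that end, [g] is what remains of [f] on the words
    ending in [false]. The second term in the last pair is [q ^+ N2 w * f (rcons w false)], so this
    pair combines the two possible last letters as needed in [chain_0_1]. *)
Lemma Rel_pop x y m f f' : Rel x y m.+1 f f' ->
  exists g g', [/\ Rel x y m g g',
    forall w, size w = m -> f (rcons w false) = y * q ^+ N2 w * g w /\
                            f' (rcons w false) = x * q ^+ N2 w * g' w &
    Rel x y m (fun w => q ^+ m * f (rcons w true) + y * (q ^+ 2) ^+ N2 w * g w)
              (fun w => q ^+ m * f' (rcons w true) + x * (q ^+ 2) ^+ N2 w * g' w)].
Proof.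
elim: m f f' => [|m IH] f f'.
  move=> [a [a' [b [b' [Ra Rb /(_ [::] erefl)[F1 F2 F1' F2']]]]]].
  exists b, b'; split=> //.
    by case=> // _; rewrite /= F2 F2'; split; ring.
  by move: Ra Rb; rewrite /= F1 F1' /= => -> ->; ring.
move=> [a [a' [b [b' [/IH[ga [ga' [Rga Fa Ia]]] /IH[gb [gb' [Rgb Fb Ib]]] H]]]]].
(* The factor [q] comes from the popped letter [false], which counts once more in the exponent [N2]
   of [single_a]. *)
exists (fun w => q * single_a ga w + single_b x y gb w),
       (fun w => q * single_a ga' w + single_b y x gb' w).
split.
- by apply: RelD; [apply/RelZ/Rel_a | apply/Rel_b].
- case=> [//|c w] /= [sw]; have {}sw' : size (rcons w false) = m.+1 by rewrite size_rcons sw.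
  have [F1 F2 F1' F2'] := H (rcons w false) sw'.
  have [Fa1 Fa2] := Fa w sw; have [Fb1 Fb2] := Fb w sw.
  case: c; rewrite /= ?F1 ?F1' ?F2 ?F2' ?Fa1 ?Fa2 ?Fb1 ?Fb2 -?cats1 ?count_cat /= ?sw.
    by split; rewrite !addn0 !add0n !exprD !expr1; ring.
  by split; rewrite !exprD !exprS; ring.
- have HH := RelD (RelZ q (Rel_a Ia)) (RelD (RelZ (q ^+ 2) (Rel_b Ib))
     (RelZ ((1 - q ^+ 2) * (x * y) * q ^+ m) (Rel_a Rgb))).
  apply: eq_Rel HH => w; case: w => [//|c w] /= [sw].
  have sw' : size (rcons w true) = m.+1 by rewrite size_rcons sw.
  have [F1 F2 F1' F2'] := H (rcons w true) sw'.
  have mE : q ^+ m = q ^+ N1 w * q ^+ N2 w by rewrite -exprD N12 sw.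
  case: c; rewrite /= ?F1 ?F1' ?F2 ?F2' -?cats1 ?count_cat /= ?sw ?addn0 ?add0n ?addn1 ?add1n.
    by split; rewrite !sqr_exp !(exprS _ m) !mE !exprS; ring.
  by split; rewrite !sqr_exp !exprS; ring.
Qed.

(* [K] lists, for each of the pending edges (the newest first), the number of the
   two rows that have a path there; [w] tells for the edges with one path whether
   it is in the upper row. *)
Fixpoint win1 (K : seq nat) w : seq bool :=
  if K is k :: K' then
    if k == 1 then head false w :: win1 K' (behead w) else (1 < k)%N :: win1 K' w
  else [::].

Fixpoint win2 (K : seq nat) w : seq bool :=
  if K is k :: K' then
    if k == 1 then ~~ head false w :: win2 K' (behead w) else (1 < k)%N :: win2 K' w
  else [::].

Notation nsingle K := (count (pred1 1) K).
Notation ndouble K := (count [pred k | 1 < k]%N K).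

Lemma win_rcons K k w : size w = nsingle K -> k != 1 ->
  win1 (rcons K k) w = rcons (win1 K w) (1 < k)%N /\
  win2 (rcons K k) w = rcons (win2 K w) (1 < k)%N.
Proof.
move=> sw /negbTE k1; elim: K w sw => [|k' K IH] w /=; first by rewrite k1.
case: eqP => [_|_]; last by move=> /IH[-> ->].
by case: w => //= c w [/IH[-> ->]].
Qed.

Lemma win_rcons1 K w c : size w = nsingle K ->
  win1 (rcons K 1%N) (rcons w c) = rcons (win1 K w) c /\
  win2 (rcons K 1%N) (rcons w c) = rcons (win2 K w) (~~ c).
Proof.
elim: K w => [|k' K IH] w /=; first by case: w.
case: eqP => [_|_]; last by move=> /IH[-> ->].
by case: w => //= d w [/IH[-> ->]].
Qed.

Lemma count_win K w : size w = nsingle K ->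
  count id (win1 K w) = (N1 w + ndouble K)%N /\
  count id (win2 K w) = (N2 w + ndouble K)%N.
Proof.
elim: K w => [|k K IH] w /=; first by case: w.
case: eqP => [->|_] /=; first by case: w => //= c w [/IH[-> ->]]; lia.
by move=> /IH[-> ->]; lia.
Qed.

Implicit Types (K : seq nat) (t v : seq bool) (phi : seq bool -> R).

Section TwoRows.
Variables x y : R.

Definition tworow v1 v2 t phi := rowH q x v1 t (fun b => rowH q y v2 b phi).

Lemma rowH_split v2 v t k F phi1 phi0 :
  (forall b, F b = k * (rowH q y (rcons v2 false) b phi1
                        + y * rowH q y (rcons v2 true) b phi0)) ->
  rowH q x v t F = k * (tworow v (rcons v2 false) t phi1
                        + y * tworow v (rcons v2 true) t phi0).
Proof.
move=> E; rewrite (@rowH_eq _ q x v t F (fun b => k * (rowH q y (rcons v2 false) b phi1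
    + y * rowH q y (rcons v2 true) b phi0))); last by move=> b _; apply: E.
by rewrite rowHZ rowHD rowHZ.
Qed.

Lemma rowH_zero v t F : (forall b, F b = 0) -> rowH q x v t F = 0.
Proof. by move=> E; rewrite (@rowH_eq _ q x v t F (fun=> 0)) ?rowH0. Qed.

Lemma tworow_0_00 v1 v2 t phi : tworow (false :: v1) (false :: v2) (false :: t) phi
  = tworow (rcons v1 false) (rcons v2 false) t (phi \o cons false).
Proof. by []. Qed.

Lemma tworow_0_01 v1 v2 t phi : tworow (false :: v1) (true :: v2) (false :: t) phi
  = q ^+ count id v2 * (tworow (rcons v1 false) (rcons v2 false) t (phi \o cons true)
     + y * tworow (rcons v1 false) (rcons v2 true) t (phi \o cons false)).
Proof. by rewrite /tworow [LHS]/=; apply: rowH_split => b. Qed.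

Lemma tworow_1 (a g : bool) v1 v2 t phi : a (+) g ->
  tworow (g :: v1) (false :: v2) (a :: t) phi
  = q ^+ count id v1 *
    (q ^+ count id v2 * (tworow (rcons v1 false) (rcons v2 false) t (phi \o cons true)
     + y * tworow (rcons v1 false) (rcons v2 true) t (phi \o cons false))
     + x * tworow (rcons v1 true) (rcons v2 false) t (phi \o cons false)).
Proof.
move=> ag; rewrite /tworow [LHS]/=.
have -> : a && g = false by case: a g ag => [] [].
have -> : a || g by case: a g ag => [] [].
congr (_ * (_ + _)); exact: rowH_split.
Qed.

Lemma tworow_2 (a g : bool) v1 v2 t phi : a (+) g ->
  tworow (g :: v1) (true :: v2) (a :: t) phi
  = q ^+ count id v1 * (x *
    (q ^+ count id v2 * (tworow (rcons v1 true) (rcons v2 false) t (phi \o cons true)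
     + y * tworow (rcons v1 true) (rcons v2 true) t (phi \o cons false)))).
Proof.
move=> ag; rewrite /tworow [LHS]/=.
have -> : a && g = false by case: a g ag => [] [].
have -> : a || g by case: a g ag => [] [].
rewrite rowH_zero ?add0r //; congr (_ * (_ * _)); exact: rowH_split.
Qed.

Lemma tworow_11 v1 v2 t phi : tworow (true :: v1) v2 (true :: t) phi = 0.
Proof. by []. Qed.

Definition tw K w t phi := tworow (rev (win1 K w)) (rev (win2 K w)) t phi.

(** A normalization that makes the scalars in the column recurrences below symmetric in [x] and [y].
    When an edge with two paths is followed by one with a single path, only the upper path goes on
    and the factor is [x] alone; the power of [y] completes it to [x * y]. *)
Definition gauge K w := y ^+ ndouble K * q ^+ (ndouble K * N2 w).

(** A linear combination, over the ways [w] to share out the single pending paths, of the weights of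
    the two rows from the current column on. The recurrences [chain_a_k] consume one column with top
    entry [a] whose incoming edge carries [k] paths. *)
Definition chain K f t phi := wsum (nsingle K) (fun w => gauge K w * f w * tw K w t phi).

Lemma chainZ K k f t phi : chain K (fun w => k * f w) t phi = k * chain K f t phi.
Proof. by rewrite -wsumZ; apply: eq_wsum => w _; ring. Qed.

Lemma count_rev_win K w : size w = nsingle K ->
  (count id (rev (win1 K w)) = N1 w + ndouble K)%N /\
  (count id (rev (win2 K w)) = N2 w + ndouble K)%N.
Proof. by move=> /count_win; rewrite !count_rev. Qed.

Lemma count_rconsE (T : Type) (p : pred T) s z : count p (rcons s z) = (p z + count p s)%N.
Proof. by rewrite -cats1 count_cat /= addn0 addnC. Qed.

Definition total K := (nsingle K + ndouble K * 2)%N.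

Lemma chain_0_0 K f t phi :
  chain (rcons K 0%N) f (false :: t) phi = chain (0%N :: K) f t (phi \o cons false).
Proof.
rewrite /chain !count_rconsE; apply: eq_wsum => w sw.
rewrite /tw /gauge !count_rconsE; have [-> ->] := @win_rcons K 0%N w sw isT.
by rewrite /= !rev_rcons tworow_0_00 !rev_cons.
Qed.

Lemma chain_1_0 K f t phi :
  chain (rcons K 0%N) f (true :: t) phi
  = q ^+ total K * chain (0%N :: K) f t (phi \o cons true)
    + q ^+ ndouble K * chain (1%N :: K) (single_b x y f) t (phi \o cons false).
Proof.
rewrite /chain !count_rconsE wsum_cons -wsumD -!wsumZ -wsumD.
apply: eq_wsum => w sw'; have {sw'}sw : size w = nsingle K := sw'; have [C1 C2] := count_rev_win sw.
rewrite /tw /gauge !count_rconsE; have [-> ->] := @win_rcons K 0%N w sw isT.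
rewrite /= !rev_rcons tworow_1 // !rev_cons C1 C2 /total -sw -N12 add0n add1n.
by rewrite !muln2 -!addnn ?mulnS ?mulSn ?(exprS, exprD); ring.
Qed.

Lemma chain_0_1 K f t phi :
  chain (rcons K 1%N) f (false :: t) phi
  = q ^+ (ndouble K * 2) * chain (0%N :: K)
      (fun w => q ^+ nsingle K * f (rcons w true) + q ^+ N2 w * f (rcons w false))
      t (phi \o cons true)
    + q ^+ ndouble K * chain (1%N :: K)
      (fun w => single_b x y (fun w => f (rcons w true)) w
        + if w is false :: w' then y * q ^+ N2 w' * f (rcons w' false) else 0)
      t (phi \o cons false).
Proof.
rewrite /chain !count_rconsE wsum_rcons [X in _ + q ^+ _ * X]wsum_cons -!wsumD -!wsumZ -wsumD.
apply: eq_wsum => w sw'; have {sw'}sw : size w = nsingle K := sw'; have [C1 C2] := count_rev_win sw.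
rewrite /tw /gauge !count_rconsE.
have [-> ->] := @win_rcons1 K w true sw; have [-> ->] := @win_rcons1 K w false sw.
rewrite /= !rev_rcons tworow_1 // tworow_0_01 !rev_cons C1 C2 -sw -N12 add0n add1n !addr0.
by rewrite !muln2 -!addnn ?mulnS ?mulSn ?(exprS, exprD); ring.
Qed.

Lemma chain_1_1 K f g t phi :
  (forall w, size w = nsingle K -> f (rcons w false) = y * q ^+ N2 w * g w) ->
  chain (rcons K 1%N) f (true :: t) phi
  = q ^+ (ndouble K + total K) * (x * y) * chain (1%N :: K) (single_a g) t (phi \o cons true)
    + q ^+ (ndouble K + total K) * (x * y) * chain (2%N :: K) g t (phi \o cons false).
Proof.
move=> E; rewrite /chain !count_rconsE wsum_rcons [X in _ = _ * X + _]wsum_cons -!wsumD -!wsumZ -wsumD.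
apply: eq_wsum => w sw'; have {sw'}sw : size w = nsingle K := sw'; have [C1 C2] := count_rev_win sw.
rewrite /tw /gauge !count_rconsE.
have [-> ->] := @win_rcons1 K w true sw; have [-> ->] := @win_rcons1 K w false sw.
rewrite /= !rev_rcons tworow_11 tworow_2 // !rev_cons C1 C2 /total E // -sw -N12 add0n add1n.
by rewrite !muln2 -!addnn ?mulnS ?mulSn ?(exprS, exprD); ring.
Qed.

Lemma chain_0_2 K k f t phi :
  chain (rcons K k.+2) f (false :: t) phi
  = q ^+ total K * (x * y) * chain (1%N :: K) (single_a f) t (phi \o cons true)
    + q ^+ total K * (x * y) * chain (2%N :: K) f t (phi \o cons false).
Proof.
rewrite /chain !count_rconsE [X in _ = _ * X + _]wsum_cons -!wsumD -!wsumZ -wsumD.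
apply: eq_wsum => w sw'; have {sw'}sw : size w = nsingle K := sw'; have [C1 C2] := count_rev_win sw.
rewrite /tw /gauge !count_rconsE; have [-> ->] := @win_rcons K k.+2 w sw isT.
rewrite /= !rev_rcons tworow_2 // !rev_cons C1 C2 /total -sw -N12 add1n add0n.
by rewrite !muln2 -!addnn ?mulnS ?mulSn ?(exprS, exprD); ring.
Qed.

Lemma chain_1_2 K k f t phi : chain (rcons K k.+2) f (true :: t) phi = 0.
Proof.
rewrite -[RHS](mul0r (chain (rcons K k.+2) f (true :: t) phi)) -wsumZ.
rewrite /chain count_rconsE; apply: eq_wsum => w sw.
rewrite /tw; have [-> ->] := @win_rcons K k.+2 w sw isT.
by rewrite /= !rev_rcons tworow_11 mulr0 mul0r.
Qed.

End TwoRows.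

(** Induction on the columns: each recurrence leads to chains over one column less, with symmetric
    scalars and with coefficients that are related again by [Rel_a], [Rel_b] and [Rel_pop]. At the
    right end only pending edges without paths contribute, and there [Rel] is the equality of two
    scalars. *)
Lemma chain_sym x y K f f' t phi : K != [::] -> Rel x y (nsingle K) f f' ->
  chain x y K f t phi = chain y x K f' t phi.
Proof.
elim: t K f f' phi => [|a t IH] K f f' phi; case/lastP: K => // K k _.
  case: (eqVneq (all (pred1 0%N) (rcons K k)) true) => [K0|K0].
    have s0 : nsingle (rcons K k) = 0%N.
      by apply/eqP; rewrite -leqn0 leqNgt -has_count; apply/negP => /hasP[z zK /eqP z1];
         move/allP/(_ z zK)/eqP: K0; rewrite /= in z1 *; lia.
    have d0 : ndouble (rcons K k) = 0%N.
      by apply/eqP; rewrite -leqn0 leqNgt -has_count; apply/negP => /hasP[z zK /= z1];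
         move/allP/(_ z zK)/eqP: K0; rewrite /= in z1 *; lia.
    rewrite /chain s0 /= /gauge d0 => ->; rewrite /tw /tworow /= ?mul0n ?expr0 ?mul1r.
    have [C1 C2] := @count_win (rcons K k) [::] (esym s0).
    by rewrite !has_count !count_rev C1 C2 d0.
  move=> _; rewrite /chain.
  have Z (u u' : R) w : size w = nsingle (rcons K k) -> tw u u' (rcons K k) w [::] phi = 0.
    move=> sw; have [C1 C2] := count_win sw.
    rewrite /tw /tworow /= !has_count !count_rev C1 C2.
    case: ifP => // /negbT H1; case: ifP => // /negbT H2; case/negP: K0; apply/eqP/allP => z zK.
    have [c1 c2] : (nsingle (rcons K k) = 0 /\ ndouble (rcons K k) = 0)%N.
      by move: (N12 w); rewrite sw; move: H1 H2; lia.
    have h1 : ~~ has (pred1 1%N) (rcons K k) by rewrite has_count c1.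
    have h2 : ~~ has [pred k | 1 < k]%N (rcons K k) by rewrite has_count c2.
    by move/hasPn/(_ z zK): h1; move/hasPn/(_ z zK): h2; case: z {zK} => [|[|]].
  by rewrite !(@eq_wsum _ _ _ (fun=> 0)) // => w sw; rewrite Z // mulr0.
have q_neq0 i : q ^+ i != 0 by rewrite expf_neq0.
case: k => [|[|k]]; rewrite count_rconsE => rel.
- case: a; last by rewrite !chain_0_0; apply: IH.
  rewrite !chain_1_0; congr (_ * _ + _ * _); first exact: IH.
  by apply: IH => //; apply: Rel_b.
- have [g [g' [Rg E Rp]]] := Rel_pop rel.
  have E1 w : size w = nsingle K -> f (rcons w false) = y * q ^+ N2 w * g w by case/E.
  have E2 w : size w = nsingle K -> f' (rcons w false) = x * q ^+ N2 w * g' w by case/E.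
  case: a.
    rewrite (chain_1_1 _ _ _ E1) (chain_1_1 _ _ _ E2) (mulrC y x).
    congr (_ * _ + _ * _); last exact: IH.
    by apply: IH => //; apply: Rel_a.
  rewrite !chain_0_1; congr (_ * _ + _ * _).
    apply: IH => //; apply: eq_Rel Rp => w /E[-> ->]; rewrite sqr_exp.
    by split; ring.
  (* Only [q ^+ nsingle K] times the new coefficient is a combination of functions already known to
     be related, so this nonzero power is introduced on both sides. *)
  apply: (mulfI (q_neq0 (nsingle K))); rewrite -!chainZ; apply: IH => //.
  apply: eq_Rel (RelD (Rel_b Rp) (RelZ (- (x * y) * q ^+ nsingle K) (Rel_a Rg))).
  case=> // c w [sw]; case: c; rewrite /= ?addr0.
    rewrite sqr_exp; have -> : q ^+ nsingle K = q ^+ N1 w * q ^+ N2 w by rewrite -exprD N12 sw.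
    by split; ring.
  by case: (E w sw) => -> ->; rewrite sqr_exp sw; split; ring.
- case: a; first by rewrite !chain_1_2.
  rewrite !chain_0_2 (mulrC y x); congr (_ * _ + _ * _); last exact: IH.
  by apply: IH => //; apply: Rel_a.
Qed.
End Commutation.

(** * Rows as products of elementary operators *)

Section Steps.
Local Open Scope ring_scope.
Variable p : nat.
Notation n := p.+1.
Implicit Types (t b v w : seq bool) (c : nat).

Definition can_step c t :=
  [&& nth false t c, (c + n < size t)%N & ~~ nth false t (c + n)].
Definition jump c t := count id (take p (drop c.+1 t)).
Definition move c t := set_nth false (set_nth false t c false) (c + n) true.

Lemma can_step_lt c t : can_step c t -> (c + n < size t)%N.
Proof. by case/and3P. Qed.

Lemma size_move c t : can_step c t -> size (move c t) = size t.
Proof.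
by move=> /can_step_lt ct; rewrite /move !size_set_nth; move: ct; lia.
Qed.

Section Operator.
Variables (R : comNzRingType) (q : R).
Implicit Types (phi psi : seq bool -> R) (z : R) (s : seq nat).

(* The operator 1 + z u_c; [move] adds an n-ribbon and [jump] is its spin. *)
Definition step z c phi t : R :=
  phi t + (if can_step c t then z * q ^+ jump c t * phi (move c t) else 0).

Definition steps z s phi : seq bool -> R := foldr (step z) phi s.

Lemma steps_cons z c s phi : steps z (c :: s) phi = step z c (steps z s phi).
Proof. by []. Qed.

Lemma steps_rcons z c s phi : steps z (rcons s c) phi = steps z s (step z c phi).
Proof. exact: foldr_rcons. Qed.

Lemma step_eq z c phi psi t : (forall b, size b = size t -> phi b = psi b) ->
  step z c phi t = step z c psi t.
Proof.
by move=> E; rewrite /step E //; case: ifP => // ct; rewrite E // size_move.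
Qed.

Lemma steps_eq z s phi psi t : (forall b, size b = size t -> phi b = psi b) ->
  steps z s phi t = steps z s psi t.
Proof.
move=> E; suff: forall b, size b = size t -> steps z s phi b = steps z s psi b by apply.
elim: s => //= c s IH b sb; apply: step_eq => b' sb'.
by apply: IH; rewrite sb'.
Qed.

Lemma stepD z c phi psi t :
  step z c (fun b => phi b + psi b) t = step z c phi t + step z c psi t.
Proof. by rewrite /step; case: ifP => _; ring. Qed.

Lemma stepZ z c k phi t : step z c (fun b => k * phi b) t = k * step z c phi t.
Proof. by rewrite /step; case: ifP => _; ring. Qed.

Lemma stepsD z s phi psi t :
  steps z s (fun b => phi b + psi b) t = steps z s phi t + steps z s psi t.
Proof.
elim: s t => //= c s IH t; rewrite -stepD; apply: step_eq => b _; exact: IH.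
Qed.

Lemma stepsZ z s k phi t : steps z s (fun b => k * phi b) t = k * steps z s phi t.
Proof.
elim: s t => //= c s IH t; rewrite -stepZ; apply: step_eq => b _; exact: IH.
Qed.

Lemma step_behead z c phi a t : step z c.+1 phi (a :: t) = step z c (phi \o cons a) t.
Proof. by []. Qed.

Lemma steps_behead z s phi a t :
  steps z (map succn s) phi (a :: t) = steps z s (phi \o cons a) t.
Proof.
elim: s t => //= c s IH t; rewrite step_behead; apply: step_eq => b _ /=; exact: IH.
Qed.

(* A second step from the same column is impossible, so [step] squares to 0. *)
Lemma stepK z c phi t : step z c (step (- z) c phi) t = phi t.
Proof.
rewrite /step; case: ifP => [ct|_]; last by rewrite !addr0.
have -> : can_step c (move c t) = false.
  apply/and3P => -[]; rewrite /move nth_set_nth /= ifN; last by lia.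
  by rewrite nth_set_nth /= eqxx.
by ring.
Qed.

Lemma stepsK z s phi t : steps z s (steps (- z) (rev s) phi) t = phi t.
Proof.
elim: s t phi => //= c s IH t phi; rewrite rev_cons.
rewrite -(stepK z c phi t); apply: step_eq => b sb.
by rewrite -(IH b (step (- z) c phi)); apply: steps_eq => b' _; rewrite steps_rcons.
Qed.

(** A pending path is a particle in flight: [join v t] lets the paths in [v] land on the first
    columns of [t], [disj v t] says that these places exist and are free, and [cross v t] counts the
    pairs of a path and a particle of [t] over which it passes. *)
Fixpoint disj v t : bool :=
  match v, t with
  | [::], _ => true
  | g :: v', [::] => ~~ has id v
  | g :: v', a :: t' => ~~ (a && g) && disj v' t'
  end.

Fixpoint join v t : seq bool :=
  match v, t with
  | g :: v', a :: t' => (a || g) :: join v' t'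
  | _, _ => t
  end.

Fixpoint cross v t : nat :=
  match v, t with
  | g :: v', a :: t' => (a * count id v' + cross v' t')%N
  | _, _ => 0%N
  end.

Lemma size_join v t : size (join v t) = size t.
Proof. by elim: v t => [|g v IH] [|a t] //=; rewrite IH. Qed.

Lemma disj_nil v : disj v [::] = ~~ has id v. Proof. by case: v. Qed.

Lemma join_nil v : join v [::] = [::]. Proof. by case: v. Qed.

Lemma cross_nil v : cross v [::] = 0%N. Proof. by case: v. Qed.

Lemma disj_rcons0 v t : disj (rcons v false) t = disj v t.
Proof.
elim: v t => [|g v IH] [|a t] //=; rewrite ?andbF ?IH //.
by rewrite has_rcons.
Qed.

Lemma join_rcons0 v t : join (rcons v false) t = join v t.
Proof. by elim: v t => [|g v IH] [|a t] //=; rewrite ?orbF ?IH //. Qed.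

Lemma cross_rcons0 v t : cross (rcons v false) t = cross v t.
Proof.
elim: v t => [|g v IH] [|a t] //=; first by rewrite muln0 addn0.
by rewrite IH -cats1 count_cat /= !addn0.
Qed.

Lemma disj_rcons1 v t : disj (rcons v true) t =
  [&& disj v t, (size v < size t)%N & ~~ nth false t (size v)].
Proof.
elim: v t => [|g v IH] [|a t] //=; rewrite ?andbT ?andbF ?IH ?andbA //.
by rewrite has_rcons orbT ?andbF.
Qed.

Lemma join_rcons1 v t : (size v < size t)%N ->
  join (rcons v true) t = set_nth false (join v t) (size v) true.
Proof.
elim: v t => [|g v IH] [|a t] //= st; first by rewrite orbT; case: t {st}.
by rewrite IH.
Qed.

Lemma nth_join v t c : (size v <= c)%N -> nth false (join v t) c = nth false t c.
Proof. by elim: v t c => [|g v IH] [|a t] [|c] //= sv; rewrite IH. Qed.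

(** Like [cross], except that a path also passes over the paths landing before it: in a row of [H]
    the jumps are made from left to right, so those particles are already in place. *)
Fixpoint crossj v t : nat :=
  match v, t with
  | g :: v', a :: t' => ((a || g) * count id v' + crossj v' t')%N
  | _, _ => 0%N
  end.

Lemma crossj_rcons0 v t : crossj (rcons v false) t = crossj v t.
Proof.
elim: v t => [|g v IH] [|a t] //=; first by rewrite muln0 addn0.
by rewrite IH -cats1 count_cat /= !addn0.
Qed.

Lemma crossj_rcons1 v t : (size v < size t)%N ->
  crossj (rcons v true) t = (crossj v t + count id (take (size v) (join v t)))%N.
Proof.
elim: v t => [|g v IH] [|a t] //= st; first by rewrite muln0; case: t {st}.
by rewrite IH // -cats1 count_cat /= addn0 mulnDr muln1; lia.
Qed.

Lemma iota0S N : iota 0 N.+1 = 0%N :: map succn (iota 0 N).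
Proof. by rewrite /= -[1%N]/(1 + 0)%N iotaDl. Qed.

(** The induction needs arbitrary pending paths. As jumps are made from left to right, these may be
    treated as landed before any jump from [t], provided that [crossj] collects the crossings for
    which they still have to pay. *)
Lemma rowH_steps x v t phi N : size v = n -> (size t <= N)%N ->
  rowH q x v t phi =
  if disj v t then q ^+ crossj v t * steps x (iota 0 N) phi (join v t) else 0.
Proof.
elim: t v phi N => [|a t IH] v phi N sv sN.
  rewrite /= disj_nil join_nil; case: has => //=.
  have -> : crossj v [::] = 0%N by case: v {sv}.
  rewrite mul1r; elim: (iota 0 N) => // c s E.
  by rewrite steps_cons /step /can_step nth_nil /= addr0 -E.
case: v sv => // g v [sv]; case: N sN => // N; rewrite ltnS => sN.
have s0 : size (rcons v false) = n by rewrite size_rcons sv.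
have s1 : size (rcons v true) = n by rewrite size_rcons sv.
rewrite [LHS]/= [disj _ _]/= [join _ _]/= [crossj _ _]/=.
rewrite iota0S steps_cons /step !steps_behead.
case: ifP => [//|ag /=].
rewrite (IH _ _ N s0 sN) (IH _ _ N s0 sN) (IH _ _ N s1 sN).
rewrite disj_rcons0 join_rcons0 crossj_rcons0 disj_rcons1.
case: (disj v t) => /=; last by rewrite !(mulr0, addr0) if_same.
rewrite /can_step /jump /= add0n drop0 size_join nth_join ?sv //.
case: (a || g) => /=; last by rewrite mul0n add0n addr0.
rewrite ltnS; case: ltnP => [pt|_] /=; last by rewrite mulr0 !addr0 mul1n exprD mulrA.
case: (nth false t p) => /=; first by rewrite mulr0 !addr0 mul1n exprD mulrA.
rewrite join_rcons1 ?sv // crossj_rcons1 ?sv // mul1n !exprD.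
by ring.
Qed.

Lemma cross_rcons1 v t : (size v < size t)%N ->
  cross (rcons v true) t = (cross v t + count id (take (size v) t))%N.
Proof.
elim: v t => [|g v IH] [|a t] //= st; first by rewrite muln0; case: t {st}.
by rewrite IH // -cats1 count_cat /= addn0 mulnDr muln1; lia.
Qed.

(** In a row of [V] the jumps are made from right to left, so the pending paths, launched further
    left, land after all jumps from [t] and on what these leave. *)
Definition land v phi t : R :=
  if disj v t then q ^+ cross v t * phi (join v t) else 0.

Lemma set_nthE v t a : (size v < size t)%N ->
  [/\ disj v (set_nth false t (size v) a) = disj v t,
      join v (set_nth false t (size v) a) = set_nth false (join v t) (size v) a &
      cross v (set_nth false t (size v) a) = cross v t].
Proof.
elim: v t => [|g v IH] [|b t] //= st.
by have [-> -> ->] := IH t st.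
Qed.

Lemma rowV_steps y v t phi N : size v = n -> (size t <= N)%N ->
  rowV q y v t phi = steps (- y) (rev (iota 0 N)) (land v phi) t.
Proof.
elim: t v phi N => [|a t IH] v phi N sv sN.
  have -> : steps (- y) (rev (iota 0 N)) (land v phi) [::] = land v phi [::].
    elim: (rev _) => // c s E.
    by rewrite steps_cons /step /can_step nth_nil /= addr0 E.
  by rewrite /= /land disj_nil join_nil cross_nil mul1r; case: has.
case: v sv => // g v [sv]; case: N sN => // N; rewrite ltnS => sN.
have s0 : size (rcons v false) = n by rewrite size_rcons sv.
have s1 : size (rcons v true) = n by rewrite size_rcons sv.
rewrite [LHS]/= iota0S rev_cons -map_rev steps_rcons steps_behead.
rewrite (IH _ _ N s0 sN) (IH _ _ N s0 sN) (IH _ _ N s1 sN).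
set s := rev _.
(* The jump from column 0 is the last one before landing. Either the particle [a] stays, which
   excludes [g], or it jumps and joins the pending paths, and then [g] may land in its place. *)
have E b : (step (- y) 0 (land (g :: v) phi) \o cons a) b =
   (if a && g then 0 else q ^+ (a * count id v) * land (rcons v false) (phi \o cons (a || g)) b)
   + a%:R * - y * land (rcons v true) (phi \o cons g) b.
  rewrite /step [LHS]/= /land /can_step /jump disj_rcons0 join_rcons0 cross_rcons0 disj_rcons1 /=.
  rewrite drop0 sv add0n; congr (_ + _).
    by case: (a && g) => //=; case: ifP => _; rewrite ?mulr0 // exprD mulrA.
  case: a => /=; last by rewrite !mul0r.
  rewrite ltnS; case: ltnP => [pt|_] /=; last by rewrite andbF mulr0.
  case: (nth false b p) => /=; first by rewrite andbF mulr0.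
  rewrite andbT; have := @set_nthE v b true; rewrite sv => /(_ pt)[-> -> ->].
  case: ifP => _; last by rewrite !mulr0.
  by rewrite join_rcons1 ?sv // cross_rcons1 ?sv // mul0n add0n exprD mul1r; ring.
rewrite (steps_eq _ _ (fun b _ => E b)) stepsD stepsZ.
case: a {E} => /=.
  rewrite mul1r mulNr; congr (_ - _); case: g => /=; last by rewrite mul1n stepsZ.
  rewrite -[LHS](mul0r (steps (- y) s (fun=> 0) t)) -stepsZ.
  by apply: steps_eq => b _; rewrite mul0r.
by rewrite !mul0r addr0 mul0n expr0 stepsZ mul1r.
Qed.

(* [rowop N (inl x)] and [rowop N (inr y)] are the row operators of [wt_H] and
   [wt_V]. *)
Definition rowop (N : nat) (l : R + R) phi : seq bool -> R :=
  match l with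
  | inl x => steps x (iota 0 N) phi
  | inr y => steps (- y) (rev (iota 0 N)) phi
  end.

Lemma rowop_eq N l phi psi t : (forall b, size b = size t -> phi b = psi b) ->
  rowop N l phi t = rowop N l psi t.
Proof. by case: l => z E; apply: steps_eq. Qed.

End Operator.
End Steps.

Section EmptyWindow.
Local Open Scope ring_scope.
Variables (p : nat) (R : comNzRingType) (q : R).
Notation n := p.+1.
Implicit Types (t : seq bool) (phi : seq bool -> R).

Lemma disj_empty k t : disj (nseq k false) t.
Proof. by elim: k t => [|k IH] [|a t] //=; rewrite ?andbF ?IH //= has_nseq andbF. Qed.

Lemma join_empty k t : join (nseq k false) t = t.
Proof. by elim: k t => [|k IH] [|a t] //=; rewrite orbF IH. Qed.

Lemma cross_empty k t : cross (nseq k false) t = 0%N.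
Proof. by elim: k t => [|k IH] [|a t] //=; rewrite IH count_nseq muln0. Qed.

Lemma crossj_empty k t : crossj (nseq k false) t = 0%N.
Proof. by elim: k t => [|k IH] [|a t] //=; rewrite IH count_nseq muln0. Qed.

Lemma rowH_stepsE x t phi N : (size t <= N)%N ->
  rowH q x (nseq n false) t phi = steps p q x (iota 0 N) phi t.
Proof.
move=> sN; rewrite (@rowH_steps p _ _ _ _ _ _ N) ?size_nseq //.
by rewrite disj_empty crossj_empty join_empty mul1r.
Qed.

Lemma rowV_stepsE y t phi N : (size t <= N)%N ->
  rowV q y (nseq n false) t phi = steps p q (- y) (rev (iota 0 N)) phi t.
Proof.
move=> sN; rewrite (@rowV_steps p _ _ _ _ _ _ N) ?size_nseq //.
by apply: steps_eq => b _; rewrite /land disj_empty cross_empty join_empty mul1r.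
Qed.

End EmptyWindow.

(** * Commutation of all row operators *)

Section RowCommutation.
Local Open Scope ring_scope.
Variables (p : nat) (R : idomainType) (q : R).
Hypothesis q0 : q != 0.
Notation n := p.+1.
Implicit Types (t : seq bool) (phi : seq bool -> R).

Lemma stepsH_comm N x y t phi : (size t <= N)%N ->
  steps p q x (iota 0 N) (steps p q y (iota 0 N) phi) t
  = steps p q y (iota 0 N) (steps p q x (iota 0 N) phi) t.
Proof.
move=> sN.
have E a b : steps p q a (iota 0 N) (steps p q b (iota 0 N) phi) t
    = tworow q a b (nseq n false) (nseq n false) t phi.
  rewrite -(rowH_stepsE p q a _ sN); apply: rowH_eq => u su.
  by apply/esym/rowH_stepsE; rewrite su.
rewrite !E.
(* With [n] pending edges and no path on them, the sum in [chain] has a single term, that of the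
   empty word, with coefficient 1. *)
have := @chain_sym R q q0 x y (nseq n 0%N) (fun=> 1) (fun=> 1) t phi isT.
have s0 : count (pred1 1%N) (nseq n 0%N) = 0%N by rewrite count_nseq.
have d0 : count [pred k | (1 < k)%N] (nseq n 0%N) = 0%N by rewrite count_nseq.
rewrite /chain /gauge s0 d0 => /(_ erefl).
have W1 k : win1 (nseq k 0%N) [::] = nseq k false by elim: k => //= k ->.
have W2 k : win2 (nseq k 0%N) [::] = nseq k false by elim: k => //= k ->.
have Rv k : rev (nseq k false) = nseq k false.
  by apply: (@eq_from_nth _ false); rewrite size_rev size_nseq // => i ik; rewrite nth_rev ?size_nseq ?nth_nseq ?if_same.
rewrite /wsum /tw !W1 !W2 !Rv.
by rewrite !mul0n !expr0 !mul1r.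
Qed.

Lemma rowop_comm N l l' t phi : (size t <= N)%N ->
  rowop p q N l (rowop p q N l' phi) t = rowop p q N l' (rowop p q N l phi) t.
Proof.
have HV : forall x y t phi, (size t <= N)%N ->
    rowop p q N (inl x) (rowop p q N (inr y) phi) t = rowop p q N (inr y) (rowop p q N (inl x) phi) t.
  move=> x y {}t {}phi sN.
  pose H z := rowop p q N (inl z); pose V z := rowop p q N (inr z).
  have HVK z psi u : H z (V z psi) u = psi u by rewrite /H /V /= stepsK.
  have VHK z psi u : V z (H z psi) u = psi u.
    rewrite /H /V /= -[X in steps p q X (iota 0 N)]opprK -[X in steps _ _ _ X psi]revK.
    by rewrite stepsK.
  (* Inserting [V(y) H(y)] brings [H(y)] next to [H(x)]; once they are exchanged, [H(y)] cancels the
     other [V(y)]. *)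
  rewrite -/(H x) -/(V y) -(VHK y (H x (V y phi)) t); apply: rowop_eq => b sb.
  rewrite -/(H x) -/(V y) /H /= stepsH_comm ?sb //; apply: steps_eq => b' _.
  exact: HVK.
move=> sN; case: l l' => [x|y] [x'|y']; [exact: stepsH_comm | exact: HV | by rewrite HV |].
pose H z := rowop p q N (inl z); pose V z := rowop p q N (inr z).
have HVK z psi u : H z (V z psi) u = psi u by rewrite /H /V /= stepsK.
have VHK z psi u : V z (H z psi) u = psi u.
  rewrite /H /V /= -[X in steps p q X (iota 0 N)]opprK -[X in steps _ _ _ X psi]revK.
  by rewrite stepsK.
rewrite -/(V y) -/(V y') -(VHK y' (V y (V y' phi)) t); apply: rowop_eq => b sb.
rewrite -/(V y) -/(V y') /H HV ?sb //; apply: rowop_eq => b' _.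
exact: HVK.
Qed.

Lemma rowops_rev N (ls : seq (R + R)) t phi : (size t <= N)%N ->
  foldr (rowop p q N) phi (rev ls) t = foldr (rowop p q N) phi ls t.
Proof.
move=> sN; elim: ls phi => //= l ls IH phi; rewrite rev_cons foldr_rcons IH.
elim: ls {IH} t sN phi => //= l' ls IH t sN phi.
rewrite [RHS]rowop_comm //; apply: rowop_eq => b sb; apply: IH.
by rewrite sb.
Qed.

End RowCommutation.

(** * Ribbons and strips in terms of Maya diagrams *)

Section RibbonGeometry.
Local Open Scope nat_scope.
Variable p : nat.
Notation n := p.+1.

Definition downclosed (D : nat -> nat -> Prop) :=
  forall i j i' j', D i j -> i' <= i -> j' <= j -> D i' j'.

(* [D] is the ribbon with cells [(f k, g k)], of contents [g k - f k = d + k - N]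
   for [k < n]; each cell is above or to the right of the previous one. *)
Record ribbon_path (N : nat) (D : nat -> nat -> Prop) (d : nat) (f g : nat -> nat) : Prop :=
  RibbonPath {
    rp_mem : forall i j, D i j <-> exists k, [/\ k < n, i = f k & j = g k];
    rp_content : forall k, k < n -> g k + N = f k + (d + k);
    rp_next : forall k, k < p -> f k.+1 <= f k <= (f k.+1).+1 }.

Section Strip.
Variables (N : nat) (I : Type) (P : I -> Prop) (rib : I -> nat -> nat -> Prop).
Variables (d : I -> nat) (f g : I -> nat -> nat) (al be : nat -> nat -> Prop).
Hypothesis path : forall u, P u -> ribbon_path N (rib u) (d u) (f u) (g u).
Hypothesis rib_inj : forall u v i j, P u -> P v -> rib u i j -> rib v i j -> u = v.
Hypothesis cover : forall i j, (be i j /\ ~ al i j) <-> exists2 u, P u & rib u i j.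
Hypothesis al_down : downclosed al.
Hypothesis be_down : downclosed be.
Hypothesis top : forall u a, P u -> a.+1 = f u p -> ~ (be a (g u p) /\ ~ al a (g u p)).

Let mem u k : P u -> k < n -> rib u (f u k) (g u k).
Proof. by move=> Pu kn; apply/(rp_mem (path Pu)); exists k. Qed.

Let mem_be u k : P u -> k < n -> be (f u k) (g u k) /\ ~ al (f u k) (g u k).
Proof. by move=> Pu kn; apply/cover; exists u => //; apply: mem. Qed.

Let content u k : P u -> k < n -> g u k + N = f u k + (d u + k).
Proof. by move=> Pu; apply: (rp_content (path Pu)). Qed.

Let next u k : P u -> k < p -> f u k.+1 <= f u k <= (f u k.+1).+1.
Proof. by move=> Pu; apply: (rp_next (path Pu)). Qed.

Let same_cell u v k l : P u -> P v -> k < n -> l < n ->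
  f u k = f v l -> d u + k = d v + l -> u = v.
Proof.
move=> Pu Pv kn ln fE dE; apply: (rib_inj Pu Pv (mem Pu kn)).
have -> : g u k = g v l by move: (content Pu kn) (content Pv ln); rewrite fE dE; lia.
by rewrite fE; apply: mem.
Qed.

(** On a common diagonal disjoint ribbons have different rows, and from one diagonal to the next the
    row index drops by at most one; so a ribbon that is above another one stays above it. *)
Let noncrossing u v k l m : P u -> P v -> u <> v -> k + m < n -> l + m < n ->
  d u + k = d v + l -> f u k < f v l -> f u (k + m) < f v (l + m).
Proof.
move=> Pu Pv uv km lm dE lt; elim: m km lm => [|m IH] km lm; first by rewrite !addn0.
have {}IH : f u (k + m) < f v (l + m) by apply: IH; lia.
rewrite !addnS in km lm *.
have := @next u (k + m) Pu; have := @next v (l + m) Pv.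
have ne : f u (k + m).+1 <> f v (l + m).+1.
  by move=> E; apply: uv; apply: (same_cell Pu Pv km lm E); lia.
by move=> /(_ ltac:(lia)) H1 /(_ ltac:(lia)) H2; move: ne H1 H2 IH; lia.
Qed.

(** If [u] is above [v] and does not end before [v], follow both up to the last diagonal of [v]. The
    cell just above the top right cell of [v] is then in [be], and it is not in [al] because [u] has
    a cell weakly above and to the left of it. This contradicts [top]. *)
Let not_below u v k l : P u -> P v -> u <> v -> k < n -> l < n ->
  d u + k = d v + l -> d v <= d u -> ~ f u k < f v l.
Proof.
move=> Pu Pv uv kn ln dE dle lt; pose m := p - l.
have km : k + m < n by rewrite /m; lia.
have lm : l + m = p by rewrite /m; lia.
have := @noncrossing u v k l m Pu Pv uv km; rewrite lm => /(_ (leqnn _) dE lt) lt2.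
have cu := content Pu km; have cv := @content v p Pv (leqnn _).
apply: (@top v (f v p).-1 Pv); first by lia.
have [bv nav] := @mem_be v p Pv (leqnn _); have [_ nau] := mem_be Pu km.
split; first by apply: be_down bv _ _; lia.
by move=> a; apply: nau; apply: al_down a _ _; lia.
Qed.

Lemma strip_tail_inj u v : P u -> P v -> d u = d v -> u = v.
Proof.
move=> Pu Pv dE; apply: boolp.contrapT => uv.
have vu : v <> u by move=> E; apply: uv.
case: (ltngtP (f u 0) (f v 0)) => E.
- by apply: (@not_below u v 0 0) E => //; lia.
- by apply: (@not_below v u 0 0) E => //; lia.
- by apply: uv; apply: (@same_cell u v 0 0) E _ => //; lia.
Qed.

(** If a neighbour to the right or below lies in another ribbon [v], then in general [u] is above
    [v] on a common diagonal although it has the larger tail content, which [not_below] excludes. *)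
Lemma strip_last_removable u i j : P u -> (forall v, P v -> d v <= d u) -> rib u i j ->
  (be i j.+1 -> rib u i j.+1) /\ (be i.+1 j -> rib u i.+1 j).
Proof.
move=> Pu dmax uij; have [k [kn fE gE]] := (rp_mem (path Pu) i j).1 uij.
have [buij nau] := mem_be Pu kn; rewrite -fE -gE in buij nau.
have cE := content Pu kn; rewrite -fE -gE in cE.
split=> bn.
- have [|v Pv vij] := (cover i j.+1).1; first by split=> // a; apply: nau; apply: al_down a _ _.
  case: (boolp.pselect (u = v)) => [->//|uv].
  have [l [ln fvE gvE]] := (rp_mem (path Pv) _ _).1 vij.
  have cv := content Pv ln; rewrite -fvE -gvE in cv.
  have dlt : d v < d u.
    by rewrite ltn_neqAle dmax // andbT; apply/eqP => dE; apply: uv; apply: strip_tail_inj.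
  have kp : k < p by lia.
  have nk := next Pu kp; rewrite -fE in nk.
  case: (@not_below u v k.+1 l) => //; [lia|lia|].
  suff : f u k.+1 <> f v l by rewrite -fvE; lia.
  by move=> E; apply: uv; apply: (same_cell Pu Pv _ ln E); lia.
- have [|v Pv vij] := (cover i.+1 j).1; first by split=> // a; apply: nau; apply: al_down a _ _.
  case: (boolp.pselect (u = v)) => [->//|uv].
  have [l [ln fvE gvE]] := (rp_mem (path Pv) _ _).1 vij.
  have cv := content Pv ln; rewrite -fvE -gvE in cv.
  have dlt : d v < d u.
    by rewrite ltn_neqAle dmax // andbT; apply/eqP => dE; apply: uv; apply: strip_tail_inj.
  case: k kn fE gE cE => [|k] kn fE gE cE.
    case: (ltngtP l p) => lp; [|lia|]; last first.
      (* The exceptional case: [v] ends in the cell just below the tail of [u], so this tail is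
         itself the cell excluded by [top]. *)
      by exfalso; apply: (@top v i Pv); rewrite -lp -?gvE.
    have nl := next Pv lp; rewrite -fvE in nl.
    case: (@not_below u v 0 l.+1) => //; [lia|lia|].
    suff : f u 0 <> f v l.+1 by rewrite -fE; lia.
    by move=> E; apply: uv; apply: (same_cell Pu Pv kn _ E); lia.
  have nk := @next u k Pu kn; rewrite -fE in nk.
  case: (@not_below u v k l) => //; [lia|lia|lia|].
  suff : f u k <> f v l by rewrite -fvE; lia.
  by move=> E; apply: uv; apply: (same_cell Pu Pv _ ln E); lia.
Qed.

End Strip.

(** Transposition reverses the path and negates contents; the offsets and the bound keep the new
    tail content a natural number. *)
Lemma ribbon_path_tr N D d f g N' : N + N' >= d + p -> ribbon_path N D d f g ->
  ribbon_path N' (fun i j => D j i) (N + N' - (d + p))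
    (fun k => g (p - k)) (fun k => f (p - k)).
Proof.
move=> dN [m c nx]; split.
- move=> i j; rewrite m; split=> -[k [kn -> ->]]; exists (p - k); split; rewrite ?subKn //; lia.
- by move=> k kn; have := c (p - k); lia.
- move=> k kn; have := nx (p - k.+1); have := c (p - k.+1); have := c (p - k).
  have -> : (p - k.+1).+1 = p - k by lia.
  lia.
Qed.

End RibbonGeometry.

(** * Maya diagrams and their counting functions *)

Section Maya.
Local Open Scope nat_scope.
Implicit Types (t u : seq bool) (al be : intpart) (e i j : nat).

(** Partitions are compared through this function of [e]: inclusion is a pointwise inequality, a
    jump from [c] adds 1 exactly for [c < e <= c + n], and a word of given length is determined by
    it. *)
Definition cnt t e := count id (drop e t).

Lemma cntS t e : cnt t e = nth false t e + cnt t e.+1.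
Proof.
rewrite /cnt; case: (ltnP e (size t)) => et; first by rewrite (drop_nth false et).
by rewrite !drop_oversize ?nth_default //; lia.
Qed.

Lemma cnt_step t e : cnt t e.+1 <= cnt t e <= (cnt t e.+1).+1.
Proof. by rewrite (cntS t e); case: nth; lia. Qed.

Lemma cnt_anti t e e' : e <= e' -> cnt t e' <= cnt t e.
Proof. by move=> /subnK <-; elim: (e' - e) => // k IH; apply: leq_trans IH; rewrite addSn; case/andP: (cnt_step t (k + e)). Qed.

Lemma cnt0 t e : size t <= e -> cnt t e = 0.
Proof. by move=> se; rewrite /cnt drop_oversize. Qed.

Lemma cnt_inj t u : size t = size u -> (forall e, cnt t e = cnt u e) -> t = u.
Proof.
move=> s E; apply: (@eq_from_nth _ false) => // i _.
by move: (cntS t i) (cntS u i); rewrite !E; do 2 case: nth; lia.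
Qed.

Lemma cnt_low t e : count id t <= cnt t e + e.
Proof.
rewrite -{1}(cat_take_drop e t) count_cat addnC leq_add2l.
by apply: leq_trans (count_size _ _) _; rewrite size_take_min geq_minl.
Qed.

Lemma cnt_set_nth t i a e : i < size t ->
  cnt (set_nth false t i a) e + (e <= i) * nth false t i = cnt t e + (e <= i) * a.
Proof.
rewrite /cnt; elim: t i e => [|b t IH] [|i] [|e] // it.
- by rewrite !drop0 /=; lia.
- by have := IH i 0 it; rewrite !drop0 /=; lia.
- by have := IH i e it; rewrite ltnS.
Qed.

Section Move.
Variable p : nat.
Notation n := p.+1.

Lemma cnt_move c t e : can_step p c t ->
  cnt (move p c t) e = cnt t e + (c < e <= c + n).
Proof.
case/and3P => tc cs tcn; rewrite /move.
have c1 : c < size t by lia.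
have H1 := @cnt_set_nth (set_nth false t c false) (c + n) true e.
have H2 := @cnt_set_nth t c false e c1.
rewrite size_set_nth nth_set_nth /= ifN in H1; last by lia.
move: H1 => /(_ ltac:(lia)); move: H2; rewrite tc (negbTE tcn); lia.
Qed.

Lemma moveP c t u : size t = size u ->
  (forall e, cnt u e = cnt t e + (c < e <= c + n)) -> can_step p c t /\ u = move p c t.
Proof.
move=> s E.
have H1 := E c; have H2 := E c.+1; have H3 := E (c + n); have H4 := E (c + n).+1.
have T1 := cntS t c; have T2 := cntS t (c + n).
have U1 := cntS u c; have U2 := cntS u (c + n).
have lt : c + n < size t by rewrite ltnNge s; apply/negP => /cnt0; lia.
have cs : can_step p c t.
  rewrite /can_step lt /=; move: T1 T2 U1 U2 H1 H2 H3 H4.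
  by do 4 case: nth; lia.
split=> //; apply: cnt_inj => [|e]; first by rewrite size_move.
by rewrite E cnt_move.
Qed.

Lemma jumpE c t : jump p c t + cnt t (c + n) = cnt t c.+1.
Proof.
rewrite /jump /cnt -{2}(cat_take_drop p (drop c.+1 t)) count_cat drop_drop.
by congr (_ + count id (drop _ _)); lia.
Qed.

End Move.

Lemma antitone_count (P : pred nat) h i :
  (forall j k, j <= k -> k < h -> P k -> P j) ->
  (i < count P (iota 0 h)) = (i < h) && P i.
Proof.
elim: h => // h IH anti.
have -> : iota 0 h.+1 = iota 0 h ++ [:: h] by rewrite -addn1 iotaD.
rewrite count_cat [count P [:: h]]/= addn0 ltnS.
have {}IH : (i < count P (iota 0 h)) = (i < h) && P i.
  by apply: IH => j k jk kh; apply: anti => //; lia.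
have := count_size P (iota 0 h); rewrite size_iota => ch.
case Ph: (P h); last first.
  rewrite addn0 IH; case: ltngtP => // ->; by rewrite Ph andbF.
have -> : count P (iota 0 h) = h.
  apply/eqP; rewrite -[X in _ == X](size_iota 0) -all_count; apply/allP => j.
  by rewrite mem_iota => jh; apply: anti Ph; lia.
by rewrite addn1 ltnS; case: leqP => // ih; rewrite (anti i h).
Qed.

Lemma part_anti al i j : i <= j -> nth 0 al j <= nth 0 al i.
Proof.
move=> ij; case: (ltnP j (size al)) => js; last by rewrite (nth_default _ js).
case: al js => s /= /andP[so _] js.
have tr : transitive geq by move=> x y z /= yx zy; apply: leq_trans zy yx.
have rf : reflexive geq by move=> x /=.
apply: (sorted_leq_nth tr rf 0 so) => //.
by rewrite inE; apply: leq_ltn_trans ij js.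
Qed.

Lemma part_gt0 al i : (0 < nth 0 al i) = (i < size al).
Proof.
case: (ltnP i (size al)) => js; last by rewrite (nth_default _ js).
case: al js => s /= /andP[_ s0] js.
by rewrite lt0n; apply: contra s0 => /eqP <-; apply: mem_nth.
Qed.

Lemma part_eq al be : (forall i, nth 0 al i = nth 0 be i) -> al = be.
Proof.
move=> E; apply: val_inj => /=; apply: (@eq_from_nth _ 0) => // .
have H i : (i < size al) = (i < size be) by rewrite -!part_gt0 E.
by move: (H (size al)) (H (size be)); rewrite !ltnn; lia.
Qed.

Lemma part_exists (F : nat -> nat) h : (forall i, F i.+1 <= F i) ->
  (forall i, h <= i -> F i = 0) ->
  exists al, size al <= h /\ forall i, nth 0 al i = F i.
Proof.
move=> dec F0; have anti i j : i <= j -> F j <= F i.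
  by move=> /subnK <-; elim: (j - i) => // k IH; apply: leq_trans IH; rewrite addSn.
pose k := count (fun i => 0 < F i) (iota 0 h).
have kE i : (i < k) = (0 < F i).
  rewrite antitone_count; first by case: ltnP => // /F0 ->.
  by move=> a b ab _ Fb; apply: leq_trans Fb (anti _ _ ab).
have so : sorted geq (mkseq F k) && (0 \notin mkseq F k).
  apply/andP; split.
    apply: (path_sorted (x := F 0)); apply/(pathP 0) => i; rewrite size_mkseq => ik.
    have N j : j < k -> nth 0 (mkseq F k) j = F j by move=> jk; rewrite nth_mkseq.
    case: i ik => [|i] ik /=; first by rewrite N.
    by rewrite !N; [exact: dec | lia | lia].
  by apply/negP => /mapP[i]; rewrite mem_iota add0n => /=; rewrite kE => /[swap] <-.
exists (IntPart so); split=> [|i] /=.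
  by rewrite size_mkseq; apply: leq_trans (count_size _ _) _; rewrite size_iota.
case: (ltnP i k) => ik; first by rewrite nth_mkseq.
rewrite nth_default ?size_mkseq //; move: (kE i); case: (F i) => //; lia.
Qed.

Definition pos (h : nat) al i := nth 0 al i + (h - i.+1).

(* Maya diagram of [al] with [h] particles, in a window of [M] positions. *)
Definition bits (h M : nat) al : seq bool :=
  mkseq (fun e => e \in [seq pos h al i | i <- iota 0 h]) M.

Definition fits (h M : nat) al := (size al <= h) && (nth 0 al 0 + h <= M).

Lemma size_bits h M al : size (bits h M al) = M.
Proof. exact: size_mkseq. Qed.

Lemma pos_anti h al i j : i < j -> j < h -> pos h al j < pos h al i.
Proof. by move=> ij jh; rewrite /pos; have := part_anti al (ltnW ij); lia. Qed.

Lemma cnt_bits h M al e : fits h M al ->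
  cnt (bits h M al) e = count (fun i => e <= pos h al i) (iota 0 h).
Proof.
case/andP => sh aM; rewrite /cnt /bits /mkseq -map_drop drop_iota add0n count_map.
set s := [seq pos h al i | i <- iota 0 h].
transitivity (count (fun x => e <= x) s); last by rewrite count_map.
have us : uniq s.
  rewrite map_inj_in_uniq ?iota_uniq // => i j; rewrite !mem_iota => ih jh E.
  by case: (ltngtP i j) => // ij; have := @pos_anti h al _ _ ij; lia.
rewrite -[LHS]size_filter -[RHS]size_filter; apply: perm_size.
apply: uniq_perm; rewrite ?filter_uniq ?iota_uniq // => x.
rewrite !mem_filter mem_iota /=; case xs: (x \in s) => //=; rewrite ?andbF ?andbT //.
case/mapP: xs => i; rewrite mem_iota => ih ->.
by rewrite /pos; have := part_anti al (leq0n i); case: (leqP e) => //= _; lia.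
Qed.

(** Particles are numbered from the right, so those from a given position on are the ones with the
    smallest numbers. The argument of [cnt] is one more than the content of the cell shifted by
    [h.-1]. *)
Lemma cell_cnt h M al i j : fits h M al -> i < h ->
  (j < nth 0 al i) = (i < cnt (bits h M al) (j + (h - i.+1)).+1).
Proof.
move=> fa ih; rewrite cnt_bits // antitone_count ?ih /=.
  by rewrite /pos; lia.
move=> a b ab bh; case: (ltngtP a b) ab => // [ab _|-> //].
by have := @pos_anti h al _ _ ab bh; lia.
Qed.

Lemma pos_cnt h M al i e : fits h M al -> i < h ->
  (i < cnt (bits h M al) e) = (e <= pos h al i).
Proof.
move=> fa ih; rewrite cnt_bits // antitone_count ?ih //=.
move=> a b ab bh; case: (ltngtP a b) ab => // [ab _|-> //].
by have := @pos_anti h al _ _ ab bh; lia.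
Qed.

Lemma cnt_bits_le h M al e : fits h M al -> cnt (bits h M al) e <= h.
Proof.
by move=> fa; rewrite cnt_bits //; apply: leq_trans (count_size _ _) _; rewrite size_iota.
Qed.

Lemma cnt_bits0 h M al : fits h M al -> cnt (bits h M al) 0 = h.
Proof.
by move=> fa; rewrite cnt_bits // (eq_count (a2 := predT)) ?count_predT ?size_iota.
Qed.

Lemma cnt_sub h M al be : fits h M al -> fits h M be ->
  (forall e, cnt (bits h M al) e <= cnt (bits h M be) e) ->
  forall i, nth 0 al i <= nth 0 be i.
Proof.
move=> fa fb le i.
case: (ltnP i h) => ih; last by case/andP: fa => sa _; rewrite (nth_default _ (leq_trans sa ih)).
rewrite leqNgt; apply/negP => lt; have := lt; rewrite (cell_cnt _ fa ih) => H.
have := ltnn (nth 0 be i); rewrite (cell_cnt _ fb ih) => /negP; apply.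
exact: leq_trans H (le _).
Qed.

Lemma bits_inj h M al be : fits h M al -> fits h M be -> bits h M al = bits h M be ->
  al = be.
Proof.
move=> fa fb E; apply: part_eq => i; case: (ltnP i h) => ih; last first.
  by case/andP: fa fb => ? _ /andP[? _]; rewrite !nth_default //; lia.
have H j : (j < nth 0 al i) = (j < nth 0 be i).
  by rewrite (cell_cnt _ fa ih) (cell_cnt _ fb ih) E.
by move: (H (nth 0 al i)) (H (nth 0 be i)); rewrite !ltnn; lia.
Qed.

Lemma bits_surj h M t : size t = M -> count id t = h ->
  exists2 al, fits h M al & bits h M al = t.
Proof.
(* [G i j] is what [cell_cnt] prescribes as membership of the cell [(i, j)] in the partition to be
   found. *)
move=> st ct; pose G i j := i < cnt t (j + (h - i.+1)).+1.
pose F i := if i < h then count (G i) (iota 0 M) else 0.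
have hM : h <= M by rewrite -ct -st count_size.
have FE i j : i < h -> (j < F i) = G i j.
  move=> ih; rewrite /F ih antitone_count.
    case: (ltnP j M) => //= jM; apply/esym/negP; rewrite /G cnt0 // st; lia.
  move=> a b ab _; rewrite /G => /leq_trans; apply; apply: cnt_anti; lia.
have dec i : F i.+1 <= F i.
  case: (ltnP i.+1 h) => ih; last by rewrite {1}/F ltnNge ih.
  rewrite leqNgt; apply/negP => lt; have i1 : i < h by lia.
  move: (lt); rewrite FE // /G => H.
  have : ~~ (F i < F i) by rewrite ltnn.
  rewrite FE // /G; have := cnt_step t (F i + (h - i.+2)).+1.
  have -> : (F i + (h - i.+2)).+2 = (F i + (h - i.+1)).+1 by lia.
  lia.
have [al [sal alE]] := part_exists dec (h := h) ltac:(by move=> i hi; rewrite /F ltnNge hi).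
have fa : fits h M al.
  rewrite /fits sal alE /=; case: (posnP (F 0)) => [->//|F0].
  have h0 : 0 < h by move: F0; rewrite /F; case: (0 < h).
  have : (F 0).-1 < F 0 by lia.
  rewrite FE // /G => lt; rewrite leqNgt; apply/negP => Mlt.
  by move: lt; rewrite cnt0 // st; lia.
exists al => //; apply: cnt_inj; first by rewrite size_bits.
case=> [|e]; first by rewrite cnt_bits0 // /cnt drop0.
have cth : cnt t e.+1 <= h by rewrite -ct /cnt -{2}(cat_take_drop e.+1 t) count_cat leq_addl.
have H i : i < h -> (i < cnt (bits h M al) e.+1) = (i < cnt t e.+1).
  move=> ih; rewrite (pos_cnt _ fa ih) /pos alE.
  case: (leqP (h - i.+1) e) => le.
    have <- : (i < cnt t e.+1) = (e < F i + (h - i.+1)); last by [].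
    transitivity (G i (e - (h - i.+1))); first by rewrite /G; congr (_ < cnt _ _); lia.
    by rewrite -FE //; lia.
  by have := cnt_low t e.+1; rewrite ct; lia.
have cb := cnt_bits_le e.+1 fa.
case: (ltngtP (cnt (bits h M al) e.+1) (cnt t e.+1)) => // lt.
  by have := H _ (leq_trans lt cth); rewrite ltnn lt.
by have := H _ (leq_trans lt cb); rewrite ltnn lt.
Qed.

End Maya.

(** * Ribbons as jumps of one particle *)

Section RibbonsInBox.
Local Open Scope nat_scope.
Variables (p h0 w0 h : nat).
Notation n := p.+1.
Notation box := ('I_h0 * 'I_w0)%type.
Implicit Types (D R U V : {set box}) (x y z : box) (al be : intpart).

Definition incell D i j : Prop := exists x, [/\ x \in D, x.1 = i :> nat & x.2 = j :> nat].

Lemma cell_eq x y : x.1 = y.1 :> nat -> x.2 = y.2 :> nat -> x = y.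
Proof. by case: x y => [a b] [c d] /= /val_inj -> /val_inj ->. Qed.

Lemma incellE D x : x \in D <-> incell D x.1 x.2.
Proof.
by split=> [xD|[y [yD y1 y2]]]; [exists x | rewrite (cell_eq (esym y1) (esym y2))].
Qed.

Definition boxed al := (size al <= h0) && (nth 0 al 0 <= w0).

Lemma incell_diagram al i j : boxed al ->
  incell (diagram h0 w0 al) i j <-> j < nth 0 al i.
Proof.
case/andP => s0 a0; split=> [[x []]|ji]; first by rewrite inE => + <- <-.
have ih : i < h0 by apply: leq_trans s0; rewrite -part_gt0; lia.
have jw : j < w0 by have := part_anti al (leq0n i); lia.
by exists (Ordinal ih, Ordinal jw); rewrite inE.
Qed.

Lemma is_youngE D : is_young D <-> exists2 al, boxed al & D = diagram h0 w0 al.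
Proof.
split=> [[al [s0 a0 ->]]|[al /andP[s0 a0] ->]]; exists al => //.
by rewrite /boxed s0.
Qed.

Lemma young_down D : is_young D <-> downclosed (incell D).
Proof.
split=> [/is_youngE[al ba ->] i j i' j'|down].
  rewrite !incell_diagram // => ji ii jj.
  by have := part_anti al ii; lia.
pose F i := count (fun j => boolp.asbool (incell D i j)) (iota 0 w0).
have FE i j : (j < F i) = boolp.asbool (incell D i j).
  rewrite /F antitone_count.
    apply/andP/idP => [[] //|H]; split=> //.
    by have [x [_ _ <-]] := boolp.asboolW H; apply: ltn_ord.
  by move=> a b ab _ /boolp.asboolW H; apply/boolp.asboolP; apply: down H _ ab.
have [i|i hi|al [sal alE]] := @part_exists F h0.
- rewrite leqNgt; apply/negP => lt.
  have := ltnn (F i); rewrite FE => /negP; apply; apply/boolp.asboolP.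
  move: lt; rewrite FE => /boolp.asboolW H; exact: down H _ _.
- apply/eqP; rewrite -leqn0 leqNgt FE; apply/negP => /boolp.asboolW [x [_ xi _]].
  by have := ltn_ord x.1; rewrite xi; lia.
apply/is_youngE; exists al.
  by rewrite /boxed sal alE /F; apply: leq_trans (count_size _ _) _; rewrite size_iota.
apply/setP => x; rewrite inE alE FE; apply/idP/boolp.asboolP; by rewrite incellE.
Qed.

Lemma incellD U V i j : incell (U :\: V) i j <-> incell U i j /\ ~ incell V i j.
Proof.
split=> [[x []]|[[x [xU xi xj]] nV]].
  rewrite inE => /andP[xV xU] <- <-; split; first by apply/incellE.
  by move/incellE; apply/negP.
exists x; split=> //; rewrite inE xU andbT; apply/negP => xV; apply: nV.
by rewrite -xi -xj; apply/incellE.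
Qed.

Hypothesis hh : h0 <= h.

Definition cont x := x.2 + (h - x.1.+1).

Lemma contE x : x.2 + h.-1 = x.1 + cont x.
Proof. by rewrite /cont; have := ltn_ord x.1; lia. Qed.

Lemma adjacentC x y : adjacent x y = adjacent y x.
Proof.
rewrite /adjacent (eq_sym y.1) (eq_sym y.2).
by congr (_ && _ || _ && _); apply: orbC.
Qed.

Lemma adjacent_cont x y : adjacent x y -> cont y = (cont x).+1 \/ cont x = (cont y).+1.
Proof.
have := contE x; have := contE y; have := ltn_ord x.1; have := ltn_ord y.1.
rewrite /adjacent => h1 h2 h3 h4 /orP[/andP[/eqP e /orP[]/eqP f]|/andP[/eqP e /orP[]/eqP f]];
  rewrite -?e in h3 h4 *; rewrite ?e in h3 h4 *; move: f h1 h2 h3 h4; lia.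
Qed.

(** Two cells on one diagonal would span a rectangle inside the skew shape, hence a forbidden
    square, so the contents are distinct. Connectedness makes them consecutive, and there are [n] of
    them. *)
Lemma ribbon_pathP R : is_ribbon n R ->
  exists d f g, ribbon_path p h.-1 (incell R) d f g.
Proof.
case=> -[U [V [yU yV sVU RE]]] cR conn no22.
have dU := (young_down U).1 yU; have dV := (young_down V).1 yV.
have memR i j : incell R i j <-> incell U i j /\ ~ incell V i j.
  split=> [[x []]|[[x [xU xi xj]] nV]].
    rewrite RE inE => /andP[xV xU] <- <-; split; first by apply/incellE.
    by move/incellE; apply/negP.
  exists x; split=> //; rewrite RE inE xU andbT; apply/negP => xV; apply: nV.
  by rewrite -xi -xj; apply/incellE.
have inj0 x y : x \in R -> y \in R -> cont x = cont y -> x.1 < y.1 -> False.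
  move=> xR yR cE lt; apply: no22; have := contE x; have := contE y => cy cx.
  have lt2 : x.2 < y.2 by lia.
  have h1 : x.1.+1 < h0 by have := ltn_ord y.1; lia.
  have w1 : x.2.+1 < w0 by have := ltn_ord y.2; lia.
  exists x, (Ordinal h1, Ordinal w1); split=> //.
  have [/memR[_ nVx] /memR[Uy _]] := ((incellE R x).1 xR, (incellE R y).1 yR).
  apply/subsetP => z; rewrite !inE => zE; apply/incellE/memR.
  have : [/\ x.1 <= z.1, x.2 <= z.2, z.1 <= y.1 & z.2 <= y.2].
    by case/orP: zE => [/orP[/orP[]|]|] /eqP -> /=; split; rewrite ?leqnn ?leqnSn ?(ltnW lt) ?(ltnW lt2).
  case=> x1 x2 y1 y2; split; first exact: dU Uy y1 y2.
  by move=> Vz; apply: nVx; apply: dV Vz x1 x2.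
have inj x y : x \in R -> y \in R -> cont x = cont y -> x = y.
  move=> xR yR cE; case: (ltngtP x.1 y.1) => lt.
  - by case: (inj0 x y).
  - by case: (inj0 y x).
  - by apply: cell_eq => //; have := contE x; have := contE y; lia.
(* On a walk from [x] to [y], take the step at which the content first exceeds that of [x]. Contents
   change by one, so this step starts on the diagonal of [x], that is, at [x] itself. *)
have nextR x y : x \in R -> y \in R -> cont x < cont y ->
    exists z, [/\ z \in R, adjacent x z & cont z = (cont x).+1].
  move=> xR yR lt; have /connectP[s ps ys] := conn x y xR yR.
  suff [u [v [uR vR uv cu cv]]] : exists u v,
      [/\ u \in R, v \in R, adjacent u v, cont u = cont x & cont v = (cont x).+1].
    by exists v; split=> //; rewrite (inj x u).
  have aux u : u \in R -> cont u <= cont x ->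
      path [rel u v | [&& u \in R, v \in R & adjacent u v]] u s -> y = last u s ->
      exists u v, [/\ u \in R, v \in R, adjacent u v, cont u = cont x & cont v = (cont x).+1].
    elim: s {ps ys} u => [|v s IH] u uR ule /= => [_ yu|/andP[/and3P[_ vR uv] ps] yl].
      by move: lt; rewrite yu ltnNge ule.
    case: (leqP (cont v) (cont x)) => vle; first exact: (IH v).
    by exists u, v; split=> //; case: (adjacent_cont uv); lia.
  exact: aux ps ys.
have [x0 x0R] : exists x, x \in R by apply/set0Pn; rewrite -card_gt0 cR.
case: (arg_minnP cont x0R) => xm xmR xmin; case: (arg_maxnP cont x0R) => xM xMR xmax.
have att k : cont xm + k <= cont xM -> exists2 x, x \in R & cont x = cont xm + k.
  elim: k => [|k IH] le; first by exists xm; rewrite ?addn0.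
  have [|x xR cx] := IH; first by lia.
  have [|z [zR _ cz]] := nextR x xM xR xMR; first by lia.
  by exists z; rewrite // cz cx addnS.
have nE : cont xM = cont xm + p.
  have Ed : cont xm <= cont xM := xmin _ xMR.
  suff : #|R| = (cont xM - cont xm).+1 by rewrite cR; lia.
  rewrite cardE -(size_map cont) -(size_iota (cont xm) (cont xM - cont xm).+1).
  apply/perm_size/uniq_perm; rewrite ?iota_uniq //.
    rewrite map_inj_in_uniq ?enum_uniq // => x y; rewrite !mem_enum; exact: inj.
  move=> e; rewrite mem_iota; apply/mapP/andP => [[x]|[e1 e2]].
    by rewrite mem_enum => xR ->; have := xmin _ xR; have := xmax _ xR; rewrite /=; lia.
  have [|x xR cx] := att (e - cont xm); first by lia.
  by exists x; rewrite ?mem_enum // cx subnKC.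
have /boolp.choice[c cP] k : exists x, k < n -> x \in R /\ cont x = cont xm + k.
  case: (ltnP k n) => kn; last by exists xm.
  by have [|x xR cx] := att k; [lia | exists x].
exists (cont xm), (fun k => (c k).1 : nat), (fun k => (c k).2 : nat); split.
- move=> i j; split=> [[x [xR <- <-]]|[k [kn -> ->]]]; last first.
    by apply/incellE; case: (cP k kn).
  have := xmin _ xR; have := xmax _ xR => /= le1 le2; exists (cont x - cont xm).
  have kn : cont x - cont xm < n by lia.
  have [cR' cc] := cP _ kn.
  have -> : c (cont x - cont xm) = x by apply: inj => //; rewrite cc subnKC.
  by [].
- by move=> k kn; have [_ <-] := cP k kn; apply: contE.
- move=> k kp; have [kR ck] := cP k (leqW kp); have [kR' ck'] := cP k.+1 kp.
  have [|z [zR az cz]] := nextR _ _ kR kR'; first by lia.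
  have zE : z = c k.+1 by apply: inj => //; rewrite cz ck' ck addnS.
  subst z; move: az; have := contE (c k); have := contE (c k.+1).
  by rewrite /adjacent => e1 e2 /orP[/andP[/eqP/(congr1 val)/= e _]|/andP[/eqP/(congr1 val)/= e _]]; lia.
Qed.

Lemma path_uniq (C : nat -> nat -> Prop) d f g x y : ribbon_path p h.-1 C d f g ->
  C x.1 x.2 -> C y.1 y.2 -> cont x = cont y -> x = y.
Proof.
move=> [m c _] /m[k [kn xk xk']] /m[l [ln yl yl']] cE.
have [ck cl] := (c k kn, c l ln); have [cx cy] := (contE x, contE y).
have kl : k = l by lia.
by apply: cell_eq; rewrite ?xk ?xk' ?yl ?yl' kl.
Qed.

Lemma path_ribbon U V d f g : is_young U -> is_young V -> V \subset U ->
  ribbon_path p h.-1 (incell (U :\: V)) d f g -> is_ribbon n (U :\: V).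
Proof.
move=> yU yV sVU rp; have [m c nx] := rp.
have /boolp.choice[cl clP] : forall k : 'I_n, exists x,
    [/\ x \in U :\: V, x.1 = f k :> nat & x.2 = g k :> nat].
  by move=> k; have [x [xR xi xj]] := (m _ _).2 (ex_intro _ (k : nat) (And3 (ltn_ord k) erefl erefl)); exists x.
have RE : U :\: V = [set cl k | k : 'I_n].
  apply/setP => x; apply/idP/imsetP => [xR|[k _ ->]]; last by case: (clP k).
  have /m[k [kn xi xj]] := (incellE _ _).1 xR.
  by exists (Ordinal kn) => //; have [_ e1 e2] := clP (Ordinal kn); apply: cell_eq; rewrite ?e1 ?e2.
have ccl k : cont (cl k) = d + k.
  by have [_ e1 e2] := clP k; have := contE (cl k); have := c k (ltn_ord k); lia.
split.
- by exists U, V.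
- rewrite RE card_imset ?card_ord // => k l E; apply: val_inj => /=.
  by move: (ccl k) (ccl l); rewrite E; lia.
- pose e : rel box := [rel u v | [&& u \in U :\: V, v \in U :\: V & adjacent u v]].
  suff : {in U :\: V &, forall x y, connect e x y} by [].
  have sym : connect_sym e.
    by apply: sym_connect_sym => u v; rewrite /e [LHS]/= [RHS]/= adjacentC andbCA.
  have conn0 k (kn : k < n) : connect e (cl ord0) (cl (Ordinal kn)).
    elim: k kn => [|k IH] kn; first by have -> : Ordinal kn = ord0 by apply: val_inj.
    apply: connect_trans (IH (ltnW kn)) _; apply: connect1.
    have [r1 i1 j1] := clP (Ordinal (ltnW kn)); have [r2 i2 j2] := clP (Ordinal kn).
    apply/and3P; split=> //; rewrite /adjacent -!val_eqE /=.
    have := nx k kn; have := c k (ltnW kn); have := c k.+1 kn; rewrite i1 i2 j1 j2 /=; lia.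
  move=> x y; rewrite {1 2}RE => /imsetP[k _ ->] /imsetP[l _ ->].
  apply: connect_trans (_ : connect e (cl ord0) _); last by case: l => l; apply: conn0.
  by rewrite sym; case: k => k; apply: conn0.
- case=> a [b [ab1 ab2 /subsetP sub]].
  have aR : a \in U :\: V by apply: sub; rewrite !inE eqxx.
  have bR : b \in U :\: V by apply: sub; rewrite !inE eqxx !orbT.
  have := path_uniq rp ((incellE _ _).1 aR) ((incellE _ _).1 bR).
  have [ca cb] := (contE a, contE b).
  by move=> /(_ ltac:(lia)) E; move: ab1; rewrite E; lia.
Qed.

(** From tail to head the row index decreases by at most one at a time, so every row from [f p] to
    [f 0] is met. *)
Lemma path_spin R d f g : ribbon_path p h.-1 (incell R) d f g ->
  ribbon_spin R = f 0 - f p.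
Proof.
move=> [m c nx].
have dec k l : k <= l -> l < n -> f l <= f k.
  move=> /subnK <-; elim: (l - k) => // i IH lt; apply: leq_trans (IH _); last by lia.
  by rewrite addSn; case/andP: (nx (i + k) ltac:(lia)).
have hit i k : k < n -> f k <= i <= f 0 -> exists2 l, l < n & f l = i.
  elim: k => [|k IH] kn /andP[l1 l2]; first by exists 0 => //; lia.
  case: (leqP (f k) i) => fi; first by apply: IH; lia.
  by exists k.+1 => //; have := nx k kn; lia.
have f0 : f 0 < h0.
  have [x [_ xi _]] := (m (f 0) (g 0)).2 (ex_intro _ 0 (And3 isT erefl erefl)).
  by rewrite -xi.
have -> : ribbon_spin R = #|[set i : 'I_h0 | f p <= i <= f 0]|.-1.
  congr _.-1; apply: eq_card => i; rewrite [RHS]inE; apply/imsetP/idP.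
    move=> [x /incellE/m[k [kn xi _]] ->]; rewrite xi !dec //; lia.
  move=> /(hit i p (leqnn _))[k kn fi].
  have [x [xR xi _]] := (m (f k) (g k)).2 (ex_intro _ k (And3 kn erefl erefl)).
  by exists x => //; apply: val_inj; rewrite /= xi.
have -> : #|[set i : 'I_h0 | f p <= i <= f 0]| = count (fun i => f p <= i <= f 0) (iota 0 h0).
  by rewrite cardsE cardE /enum_mem -enumT size_filter -val_enum_ord count_map.
have -> : iota 0 h0 = iota 0 (f p) ++ iota (f p) (f 0 - f p).+1 ++ iota (f 0).+1 (h0 - (f 0).+1).
  have H := dec 0 p isT (leqnn _).
  rewrite -[in X in _ ++ (iota X _ ++ _)](add0n (f p)).
  have -> : (f 0).+1 = 0 + f p + (f 0 - f p).+1 by lia.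
  rewrite -iotaD -iotaD; congr iota; lia.
rewrite !count_cat.
have -> : count (fun i => f p <= i <= f 0) (iota 0 (f p)) = 0.
  by apply/eqP; rewrite -leqn0 leqNgt -has_count; apply/hasPn => i; rewrite mem_iota; lia.
have -> : count (fun i => f p <= i <= f 0) (iota (f 0).+1 (h0 - (f 0).+1)) = 0.
  by apply/eqP; rewrite -leqn0 leqNgt -has_count; apply/hasPn => i; rewrite mem_iota; lia.
rewrite addn0 add0n.
have /eqP -> : count (fun i => f p <= i <= f 0) (iota (f p) (f 0 - f p).+1) == size (iota (f p) (f 0 - f p).+1).
  by rewrite -all_count; apply/allP => i; rewrite mem_iota; have := dec 0 p isT (leqnn _); lia.
by rewrite size_iota.
Qed.

Variable M : nat.
Hypothesis hM : h + w0 <= M.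

Lemma boxed_fits al : boxed al -> fits h M al.
Proof. by rewrite /boxed /fits; case/andP => *; apply/andP; lia. Qed.

(** The rows between the two counts at [e.+1] are those with a cell of the skew shape on diagonal
    [e], and a ribbon has one cell on each of its [n] diagonals and none elsewhere. *)
Lemma path_cnt al be d f g : boxed al -> boxed be ->
  (forall i, nth 0 be i <= nth 0 al i) ->
  ribbon_path p h.-1 (incell (diagram h0 w0 al :\: diagram h0 w0 be)) d f g ->
  forall e, cnt (bits h M al) e = cnt (bits h M be) e + (d < e <= d + n).
Proof.
move=> ba bb sub [m c nx] [|e]; first by rewrite !cnt_bits0 ?boxed_fits //= addn0.
have [fa fb] := (boxed_fits ba, boxed_fits bb).
have le : cnt (bits h M be) e.+1 <= cnt (bits h M al) e.+1.
  rewrite !cnt_bits //; apply: sub_count => i /=; rewrite /pos; have := sub i; lia.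
have new i : cnt (bits h M be) e.+1 <= i < cnt (bits h M al) e.+1 ->
    exists k, [/\ k < n, i = f k & e = d + k].
  case/andP => i1 i2; have ih : i < h by have := cnt_bits_le e.+1 fa; lia.
  have ea : e < pos h al i by rewrite -(pos_cnt _ fa ih).
  have eb : pos h be i <= e by rewrite leqNgt -(pos_cnt _ fb ih); lia.
  have [k [kn ifk gk]] : exists k, [/\ k < n, i = f k & e - (h - i.+1) = g k].
    apply/m; apply: (incellD _ _ _ _).2; rewrite !incell_diagram //.
    by move: ea eb; rewrite /pos; lia.
  exists k; split=> //; have := c k kn; move: eb; rewrite /pos; lia.
case: (boolP (d < e.+1 <= d + n)) => de.
  have ke : e - d < n by lia.
  have [] := (incellD _ _ _ _).1 ((m (f (e - d)) (g (e - d))).2 (ex_intro _ _ (And3 ke erefl erefl))).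
  have := c _ ke; rewrite !incell_diagram // => ce ca cb.
  have ih : f (e - d) < h.
    by case/andP: fa => sa _; apply: leq_trans sa; rewrite -part_gt0; lia.
  have ja : f (e - d) < cnt (bits h M al) e.+1 by rewrite (pos_cnt _ fa ih) /pos; lia.
  have jb : ~~ (f (e - d) < cnt (bits h M be) e.+1) by rewrite (pos_cnt _ fb ih) /pos; lia.
  rewrite addn1; apply/eqP; rewrite eqn_leq; apply/andP; split; last by lia.
  rewrite leqNgt; apply/negP => lt2.
  have [|k [_ fk ek]] := new (cnt (bits h M be) e.+1); first by lia.
  have [|l [_ fl el]] := new (cnt (bits h M be) e.+1).+1; first by lia.
  have kl : k = l by lia.
  by move: fl; rewrite -kl -fk; lia.
rewrite addn0; apply/eqP; rewrite eqn_leq le andbT leqNgt; apply/negP => lt.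
have [|k [kn _ ek]] := new (cnt (bits h M be) e.+1); first by lia.
by move: de; lia.
Qed.

(** Each diagonal from [d] to [d + p] gains exactly one cell. It lies in the first row that is free
    on this diagonal, and the index of that row is the number of particles of [be] beyond the
    diagonal. *)
Lemma cnt_path al be d : boxed al -> boxed be ->
  (forall e, cnt (bits h M al) e = cnt (bits h M be) e + (d < e <= d + n)) ->
  (forall i, nth 0 be i <= nth 0 al i) /\
  ribbon_path p h.-1 (incell (diagram h0 w0 al :\: diagram h0 w0 be)) d
    (fun k => cnt (bits h M be) (d + k).+1)
    (fun k => d + k + cnt (bits h M be) (d + k).+1 - h.-1).
Proof.
move=> ba bb E; have [fa fb] := (boxed_fits ba, boxed_fits bb).
have sub := cnt_sub fb fa (fun e => ltac:(by rewrite E leq_addr)).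
split=> //.
have low e : h <= cnt (bits h M be) e + e.
  rewrite -{1}(cnt_bits0 fb) /cnt drop0; exact: cnt_low.
split.
- move=> i j; split.
    move=> /(incellD _ _ _ _).1[]; rewrite !incell_diagram // => ja jb.
    have ih : i < h by case/andP: fa => sa _; apply: leq_trans sa; rewrite -part_gt0; lia.
    have := ja; rewrite (cell_cnt _ fa ih) E => H1.
    have : ~~ (j < nth 0 be i) by apply/negP.
    rewrite (cell_cnt _ fb ih) => H2; exists (j + (h - i.+1) - d).
    have de : d < (j + (h - i.+1)).+1 <= d + n by move: H1 H2; lia.
    rewrite subnKC; last by lia.
    by split; move: H1 H2; lia.
  move=> [k [kn -> ->]] {i j}; set i := cnt _ _; apply: (incellD _ _ _ _).2.
  have ia : i < cnt (bits h M al) (d + k).+1 by rewrite E; lia.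
  have ih : i < h by have := cnt_bits_le (d + k).+1 fa; lia.
  have := low (d + k).+1; rewrite -/i => lo.
  rewrite !incell_diagram // (cell_cnt _ fa ih) (cell_cnt _ fb ih).
  have -> : d + k + i - h.-1 + (h - i.+1) = d + k by lia.
  by split=> //; rewrite ltnn.
- by move=> k kn; have := low (d + k).+1; lia.
- by move=> k kp; have := cnt_step (bits h M be) (d + k).+1; rewrite addnS.
Qed.

End RibbonsInBox.

(** * Adding and removing the last ribbon of a strip *)

Section StripsInBox.
Local Open Scope nat_scope.
Variables (p h0 w0 h : nat).
Notation n := p.+1.
Notation box := ('I_h0 * 'I_w0)%type.
Implicit Types (D R U V : {set box}) (x y z : box) (P : {set {set box}}).

Notation path := (ribbon_path p h.-1).

Lemma path_mono C d f g k l : path C d f g -> k <= l -> l < n -> f l <= f k /\ g k <= g l.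
Proof.
move=> rp; have [_ c nx] := rp.
move=> /subnK <-; elim: (l - k) => // i IH lt; have [|f1 g1] := IH; first by lia.
have := nx (i + k) ltac:(lia); have := c _ lt; have := c (i + k) ltac:(lia).
by rewrite addSn; lia.
Qed.

Lemma path_tail_uniq C d f g d' f' g' : path C d f g -> path C d' f' g' -> d = d'.
Proof.
suff H : forall d f g d' f' g', path C d f g -> path C d' f' g' -> d <= d'.
  by move=> P1 P2; apply/eqP; rewrite eqn_leq (H _ _ _ _ _ _ P1 P2) (H _ _ _ _ _ _ P2 P1).
move=> {}d {}f {}g {}d' {}f' {}g' [m c _] [m' c' _].
have [k [kn e1 e2]] := (m _ _).1 ((m' (f' 0) (g' 0)).2 (ex_intro _ 0 (And3 isT erefl erefl))).
by have := c k kn; have := c' 0 isT; lia.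
Qed.

Lemma path_mem R d f g k : path (incell R) d f g -> k < n ->
  exists x, [/\ x \in R, x.1 = f k :> nat & x.2 = g k :> nat].
Proof. by case=> m _ _ kn; apply: (m (f k) (g k)).2; exists k. Qed.

Lemma path_memE R d f g x : path (incell R) d f g -> x \in R ->
  exists k, [/\ k < n, x.1 = f k :> nat & x.2 = g k :> nat].
Proof. by case=> m _ _ /incellE/m. Qed.

Lemma top_rightE R d f g x : path (incell R) d f g ->
  is_top_right R x <-> x.1 = f p :> nat /\ x.2 = g p :> nat.
Proof.
move=> rp; have c := rp_content rp; have [y [yR y1 y2]] := path_mem rp (leqnn n).
split=> [[xR H]|[x1 x2]].
  have [H1 H2] := H y yR; have [k [kn xk xk']] := path_memE rp xR.
  have [M1 M2] := path_mono rp (kn : k <= p) (leqnn _).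
  by move: H1 H2; rewrite y1 y2 xk xk'; lia.
have -> : x = y by apply: cell_eq; rewrite ?x1 ?x2.
split=> // w /(path_memE rp)[k [kn -> ->]]; rewrite y1 y2.
exact: (path_mono rp (kn : k <= p) (leqnn _)).
Qed.

Hypothesis hh : h0 <= h.

Lemma horizontal_stripE P : {in P, forall R, is_ribbon n R} ->
  horizontal_strip P <->
  forall R d f g a, R \in P -> path (incell R) d f g -> a.+1 = f p ->
    ~ incell (finset.cover P) a (g p).
Proof.
move=> rib; split=> [H R d f g a RP rp fa [x [xP x1 x2]]|H R x RP tr y yx1 yx2].
  have [y [yR y1 y2]] := path_mem rp (leqnn n).
  have tr : is_top_right R y by apply/(top_rightE _ rp).
  have E1 : x.1.+1 = y.1 :> nat by rewrite x1 y1.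
  have E2 : x.2 = y.2 by apply: val_inj; rewrite /= x2 y2.
  by have /negP[] := H R y RP tr x E1 E2.
have [d [f [g rp]]] := ribbon_pathP hh (rib R RP).
have [x1 x2] := (top_rightE x rp).1 tr.
apply/negP => yP; apply: (H R d f g y.1 RP rp); first by rewrite yx1 x1.
by exists y; split=> //; rewrite yx2 x2.
Qed.

Lemma mem_transpose R (y : 'I_w0 * 'I_h0) : (y \in transpose_cells R) = ((y.2, y.1) \in R).
Proof.
apply/imsetP/idP => [[x xR ->]|yR]; first by rewrite -surjective_pairing.
by exists (y.2, y.1) => //; case: y {yR}.
Qed.

Lemma cover_transpose P (y : 'I_w0 * 'I_h0) :
  (y \in finset.cover [set transpose_cells R | R : {set box} in P]) = ((y.2, y.1) \in finset.cover P).
Proof.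
apply/bigcupP/bigcupP => [[_ /imsetP[R RP ->]]|[R RP yR]].
  by rewrite mem_transpose => yR; exists R.
by exists (transpose_cells R); rewrite ?mem_transpose //; apply: imset_f.
Qed.

Lemma bottom_leftE R d f g x : path (incell R) d f g ->
  is_top_right (transpose_cells R) (x.2, x.1) <-> x.1 = f 0 :> nat /\ x.2 = g 0 :> nat.
Proof.
move=> rp; have c := rp_content rp; have [y [yR y1 y2]] := path_mem rp (ltn0Sn p).
split=> [[]|[x1 x2]]; rewrite ?mem_transpose /=.
  rewrite -surjective_pairing => xR /(_ (y.2, y.1)).
  rewrite mem_transpose -surjective_pairing => /(_ yR) /= [H1 H2].
  have [k [kn xk xk']] := path_memE rp xR.
  have [M1 M2] := path_mono rp (leq0n k) kn.
  have := c k kn; have := c 0 isT.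
  by move: H1 H2; rewrite y1 y2 xk xk'; lia.
have -> : x = y by apply: cell_eq; rewrite ?x1 ?x2.
split; rewrite ?mem_transpose -?surjective_pairing // => w; rewrite mem_transpose.
move=> /(path_memE rp)[k [kn /= -> ->]]; rewrite y1 y2.
by have [] := path_mono rp (leq0n k) kn.
Qed.

Lemma vertical_stripE P : {in P, forall R, is_ribbon n R} ->
  vertical_strip P <->
  forall R d f g b, R \in P -> path (incell R) d f g -> b.+1 = g 0 ->
    ~ incell (finset.cover P) (f 0) b.
Proof.
move=> rib; split=> [H R d f g b RP rp gb [x [xP x1 x2]]|H _ y /imsetP[R RP ->] tr w wy1 wy2].
  have [y [yR y1 y2]] := path_mem rp (ltn0Sn p).
  have tr : is_top_right (transpose_cells R) (y.2, y.1) by apply/(bottom_leftE _ rp).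
  have E1 : (x.2, x.1).1.+1 = (y.2, y.1).1 :> nat by rewrite /= x2 y2.
  have E2 : (x.2, x.1).2 = (y.2, y.1).2 by apply: val_inj; rewrite /= x1 y1.
  have /negP[] := H (transpose_cells R) (y.2, y.1) (imset_f _ RP) tr _ E1 E2.
  by rewrite cover_transpose -surjective_pairing.
have [d [f [g rp]]] := ribbon_pathP hh (rib R RP).
have [x1 x2] := (bottom_leftE (y.2, y.1) rp).1 ltac:(by rewrite -surjective_pairing).
rewrite cover_transpose; apply/negP => wP; apply: (H R d f g w.1 RP rp).
  by rewrite wy1 -x2.
by exists (w.2, w.1); split=> //=; rewrite wy2.
Qed.

Definition strip (horizontal : bool) P := if horizontal then horizontal_strip P else vertical_strip P.

Definition before (horizontal : bool) d d' := if horizontal then d < d' else d' < d.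

Section Removal.
Variables (al be : {set box}) (P : {set {set box}}) (o : bool).
Hypotheses (yal : is_young al) (ybe : is_young be) (sub : al \subset be).
Hypothesis part : finset.partition P (be :\: al).
Hypothesis rib : {in P, forall R, is_ribbon n R}.
Hypothesis str : strip o P.

(** The abstract lemmas apply directly to a horizontal strip. For a vertical strip they are applied
    to the transposed ribbons, where the largest tail content belongs to the ribbon that had the
    smallest one. *)
Lemma strip_removal :
  {in P &, forall R R' d f g f' g', path (incell R) d f g -> path (incell R') d f' g' -> R = R'} /\
  {in P, forall R d f g, path (incell R) d f g ->
   (forall R' d' f' g', R' \in P -> R' != R -> path (incell R') d' f' g' -> before o d' d) ->
   is_young (be :\: R)}.
Proof.
have /boolp.choice[c cP] : forall R, exists c : nat * (nat -> nat) * (nat -> nat),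
    R \in P -> path (incell R) c.1.1 c.1.2 c.2.
  move=> R; case: (boolP (R \in P)) => RP; last by exists (0, id, id).
  by have [d [f [g rp]]] := ribbon_pathP hh (rib RP); exists (d, f, g).
have [dal dbe] := ((young_down al).1 yal, (young_down be).1 ybe).
have inj u v i j : u \in P -> v \in P -> incell u i j -> incell v i j -> u = v.
  move=> uP vP [x [xu x1 x2]] [y [yv y1 y2]]; have xy : x = y by apply: cell_eq; rewrite ?x1 ?x2.
  subst y; case/and3P: part => _ /trivIsetP tI _.
  by apply/eqP; apply: contraT => /(tI _ _ uP vP) dis; rewrite (disjointFr dis xu) in yv.
have cov i j : (incell be i j /\ ~ incell al i j) <-> exists2 u, u \in P & incell u i j.
  rewrite -incellD -(cover_partition part); split.
    by case=> x [/bigcupP[u uP xu] x1 x2]; exists u => //; exists x.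
  by case=> u uP [x [xu x1 x2]]; exists x; split=> //; apply/bigcupP; exists u.
have covP i j : incell (finset.cover P) i j <-> incell be i j /\ ~ incell al i j.
  by rewrite (cover_partition part) incellD.
(* This bound keeps the truncated subtraction in the transposed tail contents exact. *)
have dp R : R \in P -> (c R).1.1 + p <= h.-1 + (h + w0).
  move=> RP; have := rp_content (cP R RP) (leqnn n).
  by have [x [_ _ x2]] := path_mem (cP R RP) (leqnn n); have := ltn_ord x.2; lia.
have key : {in P &, forall u v, (c u).1.1 = (c v).1.1 -> u = v} /\
   {in P, forall u, (forall v, v \in P -> v != u -> before o (c v).1.1 (c u).1.1) ->
     forall i j, incell u i j -> (incell be i j.+1 -> incell u i j.+1) /\ (incell be i.+1 j -> incell u i.+1 j)}.
  move: str; rewrite /strip; case: o => stro.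
    have top u a : u \in P -> a.+1 = (c u).1.2 p -> ~ (incell be a ((c u).2 p) /\ ~ incell al a ((c u).2 p)).
      by move=> uP ua; rewrite -covP; apply: (horizontal_stripE rib).1 uP (cP u uP) ua.
    split=> [u v uP vP|u uP ord i j uij].
      exact: (@strip_tail_inj p h.-1 _ (fun u => u \in P) (@incell h0 w0)
        (fun u => (c u).1.1) (fun u => (c u).1.2) (fun u => (c u).2) _ _ cP inj cov dal dbe top).
    apply: (@strip_last_removable p h.-1 _ (fun u => u \in P) (@incell h0 w0)
        (fun u => (c u).1.1) (fun u => (c u).1.2) (fun u => (c u).2) _ _ cP inj cov dal dbe top) => //.
    by move=> v vP; case: (eqVneq v u) => [->//|vu]; apply/ltnW/ord.
  pose tr (C : nat -> nat -> Prop) i j := C j i.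
  have cP' u : u \in P -> ribbon_path p (h + w0) (tr (incell u)) (h.-1 + (h + w0) - ((c u).1.1 + p))
      (fun k => (c u).2 (p - k)) (fun k => (c u).1.2 (p - k)).
    by move=> uP; apply: ribbon_path_tr (cP u uP); apply: dp.
  have top u a : u \in P -> a.+1 = (c u).2 (p - p) ->
      ~ (tr (incell be) a ((c u).1.2 (p - p)) /\ ~ tr (incell al) a ((c u).1.2 (p - p))).
    by move=> uP; rewrite subnn /tr => ua; rewrite -covP; apply: (vertical_stripE rib).1 uP (cP u uP) ua.
  have dal' : downclosed (tr (incell al)) by move=> i j i' j' H ii jj; apply: dal H jj ii.
  have dbe' : downclosed (tr (incell be)) by move=> i j i' j' H ii jj; apply: dbe H jj ii.
  have inj' u v i j : u \in P -> v \in P -> tr (incell u) i j -> tr (incell v) i j -> u = v.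
    exact: inj.
  have cov' i j : (tr (incell be) i j /\ ~ tr (incell al) i j) <-> exists2 u, u \in P & tr (incell u) i j.
    exact: cov.
  split=> [u v uP vP duv|u uP ord i j uij].
    apply: (strip_tail_inj cP' inj' cov' dal' dbe' top uP vP).
    by rewrite /= duv.
  have ord' v : v \in P ->
      h.-1 + (h + w0) - ((c v).1.1 + p) <= h.-1 + (h + w0) - ((c u).1.1 + p).
    move=> vP; case: (eqVneq v u) => [->//|vu].
    by have := ord v vP vu; have := dp v vP; have := dp u uP; rewrite /before; lia.
  have [H1 H2] := @strip_last_removable p (h + w0) _ (fun u => u \in P)
     (fun u => tr (incell u)) _ _ _ _ _ cP' inj' cov' dal' dbe' top u j i uP ord' uij.
  by split.
case: key => key1 key2; split.
  move=> u v uP vP d f g f' g' rp rp'; apply: key1 => //.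
  by rewrite (path_tail_uniq (cP u uP) rp) (path_tail_uniq (cP v vP) rp').
move=> u uP d f g rp ord; have {}key2 := key2 u uP _.
have {key2}key i j : incell u i j ->
    (incell be i j.+1 -> incell u i j.+1) /\ (incell be i.+1 j -> incell u i.+1 j).
  apply: key2 => v vP vu; rewrite (path_tail_uniq (cP u uP) rp).
  exact: ord vP vu (cP v vP).
apply/young_down => i j i' j' /incellD[bij nuij] ii jj; apply/incellD.
split; first exact: dbe bij ii jj.
move=> uij; apply: nuij.
(* Walking from the cell [(i', j')] of [u] down to row [i] and then right to column [j], inside
   [be], never leaves [u]. *)
have H1 : incell u i j'.
  have : incell be i j' by apply: dbe bij _ jj.
  rewrite -(subnK ii); elim: (i - i') => // k IH; rewrite addSn => bk.
  by have bk' := dbe _ _ _ _ bk (leqnSn _) (leqnn _); apply: ((key _ _ (IH bk')).2 bk).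
rewrite -(subnK jj) in bij *; elim: (j - j') bij => // k IH; rewrite addSn => bk.
by have bk' := dbe _ _ _ _ bk (leqnn _) (leqnSn _); apply: ((key _ _ (IH bk')).1 bk).
Qed.

End Removal.

(** In the horizontal case, the cell above the top right cell of [R] has a larger content than all
    of [R], so it is in no ribbon of [P], as these have smaller tail contents. For a ribbon of [P],
    the cell above its top right cell is in the Young diagram [be] and hence not in [R]. The
    vertical case is the mirror image. *)
Lemma strip_add o P R be d f g : is_young be -> R != set0 ->
  (forall R', R' \in P -> R' \subset be) -> [disjoint R & be] ->
  {in R |: P, forall R, is_ribbon n R} -> path (incell R) d f g ->
  strip o P ->
  (forall R' d' f' g', R' \in P -> path (incell R') d' f' g' -> before o d' d) ->
  strip o (R |: P).
Proof.
move=> ybe R0 sP dis rib rp str ord.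
have dbe := (young_down be).1 ybe.
have ribP : {in P, forall R, is_ribbon n R} by move=> S SP; apply: rib; rewrite inE SP orbT.
have notbe x : x \in R -> x \notin be by move=> xR; rewrite (disjointFr dis xR).
have covU : finset.cover (R |: P) = R :|: finset.cover P.
  by rewrite /cover bigcup_setU big_set1.
have [m c nx] := rp.
case: o str ord => str ord /=.
  apply/(horizontal_stripE rib) => S d' f' g' a; rewrite in_setU1 covU => SRP rp' fa [x [xC x1 x2]].
  case/orP: SRP xC => [/eqP SR|SP].
    subst S; rewrite inE => /orP[xR|/bigcupP[S SP xS]].
      have [k [kn xk xk']] := path_memE rp' xR.
      have := rp_content rp' kn; have := rp_content rp' (leqnn n); lia.
    have [d2 [f2 [g2 rp2]]] := ribbon_pathP hh (ribP S SP).
    have /= := ord S _ _ _ SP rp2; rewrite (path_tail_uniq rp rp').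
    have [k [kn xk xk']] := path_memE rp2 xS.
    have := rp_content rp2 kn; have := rp_content rp' (leqnn n); lia.
  rewrite inE => /orP[xR|xP].
    have [y [yS y1 y2]] := path_mem rp' (leqnn n).
    have yb : y \in be := subsetP (sP S SP) _ yS.
    case/negP: (notbe x xR); apply/incellE.
    by apply: (dbe _ _ _ _ ((incellE _ _).1 yb)); lia.
  by apply: ((horizontal_stripE ribP).1 str S d' f' g' a SP rp' fa); exists x.
apply/(vertical_stripE rib) => S d' f' g' b; rewrite in_setU1 covU => SRP rp' gb [x [xC x1 x2]].
case/orP: SRP xC => [/eqP SR|SP].
  subst S; rewrite inE => /orP[xR|/bigcupP[S SP xS]].
    have [k [kn xk xk']] := path_memE rp' xR.
    have := rp_content rp' kn; have := rp_content rp' (ltn0Sn p); lia.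
  have [d2 [f2 [g2 rp2]]] := ribbon_pathP hh (ribP S SP).
  have /= := ord S _ _ _ SP rp2; rewrite (path_tail_uniq rp rp').
  have [k [kn xk xk']] := path_memE rp2 xS.
  have := rp_content rp2 kn; have := rp_content rp' (ltn0Sn p); lia.
rewrite inE => /orP[xR|xP].
  have [y [yS y1 y2]] := path_mem rp' (ltn0Sn p).
  have yb : y \in be := subsetP (sP S SP) _ yS.
  case/negP: (notbe x xR); apply/incellE.
    by apply: (dbe _ _ _ _ ((incellE _ _).1 yb)); lia.
by apply: ((vertical_stripE ribP).1 str S d' f' g' b SP rp' gb); exists x.
Qed.

Lemma strip_sub o P P' : {in P', forall R, is_ribbon n R} -> P \subset P' -> strip o P' -> strip o P.
Proof.
move=> rib' /subsetP PP'; have rib : {in P, forall R, is_ribbon n R} by move=> R /PP'/rib'.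
have cov i j : incell (finset.cover P) i j -> incell (finset.cover P') i j.
  by case=> x [/bigcupP[R RP xR] x1 x2]; exists x; split=> //; apply/bigcupP; exists R; rewrite ?PP'.
case: o => /= [/(horizontal_stripE rib') H|/(vertical_stripE rib') H].
  by apply/(horizontal_stripE rib) => R d f g a RP rp fa /cov; apply: H (PP' R RP) rp fa.
by apply/(vertical_stripE rib) => R d f g a RP rp fa /cov; apply: H (PP' R RP) rp fa.
Qed.

End StripsInBox.

(** * Tableau sums *)

Section StepSequences.
Local Open Scope ring_scope.
Variables (p : nat) (R : comNzRingType) (q : R).
Implicit Types (s : seq (R * nat)) (phi psi : seq bool -> R) (t u : seq bool).

Definition stepseq s phi : seq bool -> R := foldr (fun zc => step p q zc.1 zc.2) phi s.

Lemma stepseq_rcons s x phi : stepseq (rcons s x) phi = stepseq s (step p q x.1 x.2 phi).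
Proof. exact: foldr_rcons. Qed.

Lemma stepseq_eq s phi psi t : (forall b, size b = size t -> phi b = psi b) ->
  stepseq s phi t = stepseq s psi t.
Proof.
move=> E; suff: forall b, size b = size t -> stepseq s phi b = stepseq s psi b by apply.
elim: s => //= c s IH b sb; apply: step_eq => b' sb'.
by apply: IH; rewrite sb'.
Qed.

Lemma stepseqD s phi psi t :
  stepseq s (fun b => phi b + psi b) t = stepseq s phi t + stepseq s psi t.
Proof.
elim: s t => //= c s IH t; rewrite -stepD; apply: step_eq => b _; exact: IH.
Qed.

Lemma stepseqZ s k phi t : stepseq s (fun b => k * phi b) t = k * stepseq s phi t.
Proof.
elim: s t => //= c s IH t; rewrite -stepZ; apply: step_eq => b _; exact: IH.
Qed.

Lemma stepseq_const z (s : seq nat) phi :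
  stepseq [seq (z, c) | c <- s] phi = steps p q z s phi.
Proof. by elim: s => //= c s ->. Qed.

Definition delta u t : R := (t == u)%:R.

(* Steps only move particles to the right. *)
Lemma stepseq_delta_le s t u : stepseq s (delta u) t != 0 ->
  forall e, (cnt t e <= cnt u e)%N.
Proof.
move=> H e; move: t H; elim: s => [|[z c] s IH] t /=.
  by rewrite /delta; case: (eqVneq t u) => [-> //|_]; rewrite mulr0n eqxx.
rewrite /step; case: ifP => ct; last by rewrite addr0; apply: IH.
case: (eqVneq (stepseq s (delta u) t) 0) => [->|/IH //].
rewrite add0r; case: (eqVneq (stepseq s (delta u) (move p c t)) 0) => [->|/IH le _].
  by rewrite mulr0 eqxx.
by apply: leq_trans le; rewrite cnt_move // leq_addr.
Qed.

Lemma move_inj c t u : size t = size u -> can_step p c t -> can_step p c u ->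
  move p c t = move p c u -> t = u.
Proof.
move=> s ct cu E; apply: cnt_inj => // e.
by have := cnt_move e ct; rewrite E cnt_move // => /addIn.
Qed.

End StepSequences.

(** * Tableaux taken apart ribbon by ribbon *)

Section TableauSum.
Variables (p h0 w0 h M : nat) (L : finType) (pr : rel L) (hor : L -> bool).
Notation n := p.+1.
Hypotheses (hh : (h0 <= h)%N) (hM : (h + w0 <= M)%N).
Hypothesis prT : is_total_order pr.
Notation box := ('I_h0 * 'I_w0)%type.
Notation path := (ribbon_path p h.-1).

Implicit Types (D : {set box}) (T : {ffun {set box} -> option L}) (l : L).
Implicit Types (al be : intpart) (s : seq (L * nat)).

Definition tileset T : {set {set box}} := [set S | T S != None].
Definition tiles_of T l : {set {set box}} := [set S | T S == Some l].
Definition tiles_in T (Q : pred L) : {set {set box}} :=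
  [set S | if T S is Some l then Q l else false].

(* The tableaux of shape [D' \ D] all of whose (label, tail content) pairs are
   in [s]. *)
Record partial_tableau s D D' T : Prop := PartialTableau {
  pt_sub : D \subset D';
  pt_part : finset.partition (tileset T) (D' :\: D);
  pt_rib : {in tileset T, forall S, is_ribbon n S};
  pt_mem : forall S l d f g, T S = Some l -> path (incell S) d f g -> (l, d) \in s;
  pt_young : forall Q : pred L, (forall l l', pr l l' -> Q l' -> Q l) ->
    is_young (D :|: finset.cover (tiles_in T Q));
  pt_strip : forall l, strip (hor l) (tiles_of T l) }.

(** The order in which ribbons are added: by label, and within one label as the type of its strip
    requires. *)
Definition step_lt (x y : L * nat) :=
  pr x.1 y.1 && ((x.1 != y.1) || before (hor y.1) x.2 y.2).

Definition retile T S (o : option L) : {ffun {set box} -> option L} :=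
  [ffun S' => if S' == S then o else T S'].

Lemma tiles_ofS T l : tiles_of T l \subset tileset T.
Proof. by apply/subsetP => S; rewrite !inE => /eqP ->. Qed.

Section Peel.
Variables (s : seq (L * nat)) (l : L) (c : nat).
Hypothesis sl : all (fun x => step_lt x (l, c)) s.

Let slP l' c' : (l', c') \in s -> pr l' l /\ (l' = l -> before (hor l) c' c).
Proof.
move/(allP sl)/andP => /= [-> H]; split=> // E; move: H; rewrite E eqxx /=; exact.
Qed.

Let notin : (l, c) \notin s.
Proof. by apply/negP => /slP[_ /(_ erefl)]; rewrite /before ltnn if_same. Qed.

Let prr : pr l l. Proof. by case: prT. Qed.

Let pr_le l' c' : (l', c') \in rcons s (l, c) -> pr l' l.
Proof. by rewrite mem_rcons inE => /predU1P[[-> _]//|/slP[]]. Qed.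

(** The labels in use other than the last one make up a down-set, so the inner shape [al] is a Young
    diagram. Allowing arbitrary down-sets [Q], and not only the segments up to a label, covers the
    case where no smaller label exists. *)
Lemma pt_last (D D' : {set box}) T : D \subset D' ->
  finset.partition (tileset T) (D' :\: D) ->
  {in tileset T, forall S, is_ribbon n S} ->
  (forall Q : pred L, (forall l l', pr l l' -> Q l' -> Q l) ->
    is_young (D :|: finset.cover (tiles_in T Q))) ->
  (forall S l', T S = Some l' -> pr l' l) ->
  let al := D :|: finset.cover (tiles_in T (fun l' => l' != l)) in
  is_young al /\ al \subset D' /\ finset.partition (tiles_of T l) (D' :\: al).
Proof.
move=> sDD part rib you memT /=; split; [|split].
- have -> : tiles_in T (fun l' => l' != l) = tiles_in T (fun l' => pr l' l && (l' != l)).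
    apply/setP => S; rewrite !inE; case TS: (T S) => [l'|//].
    by rewrite (memT _ _ TS).
  apply: you => a b ab /andP[bl nbl]; case: prT => _ anti tr _.
  rewrite (tr _ _ _ ab bl) /=; apply: contraNneq nbl => E.
  by apply/eqP/anti; rewrite bl -E ab.
- rewrite subUset sDD; apply/subsetP => x /bigcupP[S ST xS].
  have S'T' : S \in tileset T by move: ST; rewrite !inE; case: (T S).
  by have := subsetP (partitionS part S'T') x xS; rewrite inE => /andP[].
- case/and3P: part => /eqP cov tri n0.
  apply/and3P; split.
  - apply/eqP/setP => x; rewrite -setDDl -cov in_setD; apply/bigcupP/andP => [[S ST xS]|].
      have SlT := subsetP (tiles_ofS T l) _ ST.
      split; last by apply/bigcupP; exists S.
      apply/negP => /bigcupP[S' S'T xS']; have S'T' : S' \in tileset T.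
        by move: S'T; rewrite !inE; case: (T S').
      have SS : S = S' by apply/eqP; apply: contraT => /(trivIsetP tri _ _ SlT S'T') di; rewrite (disjointFr di xS) in xS'.
      by move: S'T ST; rewrite -SS !inE; case: (T S) => // l' /[swap] /eqP[->]; rewrite eqxx.
    case=> nx /bigcupP[S ST xS]; exists S => //; rewrite inE.
    move: ST; rewrite inE; case TS: (T S) => [l'|//] _.
    case: (eqVneq l' l) => [->//|ll]; case/negP: nx; apply/bigcupP; exists S => //.
    by rewrite inE TS.
  - exact: trivIsetS (tiles_ofS T l) tri.
  - by apply: contra n0; apply: (subsetP (tiles_ofS T l)).
Qed.

Lemma pt_le D D' T S l' : partial_tableau (rcons s (l, c)) D D' T -> T S = Some l' -> pr l' l.
Proof.
case=> _ _ rib mem _ _ TS.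
have [d [f' [g' rp']]] := ribbon_pathP hh (rib S ltac:(by rewrite inE TS)).
exact: pr_le (mem _ _ _ _ _ TS rp').
Qed.

Lemma pt_peel D D' T S f g : is_young D' -> partial_tableau (rcons s (l, c)) D D' T ->
  T S = Some l -> path (incell S) c f g -> is_young (D' :\: S) /\ S \subset D'.
Proof.
move=> yD' tT TS rp; have := pt_le tT; case: tT => sDD part rib mem you str memT.
have [yal [sal pal]] := pt_last sDD part rib you (fun S l' => @memT S l').
have sSD : S \subset D' :\: D by apply: partitionS part _; rewrite inE TS.
have ribl : {in tiles_of T l, forall S, is_ribbon n S}.
  by move=> S' /(subsetP (tiles_ofS T l)); apply: rib.
have [inj rem] := strip_removal hh yal yD' sal pal ribl (str l).
have Sl : S \in tiles_of T l by rewrite inE TS.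
split; last exact: subset_trans sSD (subsetDl _ _).
apply: (rem S Sl c f g rp) => S' d' f' g' S'l SS' rp'.
have := S'l; rewrite inE => /eqP TS'.
have := mem _ _ _ _ _ TS' rp'; rewrite mem_rcons inE => /predU1P[[dc]|/slP[_ -> //]].
by subst d'; case/eqP: SS'; apply: inj rp' rp.
Qed.

Section Add.
Variables (D D' D'' : {set box}) (f g : nat -> nat).
Hypotheses (yD : is_young D) (yD' : is_young D') (yD'' : is_young D'') (sub : D'' \subset D').
Hypothesis rp : path (incell (D' :\: D'')) c f g.
Notation S0 := (D' :\: D'').

Let S0n : S0 != set0.
Proof. by have [x [xS _ _]] := path_mem rp (ltn0Sn p); apply/set0Pn; exists x. Qed.

Let dis : [disjoint S0 & D''].
Proof. by rewrite -setI_eq0 setIDAC -setIDA setDv setI0. Qed.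

Let ribS0 : is_ribbon n S0.
Proof. exact: path_ribbon yD' yD'' sub rp. Qed.

Lemma pt_None T : partial_tableau s D D'' T -> T S0 = None.
Proof.
move=> tT; case E: (T S0) => [l'|//]; exfalso.
have ST : S0 \in tileset T by rewrite inE E.
have := partitionS (pt_part tT) ST; rewrite subsetD => /andP[sS _].
case/set0Pn: S0n => x xS; by have := disjointFr dis xS; rewrite (subsetP sS).
Qed.

(** Together with [pt_remove] this gives the bijection between the tableaux whose last tile is [S0],
    with the pair [(l, c)], and the tableaux of the smaller shape that use only pairs in [s]. *)
Lemma pt_add T : partial_tableau s D D'' T ->
  partial_tableau (rcons s (l, c)) D D' (retile T S0 (Some l)).
Proof.
move=> tT; have TN := pt_None tT; case: (tT) => sDD part rib mem you str.
have tS : tileset (retile T S0 (Some l)) = S0 |: tileset T.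
  by apply/setP => S; rewrite !inE ffunE; case: (S == S0).
have D'E : D' = D'' :|: S0.
  by apply/setP => x; rewrite !inE; have := subsetP sub x; case: (x \in D''); case: (x \in D') => // /(_ isT).
have ribU : {in S0 |: tileset T, forall S, is_ribbon n S}.
  by move=> S; rewrite in_setU1 => /predU1P[->|/rib].
have tS0 : S0 \notin tileset T by rewrite inE TN.
split.
- exact: subset_trans sDD sub.
- rewrite tS; have -> : D' :\: D = S0 :|: (D'' :\: D).
    apply/setP => x; rewrite !inE; have := subsetP sub x; have := subsetP sDD x.
    case: (x \in D''); case: (x \in D'); case: (x \in D) => //= H1 H2;
      first [by have := H1 isT | by have := H2 isT].
  apply: partitionU1 => //; apply: disjointWr dis; exact: subsetDl.
- by rewrite tS.
- move=> S l' d f' g'; rewrite ffunE mem_rcons inE; case: eqP => [-> [<-] rp'|_ TS rp'].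
    by rewrite (path_tail_uniq rp rp') eqxx.
  by rewrite (mem S l' d f' g') ?orbT.
- move=> Q Qd; case Ql: (Q l); last first.
    have -> : tiles_in (retile T S0 (Some l)) Q = tiles_in T Q.
      by apply/setP => S; rewrite !inE ffunE; case: eqP => // ->; rewrite TN Ql.
    exact: you.
  (* No label in use is larger than [l], so a down-set that contains [l] contains all of them. *)
  have -> : tiles_in (retile T S0 (Some l)) Q = S0 |: tileset T; last first.
    rewrite /finset.cover bigcup_setU big_set1 -/(finset.cover _) (cover_partition part).
    suff -> : D :|: (S0 :|: D'' :\: D) = D' by [].
    apply/setP => x; rewrite !inE; have := subsetP sub x; have := subsetP sDD x.
    case: (x \in D''); case: (x \in D'); case: (x \in D) => //= H1 H2;
      first [by have := H1 isT | by have := H2 isT].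
  apply/setP => S; rewrite !inE ffunE; case: eqP => //= _.
  case TS: (T S) => [l'|//]; have [d [f' [g' rp']]] := ribbon_pathP hh (rib S ltac:(by rewrite inE TS)).
  by rewrite (Qd l' l) //; case: (slP (mem _ _ _ _ _ TS rp')).
- move=> l'; case: (eqVneq l' l) => [->|ll'].
    have -> : tiles_of (retile T S0 (Some l)) l = S0 |: tiles_of T l.
      by apply/setP => S; rewrite !inE ffunE; case: (S == S0) => //=; rewrite eqxx.
    apply: (strip_add hh yD'' S0n _ dis _ rp (str l)).
    + move=> S; rewrite inE => /eqP TS.
      by have := partitionS part (ltac:(by rewrite inE TS) : S \in tileset T); rewrite subsetD => /andP[].
    + move=> S; rewrite in_setU1 => /predU1P[->//|/(subsetP (tiles_ofS T l))]; exact: rib.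
    + move=> S d f' g'; rewrite inE => /eqP TS rp'.
      by have [_ ->] := slP (mem _ _ _ _ _ TS rp').
  have -> : tiles_of (retile T S0 (Some l)) l' = tiles_of T l'; last exact: str.
  apply/setP => S; rewrite !inE ffunE; case: (eqVneq S S0) => // ->; rewrite TN /=.
  by apply/eqP => -[E]; rewrite E eqxx in ll'.
Qed.

Lemma pt_remove T : partial_tableau (rcons s (l, c)) D D' T -> T S0 = Some l ->
  partial_tableau s D D'' (retile T S0 None).
Proof.
move=> tT TS0; have memT S l' := @pt_le D D' T S l' tT.
case: tT => sDD part rib mem you str.
have S0T : S0 \in tileset T by rewrite inE TS0.
have tS : tileset (retile T S0 None) = tileset T :\ S0.
  by apply/setP => S; rewrite !inE ffunE; case: (S == S0).
have := partitionS part S0T; rewrite subsetD => /andP[_ disD].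
have sDD'' : D \subset D''.
  apply/subsetP => x xD; apply: contraT => xD''.
  by have := disjointFl disD xD; rewrite inE xD'' (subsetP sDD).
have ribl : {in tiles_of T l, forall S, is_ribbon n S}.
  by move=> S /(subsetP (tiles_ofS T l)); apply: rib.
have [yal [sal pal]] := pt_last sDD part rib you memT.
have [inj _] := strip_removal hh yal yD' sal pal ribl (str l).
have coverE : finset.cover (tileset T :\ S0) = D'' :\: D.
  rewrite coverD1 ?(partition_trivIset part) // (cover_partition part).
  apply/setP => x; rewrite !inE; have := subsetP sub x.
  by case: (x \in D''); case: (x \in D'); case: (x \in D) => // /(_ isT).
split=> //.
- rewrite tS -coverE; apply/and3P; split=> //.
    by apply: trivIsetS (partition_trivIset part); apply: subsetDl.
  by rewrite inE (partition0 part) andbF.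
- by move=> S; rewrite tS => /setD1P[_]; apply: rib.
- move=> S l' d f' g'; rewrite ffunE; case: eqP => // SS0 TS rp'.
  have := mem _ _ _ _ _ TS rp'; rewrite mem_rcons inE => /predU1P[[ll dc]|//].
  subst l' d; case: SS0; apply: inj rp' rp; by rewrite inE ?TS ?TS0.
- move=> Q Qd; case Ql: (Q l); last first.
    have -> : tiles_in (retile T S0 None) Q = tiles_in T Q; last exact: you.
    by apply/setP => S; rewrite !inE ffunE; case: eqP => // ->; rewrite TS0 Ql.
  have -> : tiles_in (retile T S0 None) Q = tileset T :\ S0.
    apply/setP => S; rewrite !inE ffunE; case: eqP => //= _.
    by case TS: (T S) => [l'|//]; rewrite (Qd l' l (memT _ _ TS) Ql).
  rewrite coverE; suff -> : D :|: D'' :\: D = D'' by [].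
  apply/setP => x; rewrite !inE; have := subsetP sDD'' x.
  by case: (x \in D''); case: (x \in D) => // /(_ isT).
- move=> l'; apply: (strip_sub hh) (str l'); first by move=> S /(subsetP (tiles_ofS T l')); apply: rib.
  by apply/subsetP => S; rewrite !inE ffunE; case: (S == S0).
Qed.

End Add.
End Peel.

Section Sum.
Local Open Scope ring_scope.
Variables (R : comNzRingType) (q : R) (z : L -> R).

Definition tableau_weight T : R :=
  \prod_(S : {set box}) (if T S is Some l then q ^+ ribbon_spin S * z l else 1).

Lemma diagram_sub al be : boxed h0 w0 al -> boxed h0 w0 be ->
  diagram h0 w0 al \subset diagram h0 w0 be -> forall i, (nth 0%N al i <= nth 0%N be i)%N.
Proof.
move=> ba bb /subsetP sub i; rewrite leqNgt; apply/negP => lt.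
have [x [xa x1 x2]] := (incell_diagram i (nth 0%N be i) ba).2 lt.
by have := sub x xa; rewrite inE x1 x2 ltnn.
Qed.

Lemma diagram_inj al be : boxed h0 w0 al -> boxed h0 w0 be ->
  diagram h0 w0 al = diagram h0 w0 be -> al = be.
Proof.
move=> ba bb E; apply: part_eq => i; apply/eqP; rewrite eqn_leq.
by rewrite !diagram_sub ?E.
Qed.

(** The word [b] has as many particles as that of [al], hence comes from a partition; this partition
    is contained in [al], hence lies in the same box. *)
Lemma predecessor c al b : boxed h0 w0 al -> size b = M -> can_step p c b ->
  move p c b = bits h M al ->
  exists al', [/\ boxed h0 w0 al', bits h M al' = b,
    diagram h0 w0 al' \subset diagram h0 w0 al &
    path (incell (diagram h0 w0 al :\: diagram h0 w0 al')) c
      (fun k => cnt b (c + k).+1) (fun k => (c + k + cnt b (c + k).+1 - h.-1)%N)].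
Proof.
move=> ba sb cb E; have fa := boxed_fits hh hM ba.
have cE e : cnt (bits h M al) e = (cnt b e + (c < e <= c + n))%N by rewrite -E cnt_move.
have b0 : count id b = h by have := cE 0%N; rewrite (cnt_bits0 fa) /cnt drop0 addn0.
have [al' fa' bE] := bits_surj sb b0.
have sub i : (nth 0%N al' i <= nth 0%N al i)%N.
  by apply: (cnt_sub fa' fa) => e; rewrite bE cE leq_addr.
have ba' : boxed h0 w0 al'.
  case/andP: ba => sa wa; rewrite /boxed (leq_trans (sub 0%N) wa) andbT.
  rewrite leqNgt; apply/negP => lt; have := part_gt0 al' h0; rewrite lt => gt0.
  have := leq_trans gt0 (sub h0); rewrite part_gt0; lia.
have [_ rp] := cnt_path hh hM ba ba' ltac:(by rewrite bE).
exists al'; split=> //; last by rewrite bE in rp.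
by apply/subsetP => x; rewrite !inE => /leq_trans; apply.
Qed.

Lemma pt_nil D D' T : partial_tableau [::] D D' T -> T = [ffun => None] /\ D = D'.
Proof.
case=> sub part rib mem _ _.
have TN : T = [ffun => None].
  apply/ffunP => S; rewrite ffunE; case TS: (T S) => [l|//].
  have [d [f [g rp]]] := ribbon_pathP hh (rib S ltac:(by rewrite inE TS)).
  by have := mem _ _ _ _ _ TS rp.
split=> //; apply/eqP; rewrite eqEsubset sub -setD_eq0 /=; apply/eqP.
have tn : tileset T = set0 by rewrite TN; apply/setP => S; rewrite !inE ffunE.
by rewrite -(cover_partition part) tn /finset.cover big_set0.
Qed.

Lemma pt_nil_refl D : is_young D -> partial_tableau [::] D D [ffun => None].
Proof.
move=> yD; have tn : tileset [ffun=> None] = set0 by apply/setP => S; rewrite !inE ffunE.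
split=> //.
- by rewrite setDv partition_set0 tn.
- by move=> S; rewrite tn inE.
- by move=> S l d f g; rewrite ffunE.
- move=> Q _; have -> : tiles_in [ffun=> None] Q = set0 by apply/setP => S; rewrite !inE ffunE.
  by rewrite /finset.cover big_set0 setU0.
- move=> l; have -> : tiles_of [ffun=> None] l = set0 by apply/setP => S; rewrite !inE ffunE.
  by case: (hor l) => S /=; [|move=> ?]; rewrite ?imset0 inE.
Qed.

Lemma pt_rcons s x D D' T : partial_tableau s D D' T -> partial_tableau (rcons s x) D D' T.
Proof.
case=> sub part rib mem you str; split=> // S l d f g TS rp.
by rewrite mem_rcons inE (mem _ _ _ _ _ TS rp) orbT.
Qed.

Lemma pt_last_tile s l c D D' T : partial_tableau (rcons s (l, c)) D D' T ->
  ~ partial_tableau s D D' T -> exists S f g, T S = Some l /\ path (incell S) c f g.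
Proof.
case=> sub part rib mem you str; apply: boolp.contra_notP => H.
split=> // S l' d f g TS rp; have := mem _ _ _ _ _ TS rp.
rewrite mem_rcons inE => /predU1P[[ll dc]|//]; subst l' d.
by case: H; exists S, f, g.
Qed.

(** Induction on the last pair [(l, c)]. Tableaux without such a tile give the summand 1 of the
    factor [1 + z u_c]. Those with it all have the same tile there, because [move p c] is injective
    and so the smaller shape is unique; the tile accounts for [z l * q ^+ jump p c b]. *)
Lemma tableau_sum s be al : pairwise step_lt s -> boxed h0 w0 be -> boxed h0 w0 al ->
  \sum_(T | boolp.asbool (partial_tableau s (diagram h0 w0 be) (diagram h0 w0 al) T)) tableau_weight T
  = stepseq p q [seq (z x.1, x.2) | x <- s] (delta R (bits h M al)) (bits h M be).
Proof.
move=> + bb; elim/last_ind: s al => [|s [l c] IH] al.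
  move=> _ ba; rewrite /= /delta; case: eqP => [/(bits_inj (boxed_fits hh hM bb) (boxed_fits hh hM ba)) <-|ne].
    rewrite (big_pred1 [ffun => None]) => [|T].
      by rewrite /tableau_weight big1 // => S _; rewrite ffunE.
    apply/boolp.asboolP/eqP => [/pt_nil[]//|->].
    by apply: pt_nil_refl; apply/is_youngE; exists be.
  rewrite big_pred0 // => T; apply/boolp.asboolP => /pt_nil[_ E]; apply: ne.
  by congr bits; apply: diagram_inj.
rewrite pairwise_rcons => /andP[sl ps] ba.
have {}IH := fun al => @IH al ps.
set D := diagram h0 w0 be; set D' := diagram h0 w0 al; set u := bits h M al.
have yD : is_young D by apply/is_youngE; exists be.
have yD' : is_young D' by apply/is_youngE; exists al.
have peel T : partial_tableau (rcons s (l, c)) D D' T -> ~ partial_tableau s D D' T ->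
  exists al', [/\ boxed h0 w0 al', can_step p c (bits h M al'), move p c (bits h M al') = u &
     T (D' :\: diagram h0 w0 al') = Some l].
  move=> tT ntT; have [S [f [g [TS rp]]]] := pt_last_tile tT ntT.
  have [/is_youngE[al' ba' DE] sSD] := pt_peel sl yD' tT TS rp.
  have SE : S = D' :\: diagram h0 w0 al' by rewrite -DE setDDr setDv set0U; apply/esym/setIidPr.
  have sub : diagram h0 w0 al' \subset D' by rewrite -DE subsetDl.
  rewrite SE in rp TS.
  have cE := path_cnt hh hM ba ba' (diagram_sub ba' ba sub) rp.
  have [cs mE] := moveP (etrans (size_bits _ _ _) (esym (size_bits _ _ _))) cE.
  by exists al'.
rewrite map_rcons stepseq_rcons /=.
rewrite (bigID (fun T => boolp.asbool (partial_tableau s D D' T))) /=.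
rewrite [X in X + _](eq_bigl (fun T => boolp.asbool (partial_tableau s D D' T))); last first.
  by move=> T; apply/andP/idP => [[]//|H]; split=> //; apply/boolp.asboolP/pt_rcons/boolp.asboolP.
rewrite IH //.
(* If [u] does not result from a jump from [c], there is no tableau with the pair [(l, c)] and the
   second summand of the step vanishes too. *)
case: (boolp.pselect (exists b, [/\ size b = M, can_step p c b & move p c b = u])); last first.
  move=> nb; rewrite big_pred0 => [|T].
    rewrite addr0; apply: stepseq_eq => b; rewrite size_bits => sb.
    rewrite /step; case: ifP => [cb|_]; last by rewrite addr0.
    rewrite [delta R u (move p c b)]/delta; case: eqP => [E|_]; last by rewrite mulr0n mulr0 addr0.
    by case: nb; exists b.
  apply/negP => /andP[/boolp.asboolP tT /boolp.asboolP ntT]; apply: nb.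
  have [al' [_ c1 c2 _]] := peel T tT ntT.
  by exists (bits h M al'); rewrite size_bits.
case=> b [sb cb bE]; have [al' [ba' b'E sub rp]] := predecessor ba sb cb bE.
set D'' := diagram h0 w0 al' in sub rp; set S0 := D' :\: D'' in rp.
have yD'' : is_young D'' by apply/is_youngE; exists al'.
have spin : ribbon_spin S0 = jump p c b.
  by rewrite (path_spin hh rp) addn0 -addnS -(jumpE p) addnK.
have uniqS T : partial_tableau (rcons s (l, c)) D D' T -> ~ partial_tableau s D D' T ->
    T S0 = Some l.
  move=> tT ntT; have [al2 [ba2 c2 m2 T2]] := peel T tT ntT.
  suff E : al2 = al' by rewrite /S0 /D'' -E.
  apply: (bits_inj (boxed_fits hh hM ba2) (boxed_fits hh hM ba')); rewrite b'E.
  by apply: move_inj c2 cb _; rewrite ?m2 ?size_bits.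
rewrite [RHS](@stepseq_eq _ _ _ _ _ (fun t => delta R u t + (z l * q ^+ jump p c b) * delta R b t)); last first.
  move=> t; rewrite size_bits => st; rewrite /step; congr (_ + _); rewrite /delta.
  case: (eqVneq t b) => [->|tb]; first by rewrite cb bE eqxx.
  rewrite mulr0n mulr0; case: ifP => // ct; case: eqP => [mt|_]; last by rewrite mulr0n mulr0.
  by case/eqP: tb; apply: move_inj ct cb _; rewrite ?sb ?st ?mt.
rewrite stepseqD stepseqZ -/u; congr (_ + _); rewrite -b'E -IH // big_distrr /=.
rewrite (reindex_onto (fun T => retile T S0 (Some l)) (fun T => retile T S0 None)) /=; last first.
  move=> T /andP[/boolp.asboolP tT /boolp.asboolP ntT]; apply/ffunP => S; rewrite !ffunE.
  by case: eqP => // ->; rewrite (uniqS T tT ntT).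
apply: eq_big => [T|T].
  apply/idP/boolp.asboolP => [/andP[/andP[/boolp.asboolP tT _] /eqP E]|tT].
    have := pt_remove sl yD' yD'' sub rp tT; rewrite E; apply.
    by rewrite ffunE eqxx.
  have TN := pt_None rp tT; have tT' := pt_add sl yD' yD'' sub rp tT.
  apply/andP; split; last first.
    by apply/eqP/ffunP => S; rewrite !ffunE; case: eqP => // ->; rewrite TN.
  apply/andP; split; first exact/boolp.asboolP.
  apply/boolp.asboolP => -[_ _ _ mem _ _].
  have := mem S0 l c _ _ _ rp; rewrite ffunE eqxx => /(_ erefl).
  move/(allP sl)/andP => [_] /=; rewrite eqxx /before ltnn; by case: (hor l).
case/andP => _ /eqP E; have TN : T S0 = None by rewrite -E ffunE eqxx.
rewrite /tableau_weight (bigD1 S0) //= [in RHS](bigD1 S0) //= ffunE eqxx TN mul1r spin -b'E.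
rewrite [q ^+ _ * _]mulrC; congr (_ * _); apply: eq_bigr => S /negbTE SS.
by rewrite ffunE SS.
Qed.

End Sum.
End TableauSum.

Section SuperLLTSteps.
Local Open Scope ring_scope.
Variables (p : nat) (A A' : finType) (prec : rel (A + A')).
Hypothesis precT : is_total_order prec.
Notation n := p.+1.
Notation L := (A + A')%type.
Variables (R : comNzRingType) (q : R) (x : A -> R) (y : A' -> R).

Definition row_param (l : L) : R + R :=
  match l with inl a => inl (x a) | inr b => inr (y b) end.

Definition is_inl (l : L) : bool := if l is inl _ then true else false.

Definition step_weight (l : L) : R :=
  match l with inl a => x a | inr b => - y b end.

Definition block (M : nat) (l : L) : seq (L * nat) :=
  [seq (l, c) | c <- if is_inl l then iota 0 M else rev (iota 0 M)].

Definition labels : seq L := sort prec (enum {: L}).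

Lemma stepseq_blocks M ls phi :
  stepseq p q [seq (step_weight x.1, x.2) | x <- flatten [seq block M l | l <- ls]] phi
  = foldr (rowop p q M) phi [seq row_param l | l <- ls].
Proof.
rewrite /stepseq; elim: ls => //= l ls IH; rewrite map_cat foldr_cat IH -/(stepseq p q _ _).
rewrite /block -map_comp; case: l => [a|b] /=.
  by rewrite -[map _ _]/[seq (x a, c) | c <- iota 0 M] stepseq_const.
by rewrite -[map _ _]/[seq (- y b, c) | c <- rev (iota 0 M)] stepseq_const.
Qed.

Lemma labels_pairwise : pairwise [rel l l' | prec l l' && (l != l')] labels.
Proof.
case: precT => _ _ tr tot.
have so : sorted prec labels by apply: sort_sorted.
have un : uniq labels by rewrite sort_uniq enum_uniq.
rewrite sorted_pairwise // in so; rewrite uniq_pairwise in un.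
elim: labels so un => //= l ls IH /andP[a1 p1] /andP[a2 p2].
rewrite IH // andbT; apply/allP => l' ll'.
by have /= H1 := allP a1 _ ll'; have /= H2 := allP a2 _ ll'; rewrite H1 H2.
Qed.

Lemma blocks_pairwise M :
  pairwise (step_lt prec is_inl) (flatten [seq block M l | l <- labels]).
Proof.
have refl l : prec l l by case: precT.
elim: labels labels_pairwise => //= l ls IH /andP[al pl].
rewrite pairwise_cat IH // andbT; apply/andP; split.
  apply/allrelP => _ u /mapP[c _ ->] /flatten_mapP[l' ll' /mapP[c' _ ->]].
  by have /andP[H1 H2] := allP al _ ll'; rewrite /step_lt /= H1 H2.
rewrite /block pairwise_map; case: l {al} => [a|b] /=.
  apply: (@sub_pairwise _ ltn) => [c c' cc'|]; first by rewrite /step_lt /= refl eqxx.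
  by rewrite -sorted_pairwise ?iota_ltn_sorted //; apply: ltn_trans.
apply: (@sub_pairwise _ [rel c c' | (c' < c)%N]) => [c c' cc'|].
  by rewrite /step_lt /= refl eqxx.
rewrite -sorted_pairwise; last by move=> c1 c2 c3 /= H1 H2; apply: ltn_trans H2 H1.
by rewrite rev_sorted iota_ltn_sorted.
Qed.

Lemma max_label (Q : pred L) l0 : Q l0 -> exists2 l, Q l & forall l', Q l' -> prec l' l.
Proof.
move=> Q0; case: (arg_maxnP (fun l => #|[set l' | prec l' l]|) Q0) => l Ql lmax.
exists l => // l' Ql'; case: precT => refl _ tr tot; case/orP: (tot l' l) => // ll'.
have sub : [set l' | prec l' l] \subset [set l'' | prec l'' l'].
  by apply/subsetP => k; rewrite !inE => /tr; apply.
have /eqP/setP/(_ l') : [set l' | prec l' l] == [set l'' | prec l'' l'].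
  by rewrite eqEcard sub; apply: lmax.
by rewrite !inE refl.
Qed.

(** Listed in the order [step_lt], the pairs form one block for each label, and the steps of a block
    make up the row operator of that label. The box is the bounding box of [la], while [h] and [M]
    may be larger, so that one window serves for many partitions. *)
Lemma super_LLT_steps h M (la mu : intpart) : fits h M la -> fits h M mu ->
  super_LLT n la mu prec q x y
  = foldr (rowop p q M) (delta R (bits h M la)) [seq row_param l | l <- labels] (bits h M mu).
Proof.
move=> fl fm; rewrite -stepseq_blocks.
(* If [mu] is not contained in [la] there is no tableau, and the matrix coefficient vanishes because
   steps only enlarge partitions. *)
case: (boolp.pselect (part_included mu la)) => [inc|ninc]; last first.
  rewrite /super_LLT big_pred0 => [|T]; last by apply/boolp.asboolP; case.
  apply/esym/eqP; apply: contra_notT ninc => /stepseq_delta_le le.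
  exact: cnt_sub fm fl le.
set h0 := size la; set w0 := nth 0%N la 0.
have hh : (h0 <= h)%N by case/andP: fl.
have hM : (h + w0 <= M)%N by case/andP: fl => _; rewrite addnC.
have ba : boxed h0 w0 la by rewrite /boxed !leqnn.
have bm : boxed h0 w0 mu.
  rewrite /boxed inc andbT leqNgt; apply/negP => lt.
  have m0 := part_gt0 mu h0; rewrite lt in m0.
  by have := leq_trans m0 (inc h0); rewrite part_gt0 ltnn.
rewrite -(tableau_sum p hh hM precT q step_weight (blocks_pairwise M) bm ba).
apply: eq_big => [T|T _].
  apply/boolp.asboolP/boolp.asboolP => [[_ part rib you hs vs]|[sub part rib mem you str]].
    split=> //.
    - by apply/subsetP => c; rewrite !inE => /leq_trans; apply.
    - move=> S l d f g _ rp; apply/flatten_mapP; exists l.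
        by rewrite mem_sort mem_enum.
      have dM : (d < M)%N.
        have [c [_ c1 c2]] := path_mem rp (ltn0Sn p).
        have := rp_content rp (ltn0Sn p); have := ltn_ord c.1; have := ltn_ord c.2.
        by rewrite c1 c2 -/h0 -/w0; lia.
      by apply/mapP; exists d => //; case: is_inl; rewrite ?mem_rev mem_iota.
    (* A nonempty down-set has a maximum, hence is one of the segments in [st_young]; the empty one
       leaves [mu] itself. *)
    - move=> Q Qd; case: (boolp.pselect (exists l, Q l)) => [[l0 Q0]|nQ].
        have [l Ql lmax] := max_label Q0.
        suff -> : tiles_in T Q = tiles_upto prec T l by apply: you.
        apply/setP => S; rewrite !inE; case: (T S) => // l'.
        by apply/idP/idP => [/lmax|/Qd]; [|apply].
      have -> : tiles_in T Q = set0.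
        by apply/setP => S; rewrite !inE; case: (T S) => // l; apply/negP => Ql; apply: nQ; exists l.
      rewrite /finset.cover big_set0 setU0; apply/is_youngE; by exists mu.
    - by case=> [a|b]; [apply: hs | apply: vs].
  split=> //.
  - move=> l; apply: you => l1 l2; case: precT => _ _ tr _; exact: tr.
  - by move=> a; apply: (str (inl a)).
  - by move=> b; apply: (str (inr b)).
rewrite /tableau_weight /tableau_spin.
transitivity ((\prod_(S in tiles T) q ^+ ribbon_spin S) *
   \prod_(l : L) \prod_(S | T S == Some l) step_weight l).
  rewrite -mulrA; congr (_ * _); first by rewrite -prodrXr.
  rewrite big_sumType /=; congr (_ * _); apply: eq_bigr => l _;
    by rewrite prodr_const; congr (_ ^+ _); apply: eq_card => S; rewrite inE.
rewrite (exchange_big_dep predT) //= [X in X * _]big_mkcond -big_split /=.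
apply: eq_bigr => S _; rewrite inE; case TS: (T S) => [l|] /=.
  by rewrite (big_pred1 l) // => l'; rewrite (inj_eq Some_inj) eq_sym.
by rewrite mul1r big_pred0.
Qed.

End SuperLLTSteps.

(** * Sums over states *)

Section LocalWeights.
Local Open Scope ring_scope.
Variables (p : nat) (R : comNzRingType) (q : R).
Notation n := p.+1.
Implicit Types (t b v G : seq bool).

(* Vertex weights in terms of the occupations [a], [c] of the column above and
   below the vertex, of the path indicators [g], [g'] on its left and right
   (first and last components), and of the number [s] of paths passing over. *)
Definition locH (x : R) (a g c g' : bool) (s : nat) : R :=
  if (a + g == c + g')%N then
    if a && g then 0 else if a || g then q ^+ s * x ^+ g' else 1
  else 0.

Definition locV (y : R) (a g c g' : bool) (s : nat) : R :=
  if (a + g == c + g')%N then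
    if a then if c && ~~ g then q ^+ s else - y else if g' then 0 else 1
  else 0.

Definition local_weight (l : R + R) :=
  match l with inl x => locH x | inr y => locV y end.

Lemma local_weight_conserv l (a g c g' : bool) s : (a + g != c + g')%N -> local_weight l a g c g' s = 0.
Proof. by case: l => z /= /negbTE; rewrite /locH /locV => ->. Qed.

Lemma local_weight_vac l s : local_weight l false false false false s = 1.
Proof. by case: l. Qed.

Lemma local_weight_full l : local_weight l true false true false 0 = 1.
Proof. by case: l => z //=; rewrite /locH /= mulr1. Qed.

Fixpoint row_sum l v t b : R :=
  match t, b with
  | a :: t', c :: b' =>
    \sum_(g' : bool) local_weight l a (head false v) c g' (count id (behead v))
      * row_sum l (rcons (behead v) g') t' b'
  | [::], [::] => (~~ has id v)%:R
  | _, _ => 0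
  end.

Lemma rowH_delta x v t c b c' :
  rowH q x v t (delta R (c :: b) \o cons c') = (~~ (c' (+) c))%:R * rowH q x v t (delta R b).
Proof.
rewrite -rowHZ; apply: rowH_eq => u _; rewrite /delta /= eqseq_cons.
by case: c c' => [] []; rewrite /= ?mul1r ?mul0r.
Qed.

Lemma rowVZ y v t k phi : rowV q y v t (fun b => k * phi b) = k * rowV q y v t phi.
Proof.
elim: t v phi => [|a t IH] v phi /=; first by case: has; rewrite ?mulr0.
have E c w : rowV q y w t ((fun b => k * phi b) \o cons c)
           = k * rowV q y w t (phi \o cons c) by rewrite -IH.
rewrite !E; case: a => //; case: ifP => _; ring.
Qed.

Lemma rowV_delta y v t c b c' :
  rowV q y v t (delta R (c :: b) \o cons c') = (~~ (c' (+) c))%:R * rowV q y v t (delta R b).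
Proof.
rewrite -rowVZ; apply: rowV_eq => u _; rewrite /delta /= eqseq_cons.
by case: c c' => [] []; rewrite /= ?mul1r ?mul0r.
Qed.

Lemma row_sumE l v t b : size t = size b ->
  row_sum l v t b = match l with
    | inl x => rowH q x v t (delta R b) | inr y => rowV q y v t (delta R b) end.
Proof.
elim: t v b => [|a t IH] v [|c b] //= => [_|[sb]].
  by case: l => z; rewrite /delta /=; case: has.
rewrite big_bool /= !IH //; case: l {IH} => z.
  rewrite !rowH_delta /local_weight /locH; case: a (head false v) c => [] [] [] /=;
    rewrite ?(mul0r, mul1r, mulr0, mulr1, add0r, addr0, expr0, expr1) //; ring.
rewrite !rowV_delta /local_weight /locV; case: a (head false v) c => [] [] [] /=;
  rewrite ?(mul0r, mul1r, mulr0, mulr1, add0r, addr0, expr0, expr1) //; ring.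
Qed.

Definition conserved t b G := forall e, (e < size t)%N ->
  (nth false t e + nth false G e = nth false b e + nth false G (e + n))%N.

(** Conservation at a vertex determines the outgoing path, so every other choice in [row_sum] has
    weight 0 and one product remains. *)
Lemma row_sum_prod l t b G : size t = size b -> size G = (size t + n)%N ->
  conserved t b G -> ~~ has id (drop (size t) G) ->
  row_sum l (take n G) t b =
  \prod_(e < size t) local_weight l (nth false t e) (nth false G e) (nth false b e)
     (nth false G (e + n)) (count id (take p (drop e.+1 G))).
Proof.
elim: t b G => [|a t IH] [|c b] //= [|g G] //.
  move=> _ sG _ H; rewrite big_ord0 take_oversize; last by lia.
  by rewrite H.
move=> [sb] [sG] cons tail; rewrite big_ord_recl /=.
have sG' : size G = (size t + n)%N by rewrite sG addnS.
have pG : (p < size G)%N by rewrite sG' addnS ltnS leq_addl.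
have cons' : conserved t b G by move=> e et; have := cons e.+1 et.
have c0 := cons 0%N isT; rewrite /= in c0.
rewrite drop0 -(IH b G sb sG' cons' tail).
rewrite (bigD1 (nth false G p)) //= -take_nth // big1 ?addr0 // => g' gg'.
rewrite local_weight_conserv ?mul0r //; apply: contra gg' => /eqP; rewrite c0.
by move=> /addnI; case: nth; case: g'.
Qed.

Lemma row_sum_run l v t b : size t = size b -> size v = n -> row_sum l v t b != 0 ->
  exists G, [/\ size G = (size t + n)%N, take n G = v, conserved t b G & ~~ has id (drop (size t) G)].
Proof.
elim: t v b => [|a t IH] v [|c b] //=.
  move=> _ sv; case hv: (has id v); first by rewrite mulr0n eqxx.
  by exists v; rewrite drop0 hv take_oversize ?sv.
move=> [sb] sv H.
have [g' /andP[H1 H2]] : exists g', (local_weight l a (head false v) c g' (count id (behead v)) != 0)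
    && (row_sum l (rcons (behead v) g') t b != 0).
  apply: boolp.contrapT => nH; case/eqP: H; apply: big1 => g' _.
  apply/eqP; apply: contraT => K; case: nH; exists g'.
  by rewrite -negb_or; apply: contra K => /orP[] /eqP ->; rewrite ?mul0r ?mulr0.
case: v sv {H} H1 H2 => //= g v [sv] H1 H2.
have [G [sG tG cG hG]] := IH (rcons v g') b sb ltac:(by rewrite size_rcons sv) H2.
have pG : (p < size G)%N by rewrite sG addnS ltnS leq_addl.
have [tv gE] : take p G = v /\ nth false G p = g'.
  by move: tG; rewrite (take_nth false) // => /rcons_inj[-> ->].
exists (g :: G); split=> //=; [by rewrite sG | by rewrite tv |].
case=> [|e] /= et; last exact: cG.
rewrite gE; apply/eqP; apply: contraNT H1 => /local_weight_conserv ->; exact: eqxx.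
Qed.

End LocalWeights.

Section VertexWeights.
Local Open Scope ring_scope.
Variables (p : nat) (A A' B B' : finType).
Notation n := p.+1.
Notation Lab := (rows A A' B B').
Variables (R : comNzRingType) (q : R).
Variables (x : A -> R) (y : A' -> R) (w : B -> R) (z : B' -> R).
Implicit Types (v : vertex n) (l : Lab).

Definition shifted v := forall k, (k < p)%N -> nth Lft (vE v) k = nth Lft (vW v) k.+1.

Definition is_path l (a : harrow) : bool := if l is inl _ then Defs.is_left a else is_right a.

Definition label_param l : R + R :=
  match l with
  | inl l' => row_param x y l'
  | inr l' => row_param w z l'
  end.

(* Rows of B and B' are read upside down. *)
Definition occ_in l (a c : varrow) : bool := if l is inl _ then is_up a else is_up c.
Definition occ_out l (a c : varrow) : bool := if l is inl _ then is_up c else is_up a.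

(** The components shared by the two tuples cancel in the count of arrows; only the first one on the
    left and the last one on the right matter. *)
Lemma admissible_conserv v : shifted v -> boolp.asbool (admissible v) =
  (is_up (vN v) + Defs.is_left (nth Lft (vW v) 0) == is_up (vS v) + Defs.is_left (nth Lft (vE v) p))%N.
Proof.
move=> sh; have E : behead (vW v) = take p (vE v) :> seq harrow.
  apply: (@eq_from_nth _ Lft); first by rewrite size_behead size_takel size_tuple.
  move=> k; rewrite size_behead size_tuple /= => kp; by rewrite nth_behead nth_take // sh.
have sizeW : (p < size (vE v))%N by rewrite size_tuple.
have W : vW v = nth Lft (vW v) 0 :: take p (vE v) :> seq harrow.
  by rewrite -E; case: (vW v) => [[|? ?]].
have V : vE v = rcons (take p (vE v)) (nth Lft (vE v) p) :> seq harrow.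
  by rewrite -take_nth // take_oversize // size_tuple.
have sz : size (take p (vE v)) = p by rewrite size_takel // size_tuple.
have C : (count Defs.is_left (take p (vE v)) + count is_right (take p (vE v)))%N = p.
  by rewrite -[RHS]sz -(count_predC Defs.is_left); congr addn; apply: eq_count.
have cW f : count f (vW v) = (f (nth Lft (vW v) 0) + count f (take p (vE v)))%N by rewrite {1}W.
have cE f : count f (vE v) = (count f (take p (vE v)) + f (nth Lft (vE v) p))%N.
  by rewrite {1}V -cats1 count_cat /= addn0.
apply/boolp.asboolP/eqP => [[+ _]|H].
  rewrite /arrows_in /arrows_out !cW !cE; move: C.
  by case: (vN v); case: (vS v); case: (nth Lft (vW v) 0); case: (nth Lft (vE v) p) => /=; lia.
split; last by move=> k; rewrite ltnS; apply: sh.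
rewrite /arrows_in /arrows_out !cW !cE; move: C H.
by case: (vN v); case: (vS v); case: (nth Lft (vW v) 0); case: (nth Lft (vE v) p) => /=; lia.
Qed.

(** Turning a row upside down exchanges the two vertical edges and the meaning of the horizontal
    arrows. That this carries [wt_Ht] to [wt_H] and [wt_Vt] to [wt_V] is checked on the sixteen
    configurations. *)
Lemma row_weightE l v : shifted v ->
  row_weight q x y w z l v =
  local_weight q (label_param l) (occ_in l (vN v) (vS v)) (is_path l (nth Lft (vW v) 0))
    (occ_out l (vN v) (vS v)) (is_path l (nth Lft (vE v) p)) (count (is_path l) (take p (vE v))).
Proof.
move=> sh; case: l => [[a|b]|[a|b]]; rewrite /= /wt_H /wt_V /wt_Ht /wt_Vt /kind_of admissible_conserv //=
  /locH /locV /num_left /num_right;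
  case: (vN v); case: (vS v); case: (nth Lft (vW v) 0); case: (nth Lft (vE v) p) => //=;
  by rewrite ?expr0 ?expr1 ?mulr1.
Qed.

Lemma row_weight_shifted l v : row_weight q x y w z l v != 0 -> shifted v.
Proof.
move=> H; suff : admissible v by case=> _ sh k kp; apply: sh.
apply: boolp.contrapT => nad; move: H; have E : kind_of v = None by rewrite /kind_of boolp.asboolF.
by case: l => [[a|b]|[a|b]]; rewrite /= /wt_H /wt_V /wt_Ht /wt_Vt E eqxx.
Qed.

End VertexWeights.

(** * Conservation of paths in infinite rows *)

Section InfiniteRows.
Local Open Scope ring_scope.
Variable p : nat.
Notation n := p.+1.
Implicit Types (o t b g : int -> bool) (c lo hi : int).

Definition windowed lo hi o :=
  (forall c, c < lo -> o c = true) /\ (forall c, hi <= c -> o c = false).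

Definition far_false g := exists K : nat, forall c, (K <= absz c)%N -> g c = false.

Definition row_conserved t b g :=
  forall c, (t c + g c = b c + g (c + n%:Z)%R)%N.

Lemma windowed_widen lo hi lo' hi' o : lo' <= lo -> hi <= hi' ->
  windowed lo hi o -> windowed lo' hi' o.
Proof.
move=> l h [ol oh]; split=> c H; [apply: ol | apply: oh]; lia.
Qed.

(* Along a progression of difference [n] where [t = b], the path indicator is constant. *)
Lemma conserved_vacL lo hi t b g : windowed lo hi t -> windowed lo hi b ->
  row_conserved t b g -> far_false g -> forall c, c < lo + n%:Z -> g c = false.
Proof.
move=> [tl _] [bl _] cons [K far] c clo.
have H k : g (c - (k * n)%:Z) = g c.
  elim: k => [|k <-]; first by rewrite mul0n subr0.
  have := cons (c - (k.+1 * n)%:Z); rewrite tl ?bl; try lia.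
  have -> : c - (k.+1 * n)%:Z + n%:Z = c - (k * n)%:Z by lia.
  by do 2 case: (g _).
by rewrite -(H (K + absz c)%N) far //; lia.
Qed.

Lemma conserved_vacR lo hi t b g : windowed lo hi t -> windowed lo hi b ->
  row_conserved t b g -> far_false g -> forall c, hi <= c -> g c = false.
Proof.
move=> [_ th] [_ bh] cons [K far] c chi.
have H k : g (c + (k * n)%:Z) = g c.
  elim: k => [|k <-]; first by rewrite mul0n addr0.
  have := cons (c + (k * n)%:Z); rewrite th ?bh; try lia.
  have -> : c + (k * n)%:Z + n%:Z = c + (k.+1 * n)%:Z by lia.
  by do 2 case: (g _).
by rewrite -(H (K + absz c)%N) far //; lia.
Qed.

Lemma conserved_some_window lo hi t b g : row_conserved t b g -> far_false g ->
  windowed lo hi t \/ windowed lo hi b ->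
  exists lo' hi', [/\ lo' <= lo, hi <= hi', windowed lo' hi' t & windowed lo' hi' b].
Proof.
move=> cons [K far] w.
pose lo' := Num.min lo (- (K + n)%:Z); pose hi' := Num.max hi (K + n)%:Z.
have l1 : lo' <= lo by rewrite /lo'; lia.
have h1 : hi <= hi' by rewrite /hi'; lia.
have eq c : c < lo' \/ hi' <= c -> t c = b c.
  rewrite /lo' /hi' => H; have := cons c.
  have -> : g c = false by apply: far; lia.
  have -> : g (c + n%:Z) = false by apply: far; lia.
  by case: (t c); case: (b c).
case: w => /(windowed_widen l1 h1) W; exists lo', hi'; split=> //; case: W => wl wh; split=> c H.
- by rewrite -eq ?wl //; left.
- by rewrite -eq ?wh //; right.
- by rewrite eq ?wl //; left.
- by rewrite eq ?wh //; right.
Qed.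

(** A path beyond the new right end must have come through [d.+1] columns without particles above,
    and one beyond the left end must go on through [d.+1] columns with particles above; either way
    it makes a run that the hypothesis forbids. *)
Lemma window_up d lo hi t b g : windowed lo hi t -> row_conserved t b g ->
  (forall c, exists2 i, (i <= d)%N & g (c + (i * n)%:Z + n%:Z) = false) ->
  windowed (lo - (d.+1 * n)%:Z) (hi + (d.+1 * n)%:Z) b.
Proof.
move=> [tl th] cons run.
have gR c : hi + (d.+1 * n)%:Z <= c -> g c = false.
  move=> H; case gc: (g c) => //.
  have G i : (i <= d.+1)%N -> g (c - (i * n)%:Z) = true.
    elim: i => [|i IH] le; first by rewrite mul0n subr0.
    have := cons (c - (i.+1 * n)%:Z).
    have -> : c - (i.+1 * n)%:Z + n%:Z = c - (i * n)%:Z by lia.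
    have : (i.+1 * n <= d.+1 * n)%N by rewrite leq_mul2r le orbT.
    by move=> le2; rewrite IH ?th; [case: (b _); case: (g _) | lia | lia].
  have [i le] := run (c - (d.+1 * n)%:Z).
  have -> : c - (d.+1 * n)%:Z + (i * n)%:Z + n%:Z = c - ((d - i) * n)%:Z.
    have : (i * n <= d * n)%N by rewrite leq_mul2r le orbT.
    rewrite mulnBl; lia.
  by rewrite G //; lia.
have gL c : c < lo - (d * n)%:Z -> g c = false.
  move=> H; case gc: (g c) => //.
  have G i : (i <= d.+1)%N -> g (c + (i * n)%:Z) = true.
    elim: i => [|i IH] le; first by rewrite mul0n addr0.
    have := cons (c + (i * n)%:Z).
    have -> : c + (i * n)%:Z + n%:Z = c + (i.+1 * n)%:Z by lia.
    have : (i * n <= d * n)%N by rewrite leq_mul2r orbC; lia.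
    by move=> le2; rewrite IH ?tl; [case: (b _); case: (g _) | lia | lia].
  have [i le] := run c.
  have -> : c + (i * n)%:Z + n%:Z = c + (i.+1 * n)%:Z by lia.
  by rewrite G.
split=> c H; have := cons c.
  by rewrite tl ?gL; [case: (b c) | lia | lia | lia].
by rewrite th ?gR; [case: (b c) | lia | lia | lia].
Qed.

(** A path to the right of the window of [b] could never end and one to the left could never have
    begun, so [far_false] excludes both and the window does not grow. *)
Lemma window_down lo hi t b g : windowed lo hi b -> row_conserved t b g ->
  far_false g -> windowed lo hi t.
Proof.
move=> [bl bh] cons [K far].
have gR c : hi <= c -> g c = false.
  move=> H; case gc: (g c) => //.
  have G i : g (c + (i * n)%:Z) = true.
    elim: i => [|i IH]; first by rewrite mul0n addr0.
    have := cons (c + (i * n)%:Z).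
    have -> : c + (i * n)%:Z + n%:Z = c + (i.+1 * n)%:Z by lia.
    by rewrite IH bh; [case: (t _); case: (g _) | lia].
  by have := G (K + absz c)%N; rewrite far //; lia.
have gL c : c < lo + n%:Z -> g c = false.
  move=> H; case gc: (g c) => //.
  have G i : g (c - (i * n)%:Z) = true.
    elim: i => [|i IH]; first by rewrite mul0n subr0.
    have := cons (c - (i.+1 * n)%:Z).
    have -> : c - (i.+1 * n)%:Z + n%:Z = c - (i * n)%:Z by lia.
    by rewrite IH bl; [case: (t _); case: (g _) | lia].
  by have := G (K + absz c)%N; rewrite far //; lia.
split=> c H; have := cons c.
  by rewrite bl ?gL; [case: (t c) | lia | lia | lia].
by rewrite bh ?gR; [case: (t c) | lia | lia | lia].
Qed.

End InfiniteRows.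

From mathcomp Require Import boolp classical_sets cardinality fsbigop.
From mathcomp Require Import mpoly.

(** * States inside a finite window *)

Section States.
Local Open Scope ring_scope.
Variables (p : nat) (A A' B B' : finType).
Notation n := p.+1.
Notation Lab := (rows A A' B B').
Notation N := #|{: Lab}|.
Variable I : rel Lab.
Notation poly := {mpoly {poly int}[N]}.
Notation q := (var_q A A' B B').
Notation st := (state n A A' B B').
Implicit Types (s : st) (k : 'I_N) (c lo : int).

Definition row_var (l : Lab) : poly + poly :=
  label_param (@var_x A A' B B') (@var_y A A' B B') (@var_w A A' B B') (@var_z A A' B B') l.

Definition vw s k c : poly :=
  vertex_weight I q (@var_x A A' B B') (@var_y A A' B B') (@var_w A A' B B')
    (@var_z A A' B B') s (k, c).

Notation lab := (row_label I).

Definition level s (j : 'I_N.+1) c : bool := is_up (vedge s j c).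
Definition row_in s k c : bool :=
  if lab k is inl _ then level s (widen_ord (leqnSn N) k) c else level s (lift ord0 k) c.
Definition row_out s k c : bool :=
  if lab k is inl _ then level s (lift ord0 k) c else level s (widen_ord (leqnSn N) k) c.
Definition path_at s k c : bool := is_path (lab k) (nth Lft (hedge s k c) 0).
Definition passing s k c := count id [seq path_at s k (c + 1 + j%:Z) | j <- iota 0 p].

(** Admissibility shifts the components of the tuples from edge to edge, so in a row without weight
    0 the first components carry all the information. *)
Definition slid s k := forall c j, (j < n)%N ->
  nth Lft (hedge s k c) j = nth Lft (hedge s k (c + j%:Z)) 0.

Lemma vwE s k c : slid s k ->
  vw s k c = local_weight q (row_var (lab k)) (row_in s k c) (path_at s k c)
    (row_out s k c) (path_at s k (c + n%:Z)) (passing s k c).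
Proof.
move=> sl; rewrite /vw /vertex_weight row_weightE /=; last first.
  move=> j jp; rewrite /= sl 1?ltnW // [RHS]sl //; congr (nth _ (hedge _ _ _) _); lia.
rewrite /row_in /row_out /occ_in /occ_out /level /path_at; congr local_weight.
- by rewrite sl //; congr (is_path _ (nth _ (hedge _ _ _) _)); lia.
- have sz : size (hedge s k (c + 1)) = n by rewrite size_tuple.
  rewrite /passing count_map -[X in count _ X](@mkseq_nth _ Lft) count_map size_takel ?sz //.
  apply: eq_in_count => j; rewrite mem_iota add0n => jp; rewrite /= nth_take // sl 1?ltnW //.
Qed.

Lemma nonzero_slid s k : (forall c, vw s k c != 0) -> slid s k.
Proof.
move=> nz c j; elim: j c => [|j IH] c jn; first by rewrite addr0.
have := row_weight_shifted (nz c); move=> /(_ j jn) /= <-.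
by rewrite IH 1?ltnW //; congr (nth _ (hedge _ _ _) _); lia.
Qed.

Lemma nonzero_conserved s k : (forall c, vw s k c != 0) ->
  row_conserved p (row_in s k) (row_out s k) (path_at s k).
Proof.
move=> nz c; apply/eqP; apply: contraNT (nz c) => H.
by rewrite vwE ?local_weight_conserv //; apply: nonzero_slid.
Qed.

Lemma compatible_far mu nu r s k : compatible mu nu I r s -> far_false (path_at s k).
Proof.
case=> _ _ /(_ k)[K H]; exists K => c Kc.
by rewrite /path_at -(tnth_nth Lft _ ord0) H //; case: (lab k).
Qed.

Section Window.
Variables (lo : int) (M : nat).

Definition frame (o : int -> bool) : seq bool := mkseq (fun e => o (lo + e%:Z)) M.

Lemma nth_frame o e : (e < M)%N -> nth false (frame o) e = o (lo + e%:Z).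
Proof. by move=> eM; rewrite nth_mkseq. Qed.

Definition in_window s := forall j, windowed lo (lo + M%:Z) (level s j).

Lemma in_window_row s k : in_window s ->
  windowed lo (lo + M%:Z) (row_in s k) /\ windowed lo (lo + M%:Z) (row_out s k).
Proof. by move=> w; rewrite /row_in /row_out; case: (lab k) => l; split; apply: w. Qed.

Lemma vw_outside s k c : in_window s -> slid s k ->
  row_conserved p (row_in s k) (row_out s k) (path_at s k) -> far_false (path_at s k) ->
  c < lo \/ lo + M%:Z <= c -> vw s k c = 1.
Proof.
move=> w sl cons far out; have [wi wo] := in_window_row k w.
have L := conserved_vacL wi wo cons far; have H := conserved_vacR wi wo cons far.
rewrite vwE //; case: out => out; last first.
  rewrite wi.2 ?wo.2 // !H ?local_weight_vac //; lia.
rewrite wi.1 ?wo.1 // !L; try lia.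
(* [conserved_vacL] reaches [n] columns into the window, which is enough for all paths passing over
   a column to its left. *)
have -> : passing s k c = 0%N; last exact: local_weight_full.
apply/eqP; rewrite -leqn0 leqNgt -has_count has_map; apply/hasPn => j.
by rewrite mem_iota => jp /=; rewrite L //; lia.
Qed.

Lemma row_sum_vw s k : in_window s -> slid s k ->
  row_conserved p (row_in s k) (row_out s k) (path_at s k) -> far_false (path_at s k) ->
  row_sum q (row_var (lab k)) (nseq n false) (frame (row_in s k)) (frame (row_out s k))
  = \prod_(e < M) vw s k (lo + (e : nat)%:Z).
Proof.
move=> w sl cons far; have [wi wo] := in_window_row k w.
have L := conserved_vacL wi wo cons far; have H := conserved_vacR wi wo cons far.
pose G := mkseq (fun e => path_at s k (lo + e%:Z)) (M + n).
have nG e : (e < M + n)%N -> nth false G e = path_at s k (lo + e%:Z).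
  by move=> eM; rewrite nth_mkseq.
have -> : nseq n false = take n G.
  apply: (@eq_from_nth _ false); first by rewrite size_nseq size_takel // size_mkseq leq_addl.
  rewrite size_nseq => e en; rewrite nth_nseq en nth_take // nG ?L //; lia.
rewrite row_sum_prod ?size_mkseq //.
- apply: eq_bigr => e _; have eM := ltn_ord e.
  rewrite !nth_frame // !nG ?vwE //; try lia.
  have -> : lo + (e + n)%:Z = lo + (e : nat)%:Z + n%:Z by lia.
  congr local_weight; rewrite /passing /G /mkseq -map_drop -map_take drop_iota take_iota !count_map.
  have -> : minn p (M + n - e.+1) = p by lia.
  rewrite -[X in iota X p](addn0 (0 + e.+1)) iotaDl count_map; apply: eq_count => j /=.
  congr (path_at _ _ _); lia.
- by move=> e eM; rewrite size_mkseq in eM; rewrite !nth_frame // !nG; [have := cons (lo + e%:Z); rewrite -addrA -PoszD | lia | lia].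
- apply/hasPn => b; rewrite /G /mkseq -map_drop drop_iota => /mapP[e]; rewrite mem_iota => eM ->.
  by rewrite H //; lia.
Qed.

Lemma cauchy_weight_prod s : in_window s ->
  (forall k, slid s k) ->
  (forall k, row_conserved p (row_in s k) (row_out s k) (path_at s k)) ->
  (forall k, far_false (path_at s k)) -> (forall k c, vw s k c != 0) ->
  cauchy_weight I s = \prod_k \prod_(e < M) vw s k (lo + (e : nat)%:Z).
Proof.
move=> w sl cons far nz; rewrite /cauchy_weight /state_weight asboolT; last by case=> k c; apply: nz.
pose rr := [seq (k, lo + e%:Z) | k <- enum 'I_N, e <- iota 0 M].
rewrite (@fsbigE _ _ _ _ _ rr).
- rewrite (eq_bigl predT) => [|i]; last by rewrite in_setT.
  rewrite /rr big_allpairs_dep big_enum /=; apply: eq_bigr => k _.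
  by rewrite -{1}(subn0 M) -/(index_iota 0 M) big_mkord.
- apply: allpairs_uniq; rewrite ?enum_uniq ?iota_uniq // => -[k e] [k' e'] _ _ /= [-> E].
  by congr (_, _); lia.
- by [].
- case=> k c _ H; apply: vw_outside => //.
  case: (ltP c lo) => [|c1]; first by left.
  case: (leP (lo + M%:Z) c) => [|c2]; first by right.
  case/negP: H; apply/allpairsP; exists (k, absz (c - lo)); split=> /=; rewrite ?mem_enum ?mem_iota //.
    lia.
  by congr (_, _); lia.
Qed.

End Window.
End States.

(** * Polynomials without terms of low degree *)

Section LowDegree.
Local Open Scope ring_scope.
Variables (k : nat) (R : comNzRingType).
Implicit Types (P Q : {mpoly R[k]}).

Definition order_ge (e : nat) P := forall m : 'X_{1..k}, (mdeg m < e)%N -> P@_m = 0.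

Lemma order_ge0 P : order_ge 0 P. Proof. by []. Qed.

Lemma order_geM e e' P Q : order_ge e P -> order_ge e' Q -> order_ge (e + e') (P * Q).
Proof.
move=> oP oQ m lt; rewrite mcoeffM big1 // => ij /eqP mE; rewrite mE mdegD in lt.
case: (ltnP (mdeg ij.1) e) => le; first by rewrite oP ?mul0r.
have lt2 : (mdeg ij.2 < e')%N by rewrite -(ltn_add2l e); apply: leq_ltn_trans lt; rewrite leq_add2r.
by rewrite (oQ _ lt2) mulr0.
Qed.

Lemma order_ge_prod (T : finType) (e : T -> nat) (F : T -> {mpoly R[k]}) :
  (forall i, order_ge (e i) (F i)) -> order_ge (\sum_i e i) (\prod_i F i).
Proof.
move=> H; apply: (big_ind2 (fun e P => order_ge e P)) => // e1 P e2 Q.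
exact: order_geM.
Qed.

Lemma order_geX i : order_ge 1 ('X_i : {mpoly R[k]}).
Proof.
move=> m; rewrite ltnS leqn0 mdeg_eq0 => /eqP ->.
by rewrite mcoeffX mnm1_eq0.
Qed.

Lemma order_geN e P : order_ge e P -> order_ge e (- P).
Proof. by move=> oP m /oP; rewrite mcoeffN => ->; rewrite oppr0. Qed.

Lemma order_ge_zero e : order_ge e 0.
Proof. by move=> m _; rewrite mcoeff0. Qed.

End LowDegree.

(** * A common window for the states that contribute to a monomial *)

Section StateBounds.
Local Open Scope ring_scope.
Variables (p : nat) (A A' B B' : finType).
Notation n := p.+1.
Notation Lab := (rows A A' B B').
Notation N := #|{: Lab}|.
Variable I : rel Lab.
Notation st := (state n A A' B B').
Notation lab := (row_label I).
Notation path_at := (path_at I).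
Implicit Types (s : st) (k : 'I_N) (c lo : int) (m : 'X_{1..N}).

Lemma launch_order l (a g c : bool) j :
  order_ge 1 (local_weight (var_q A A' B B') (@row_var A A' B B' (inl l)) a g c true j).
Proof.
have E P Q : order_ge 1 Q -> order_ge 1 (P * Q) by apply: (@order_geM _ _ 0 1).
case: l => [x|y]; rewrite /= /locH /locV.
  case: a g c => [] [] [] /=; rewrite ?expr1; try exact: order_ge_zero;
    by apply: E; apply: order_geX.
case: a g c => [] [] [] /=; try exact: order_ge_zero; by apply/order_geN/order_geX.
Qed.

Definition launches s k c : bool := (if lab k is inl _ then true else false) && path_at s k (c + n%:Z).

Lemma vw_order s k c : slid s k -> order_ge (launches s k c) (vw I s k c).
Proof.
move=> sl; rewrite vwE // /launches; case E: (lab k) => [l|//] /=.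
case: (path_at _ _ _); last exact: order_ge0.
exact: launch_order.
Qed.

Section Nonzero.
Variables (mu nu : intpart) (r : nat) (s : st).
Hypothesis comp : compatible mu nu I r s.
Hypothesis nz : forall k c, vw I s k c != 0.

Let sl k : slid s k. Proof. exact: nonzero_slid. Qed.
Let cons k : row_conserved p (row_in I s k) (row_out I s k) (path_at s k).
Proof. exact: nonzero_conserved. Qed.
Let far k : far_false (path_at s k). Proof. exact: compatible_far comp. Qed.

Lemma boundary_windowed (ka : intpart) : (size ka <= r)%N ->
  windowed 1 ((nth 0%N ka 0 + r).+1)%:Z (fun c => is_up (boundary r ka c)).
Proof.
move=> sr; split=> c H; rewrite /boundary; first by have -> : (c <= 0) = true by lia.
have -> : (c <= 0) = false by lia.
have -> // : [exists i : 'I_r, c == (nth 0%N ka i + (r - i))%N%:Z] = false.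
apply: negbTE; apply/existsP => -[i /eqP cE]; have := part_anti ka (leq0n i); have := ltn_ord i; lia.
Qed.

Lemma level_rows k lo hi : windowed lo hi (level s (widen_ord (leqnSn N) k)) ->
  windowed lo hi (row_in I s k) \/ windowed lo hi (row_out I s k).
Proof. by rewrite /row_in /row_out; case: (lab k); [left | right]. Qed.

(** This window depends on the state; it serves to write the weight as a finite product before a
    uniform window is known. *)
Lemma some_window : (size mu <= r)%N -> exists lo M, in_window lo M s.
Proof.
move=> sr; suff H (j : nat) : (j <= N)%N -> exists lo hi, forall i : 'I_N.+1, (i <= j)%N ->
    windowed lo hi (level s i).
  have [lo [hi W]] := H N (leqnn N); exists lo, (absz (hi - lo)%R) => i.
  have iN : (i <= N)%N by rewrite -ltnS; exact: ltn_ord.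
  by move: (W i iN); apply: windowed_widen => //; clear; lia.
elim: j => [|j IH] jN.
  exists 1, ((nth 0%N mu 0 + r).+1)%:Z => i; rewrite leqn0 => /eqP i0.
  have -> : i = ord0 by apply: val_inj.
  have [ct _ _] := comp; have := boundary_windowed sr.
  by congr windowed; apply: funext => c; rewrite /level ct.
have [lo [hi W]] := IH (ltnW jN); pose k := Ordinal jN.
have [lo' [hi' [l h wi wo]]] : exists lo' hi', [/\ lo' <= lo, hi <= hi',
    windowed lo' hi' (row_in I s k) & windowed lo' hi' (row_out I s k)].
  apply: conserved_some_window (cons k) (far k) _; apply: level_rows; exact: W.
exists lo', hi' => i; rewrite leq_eqVlt => /orP[/eqP iE|ij]; last first.
  by apply: windowed_widen l h (W i _); rewrite -ltnS.
have iE' : i = lift ord0 k by apply: val_inj; rewrite /= iE.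
by move: wi wo; rewrite /row_in /row_out iE'; case: (lab k).
Qed.

(** A run of [(mdeg m).+1] paths in a row of [A] or [A'] would give as many vertex weights without
    constant term, and the product would have no term of degree [mdeg m]. *)
Lemma launch_run m k : (size mu <= r)%N -> (cauchy_weight I s)@_m != 0 ->
  (if lab k is inl _ then true else false) ->
  forall c, exists2 i, (i <= mdeg m)%N & path_at s k (c + (i * n)%:Z + n%:Z) = false.
Proof.
move=> sr wm up c; apply: contrapT => run; case/eqP: wm.
have {}run i : (i <= mdeg m)%N -> path_at s k (c + (i * n)%:Z + n%:Z).
  by move=> im; apply/negPn/negP => /negbTE H; apply: run; exists i.
have [lo [M w]] := some_window sr; have [wi wo] := in_window_row I k w.
have L := conserved_vacL wi wo (cons k) (far k); have H := conserved_vacR wi wo (cons k) (far k).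
have bd i : (i <= mdeg m)%N -> lo <= c + (i * n)%:Z /\ c + (i * n)%:Z + n%:Z < lo + M%:Z.
  move=> /run; case: (ltP (c + (i * n)%:Z) lo) => [lt|ge]; first by rewrite L //; lia.
  by case: (leP (lo + M%:Z) (c + (i * n)%:Z + n%:Z)) => [le|//]; rewrite H.
rewrite (cauchy_weight_prod w sl cons far nz).
pose e k := (\sum_(e < M) launches s k (lo + (e : nat)%:Z))%N.
have oe : order_ge (\sum_k e k)%N (\prod_k \prod_(e < M) vw I s k (lo + (e : nat)%:Z)).
  by apply: order_ge_prod => k'; apply: order_ge_prod => i; apply: vw_order.
apply: oe; rewrite (bigD1 k) //=; apply: (@leq_trans (e k)); last exact: leq_addr.
have /boolp.choice[f fE] : forall i : 'I_(mdeg m).+1, exists j : 'I_M, lo + (j : nat)%:Z = c + (i * n)%:Z.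
  move=> i; have [b1 b2] := bd i ltac:(rewrite -ltnS; exact: ltn_ord).
  have jM : (absz (c + (i * n)%:Z - lo)%R < M)%N by lia.
  exists (Ordinal jM); have -> : (Ordinal jM : nat) = absz (c + (i * n)%:Z - lo)%R by [].
  by clear -b1; lia.
have -> : e k = #|[set j : 'I_M | launches s k (lo + (j : nat)%:Z)]|.
  by rewrite /e -sum1_card [RHS]big_mkcond; apply: eq_bigr => j _; rewrite inE; case: launches.
have finj : injective f.
  move=> i i' E; apply: val_inj; have := fE i; rewrite E fE => /addrI[] /eqP.
  by rewrite eqn_mul2r => /eqP.
have fC : #|[set f i | i : 'I_(mdeg m).+1]| = (mdeg m).+1 by rewrite card_imset ?card_ord.
rewrite -[X in (X <= _)%N]fC; apply: subset_leq_card; apply/fintype.subsetP => _ /imsetP[i _ ->].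
by rewrite inE /launches up fE; apply: run; rewrite -ltnS.
Qed.

(** By [launch_run], a row of [A] or [A'] enlarges the window by at most [(mdeg m).+1 * n] columns
    on each side; a row of [B] or [B'] does not enlarge it. *)
Lemma state_window m : (size mu <= r)%N -> (cauchy_weight I s)@_m != 0 ->
  forall j : 'I_N.+1, windowed (1 - (j * ((mdeg m).+1 * n))%:Z)
    ((nth 0%N mu 0 + r).+1%:Z + (j * ((mdeg m).+1 * n))%:Z) (level s j).
Proof.
move=> sr wm [j jN] /=; elim: j jN => [|j IH] jN.
  have -> : Ordinal jN = ord0 by apply: val_inj.
  rewrite mul0n subr0 addr0; have [ct _ _] := comp; have := boundary_windowed sr.
  by congr windowed; apply: funext => c; rewrite /level ct.
pose k : 'I_N := Ordinal (jN : (j < N)%N).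
have := IH (ltnW jN); have -> : Ordinal (ltnW jN) = widen_ord (leqnSn N) k by apply: val_inj.
have -> : Ordinal jN = lift ord0 k by apply: val_inj.
set d := ((mdeg m).+1 * n)%N.
have := cons k; have := @launch_run m k sr wm; have := far k.
rewrite /row_in /row_out; case E: (lab k) => [l|l] fk run ck w.
  have := window_up w ck (run isT); apply: windowed_widen; rewrite mulSn -/d; lia.
by have := window_down w ck fk; apply: windowed_widen; rewrite mulSn; lia.
Qed.

End Nonzero.

End StateBounds.

Section FiniteSum.
Local Open Scope ring_scope.
Local Open Scope classical_set_scope.
Variables (k : nat) (T : Type) (D : set {classic T}) (F : {classic T} -> {mpoly {poly int}[k]}).

Lemma fps_sum_finite (K : finType) (m : 'X_{1..k}) (P : pred K) (g : K -> T) (V : K -> {poly int}) :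
  (forall i, P i -> D (g i) /\ (F (g i))@_m = V i) ->
  {in P &, injective g} ->
  (forall t, D t -> (F t)@_m != 0 -> exists2 i, P i & t = g i) ->
  finite_set [set t | D t /\ (F t)@_m != 0] /\ fps_sum D F m = \sum_(i | P i) V i.
Proof.
move=> gD inj sur; pose r : seq {classic T} := [seq g i | i <- enum P].
have sub : [set t | D t /\ (F t)@_m != 0] `<=` [set` r].
  move=> t [Dt /(sur t Dt)[i Pi ->]] /=; apply/mapP; exists i => //.
  by rewrite mem_enum.
split; first exact: sub_finite_set sub (finite_seq r).
rewrite /fps_sum (@fsbigE _ _ _ _ _ r).
- rewrite big_map big_enum_cond; apply: eq_big => [i|i /andP[Pi _]]; last by have [] := gD i Pi.
  apply/andP/idP => [[]//|Pi]; split=> //; apply/asboolP; by have [] := gD i Pi.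
- by rewrite map_inj_in_uniq ?enum_uniq // => i j; rewrite !mem_enum; apply: inj.
- by move=> t /= /mapP[i]; rewrite mem_enum => Pi ->; have [] := gD i Pi.
- by move=> t Dt tr; apply/eqP; apply: contraNT tr => nz; apply: sub.
Qed.

End FiniteSum.

(** * States as chains of configurations *)

Section Chains.
Local Open Scope ring_scope.
Variables (p : nat) (A A' B B' : finType).
Notation n := p.+1.
Notation Lab := (rows A A' B B').
Notation N := #|{: Lab}|.
Variable I : rel Lab.
Notation q := (var_q A A' B B').
Notation st := (state n A A' B B').
Notation lab := (row_label I).
Variables (mu nu : intpart) (r h M : nat).
Hypotheses (smu : (size mu <= r)%N) (snu : (size nu <= r)%N) (rh : (r <= h)%N).
Hypotheses (fmu : fits h M mu) (fnu : fits h M nu).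
Implicit Types (s : st) (k : 'I_N) (c : int) (m : 'X_{1..N}).

(** The column of the first bit. The boundary has [r] shifted parts, whereas [bits] has [h]
    particles, so the window begins with [h - r] of the filled columns [c <= 0]. *)
Definition origin : int := 1 - (h - r)%:Z.
Notation lo := origin.
Notation chain := (N.-tuple (M.-tuple bool)).
Implicit Types (sg : chain).

Lemma frame_boundary (ka : intpart) : (size ka <= r)%N ->
  frame lo M (fun c => is_up (boundary r ka c)) = bits h M ka.
Proof.
move=> sr; apply: (@eq_from_nth _ false); rewrite !size_mkseq // => e eM.
rewrite !nth_mkseq // /boundary.
have upE (b : bool) : is_up (if b then Up else Down) = b by case: b.
rewrite upE; apply/orP/mapP => [[c0|/existsP[i /eqP cE]]|[i]].
- exists (h.-1 - e)%N; first by rewrite mem_iota; rewrite /origin in c0; lia.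
  rewrite /pos nth_default; rewrite /origin in c0; lia.
- have ir := ltn_ord i; exists (i : nat); first by rewrite mem_iota; lia.
  by rewrite /pos; rewrite /origin in cE; lia.
rewrite mem_iota add0n => /= ih eE; case: (ltnP i r) => ir.
  right; apply/existsP; exists (Ordinal ir); apply/eqP => /=; rewrite eE /pos /origin; lia.
left; rewrite eE /pos nth_default ?(leq_trans sr) // /origin; lia.
Qed.

Lemma boundary_in_window (ka : intpart) : (size ka <= r)%N -> fits h M ka ->
  windowed lo (lo + M%:Z) (fun c => is_up (boundary r ka c)).
Proof.
move=> sr /andP[_ f]; apply: windowed_widen (boundary_windowed sr); rewrite /origin; lia.
Qed.

Definition chain_level sg (j : nat) : seq bool :=
  nth [::] (bits h M mu :: map val sg) j.

Lemma size_chain_level sg j : (j <= N)%N -> size (chain_level sg j) = M.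
Proof.
case: j => [|j] jN; rewrite /chain_level /=; first exact: size_bits.
by rewrite (nth_map [tuple of nseq M false]) ?size_tuple.
Qed.

Definition row_kernel (l : Lab) (t b : seq bool) : {mpoly {poly int}[N]} :=
  if l is inl _ then row_sum q (row_var l) (nseq n false) t b
  else row_sum q (row_var l) (nseq n false) b t.

Definition chain_weight sg := \prod_(k < N) row_kernel (lab k) (chain_level sg k) (chain_level sg k.+1).

Definition chain_of s : chain :=
  [tuple [tuple level s (lift ord0 k) (lo + (e : nat)%:Z) | e < M] | k < N].

Lemma chain_levelE s : compatible mu nu I r s -> forall j : 'I_N.+1,
  chain_level (chain_of s) j = frame lo M (level s j).
Proof.
move=> [ct _ _] [[|j] jN].
  rewrite -[LHS]/(bits h M mu) -(frame_boundary smu); congr frame; apply: funext => c.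
  by rewrite /level -ct; congr (is_up (vedge s _ c)); apply: val_inj.
have jN' : (j < N)%N by [].
rewrite -[LHS]/(nth [::] (map val (chain_of s)) j) (nth_map [tuple of nseq M false]); last by rewrite size_tuple.
have -> : nth [tuple of nseq M false] (chain_of s) j = tnth (chain_of s) (Ordinal jN') by rewrite (tnth_nth [tuple of nseq M false]).
rewrite tnth_mktuple /= /frame /mkseq -val_enum_ord -map_comp.
have -> : lift ord0 (Ordinal jN') = Ordinal jN by apply: val_inj.
exact: eq_map.
Qed.

Lemma chain_weightE s : compatible mu nu I r s -> in_window lo M s ->
  (forall k, slid s k) ->
  (forall k, row_conserved p (row_in I s k) (row_out I s k) (path_at I s k)) ->
  (forall k, far_false (path_at I s k)) ->
  chain_weight (chain_of s) = \prod_k \prod_(e < M) vw I s k (lo + (e : nat)%:Z).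
Proof.
move=> comp w sl cons far; apply: eq_bigr => k _.
rewrite -row_sum_vw // /row_kernel.
have := chain_levelE comp (widen_ord (leqnSn N) k) => /= ->.
have := chain_levelE comp (lift ord0 k) => /= ->.
by rewrite /row_in /row_out; case: (lab k).
Qed.

(** The vertical edges agree inside the window by assumption and outside it by [in_window]. Given
    these, conservation determines the paths of a row from left to right, starting where there are
    none. *)
Lemma state_ext s s' : in_window lo M s -> in_window lo M s' ->
  (forall k, slid s k) -> (forall k, slid s' k) ->
  (forall k, row_conserved p (row_in I s k) (row_out I s k) (path_at I s k)) ->
  (forall k, row_conserved p (row_in I s' k) (row_out I s' k) (path_at I s' k)) ->
  (forall k, far_false (path_at I s k)) -> (forall k, far_false (path_at I s' k)) ->
  (forall j, frame lo M (level s j) = frame lo M (level s' j)) -> s = s'.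
Proof.
move=> w w' sl sl' cons cons' far far' E.
have lE j : level s j = level s' j.
  apply: funext => c; have [wl wh] := w j; have [wl' wh'] := w' j.
  case: (ltP c lo) => c1; first by rewrite wl ?wl'.
  case: (leP (lo + M%:Z) c) => c2; first by rewrite wh ?wh'.
  have := congr1 (fun t => nth false t (absz (c - lo)%R)) (E j).
  by rewrite !nth_frame; try lia; have -> : lo + (absz (c - lo)%R)%:Z = c by lia.
have iE k : row_in I s k = row_in I s' k by rewrite /row_in !lE.
have oE k : row_out I s k = row_out I s' k by rewrite /row_out !lE.
have pE k c : path_at I s k c = path_at I s' k c.
  have [wi wo] := in_window_row I k w; have [wi' wo'] := in_window_row I k w'.
  have L := conserved_vacL wi wo (cons k) (far k).
  have L' := conserved_vacL wi' wo' (cons' k) (far' k).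
  case: (ltP c lo) => c1; first by rewrite L ?L'; try lia.
  have -> : c = lo + (absz (c - lo)%R)%:Z by lia.
  elim/ltn_ind: (absz _) => e IH; case: (ltnP e n) => en; first by rewrite L ?L'; try lia.
  have eE : lo + e%:Z = lo + (e - n)%:Z + n%:Z by lia.
  have := cons k (lo + (e - n)%:Z); have := cons' k (lo + (e - n)%:Z).
  rewrite iE oE IH; last by lia.
  by rewrite -eE => H1; rewrite H1 => /addnI; do 2 case: (path_at _ _ _ _).
have vE : vedge s = vedge s'.
  apply: funext => j; apply: funext => c; have := congr1 (fun f => f c) (lE j).
  by rewrite /level; case: (vedge s j c); case: (vedge s' j c).
have hE : hedge s = hedge s'.
  apply: funext => k; apply: funext => c; apply: val_inj; apply: (@eq_from_nth _ Lft).
    by rewrite !size_tuple.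
  rewrite size_tuple => j jn; rewrite sl // sl' //.
  have := pE k (c + j%:Z); rewrite /path_at /is_path.
  by case: (lab k) => l; do 2 case: (nth _ _ _).
by move: vE hE; case: s {w sl cons far E lE iE oE pE} => v1 h1; case: s' {w' sl' cons' far'} => v2 h2 /= -> ->.
Qed.

Section Build.
Variable sg : chain.
Hypothesis last_level : chain_level sg N = bits h M nu.
Hypothesis nz : chain_weight sg != 0.

Definition side_arrow (l : Lab) (g : bool) : harrow :=
  match l with inl _ => if g then Lft else Rgt | inr _ => if g then Rgt else Lft end.

(** To the right of the window the default value of [nth] makes the columns empty. *)
Definition extend (t : seq bool) c : varrow :=
  if (c < lo) || nth false t (absz (c - lo)%R) then Up else Down.

Definition edge_paths k (G : seq bool) : Prop :=
  let t := chain_level sg k in let b := chain_level sg k.+1 in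
  [/\ size G = (M + n)%N, take n G = nseq n false,
      (forall e, (e < M)%N ->
       ((if lab k is inl _ then nth false t e else nth false b e) + nth false G e
        = (if lab k is inl _ then nth false b e else nth false t e) + nth false G (e + n))%N)
    & forall e, (M <= e)%N -> nth false G e = false].

Lemma chain_paths : exists G, forall k, edge_paths k (G k).
Proof.
suff H k : exists G, edge_paths k G by have [G GP] := boolp.choice H; exists G.
rewrite /edge_paths; set t := chain_level sg k; set b := chain_level sg k.+1.
have st : size t = M by apply/size_chain_level/ltnW.
have sb : size b = M by apply: size_chain_level.
have : row_kernel (lab k) t b != 0.
  by apply: contraNneq nz => H; rewrite /chain_weight (bigD1 k) //= -/t -/b H mul0r.
have tailE (G : seq bool) e : ~~ has id (drop M G) -> (M <= e)%N -> nth false G e = false.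
  move=> /hasPn H Me; case: (ltnP e (size G)) => eG; last by rewrite nth_default.
  have : nth false (drop M G) (e - M) \in drop M G.
    by rewrite mem_nth // size_drop ltn_sub2r // (leq_ltn_trans Me).
  by rewrite nth_drop subnKC // => /H/negbTE.
have sv : size (nseq n false) = n by rewrite size_nseq.
rewrite /row_kernel; case: (lab k) => l rs.
  have [G [sG tG cG hG]] := row_sum_run (etrans st (esym sb)) sv rs.
  rewrite /conserved st in sG cG hG; exists G; split=> // e; exact: tailE.
have [G [sG tG cG hG]] := row_sum_run (etrans sb (esym st)) sv rs.
rewrite /conserved sb in sG cG hG; exists G; split=> // e; exact: tailE.
Qed.

(** A nonzero chain weight has nonzero row sums, and each of these admits a conserved choice of
    paths. Extended by no paths outside the window, these are the horizontal edges. *)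
Lemma build_state : exists s, [/\ compatible mu nu I r s, in_window lo M s,
  (forall k, slid s k),
  (forall k, row_conserved p (row_in I s k) (row_out I s k) (path_at I s k)) &
  chain_of s = sg].
Proof.
have [G GP] := chain_paths.
pose gm k c := if c < lo then false else nth false (G k) (absz (c - lo)%R).
pose s : st := State (fun j c => extend (chain_level sg j) c)
  (fun k c => [tuple side_arrow (lab k) (gm k (c + (j : nat)%:Z)) | j < n]).
have hE k c j : (j < n)%N -> nth Lft (hedge s k c) j = side_arrow (lab k) (gm k (c + j%:Z)).
  by move=> jn; rewrite -[j]/(val (Ordinal jn)) -tnth_nth tnth_mktuple.
have sl k : slid s k by move=> c j jn; rewrite !hE // addr0.
have pE k c : path_at I s k c = gm k c.
  rewrite /path_at hE // addr0 /is_path /side_arrow.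
  by case: (lab k) => l; case: (gm k c).
have lE j : frame lo M (level s j) = chain_level sg j.
  have sj : size (chain_level sg j) = M by apply: size_chain_level; rewrite -ltnS.
  apply: (@eq_from_nth _ false); rewrite size_mkseq ?sj // => e eM; rewrite nth_frame //.
  rewrite /level /= /extend; have -> : (lo + e%:Z < lo) = false by lia.
  have -> : absz (lo + e%:Z - lo)%R = e by lia.
  by case: nth.
have w : in_window lo M s.
  move=> j; have sj : size (chain_level sg j) = M by apply: size_chain_level; rewrite -ltnS.
  split=> c H; rewrite /level /= /extend; first by rewrite H.
  have -> : (c < lo) = false by lia.
  by rewrite nth_default // sj; lia.
have bE (ka : intpart) (j : 'I_N.+1) : (size ka <= r)%N -> fits h M ka -> chain_level sg j = bits h M ka ->
    forall c, vedge s j c = boundary r ka c.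
  move=> sr fk E c; have [bl bh] := boundary_in_window sr fk; have [wl wh] := w j.
  suff : is_up (vedge s j c) = is_up (boundary r ka c).
    by case: (vedge s j c); case: (boundary r ka c).
  case: (ltP c lo) => c1; first by rewrite bl // -[LHS]/(level s j c) wl.
  case: (leP (lo + M%:Z) c) => c2; first by rewrite bh // -[LHS]/(level s j c) wh.
  have := congr1 (fun t => nth false t (absz (c - lo)%R)) (etrans (lE j) (etrans E (esym (frame_boundary sr)))).
  by rewrite /= !nth_frame; try lia; have -> : lo + (absz (c - lo)%R)%:Z = c by lia.
have gm0 k c : lo + M%:Z <= c -> gm k c = false.
  move=> H; have [_ _ _ z] := GP k; rewrite /gm; case: ltP => // _; apply: z; lia.
have comp : compatible mu nu I r s.
  split.
  - by move=> c; apply: bE.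
  - by move=> c; apply: bE.
  - move=> k; exists (absz lo + M + n)%N => c cK j; rewrite tnth_mktuple.
    have -> : gm k (c + (j : nat)%:Z) = false.
      have jn := ltn_ord j; case: (ltP (c + (j : nat)%:Z) lo) => H; first by rewrite /gm H.
      by apply: gm0; lia.
    by case: (lab k).
have cons k : row_conserved p (row_in I s k) (row_out I s k) (path_at I s k).
  move=> c; rewrite !pE; have [sG tG cG hG] := GP k; have [wi wo] := in_window_row I k w.
  have g0 c' : c' < lo + n%:Z -> gm k c' = false.
    move=> H; rewrite /gm; case: ltP => // c1; rewrite -(nth_take (n0 := n)); last by lia.
    by rewrite tG nth_nseq if_same.
  case: (ltP c lo) => c1; first by rewrite wi.1 ?wo.1 // !g0 //; lia.
  case: (leP (lo + M%:Z) c) => c2; first by rewrite wi.2 ?wo.2 // !gm0 //; lia.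
  have eM : (absz (c - lo)%R < M)%N by lia.
  have cE : c = lo + (absz (c - lo)%R)%:Z by lia.
  have := cG _ eM.
  have -> : nth false (G k) (absz (c - lo)%R) = gm k c by rewrite /gm ifN // -leNgt.
  have -> : nth false (G k) (absz (c - lo)%R + n) = gm k (c + n%:Z).
    by rewrite /gm ifN; [congr nth; lia | rewrite -leNgt; lia].
  rewrite /row_in /row_out {2 5}cE.
  have := lE (widen_ord (leqnSn N) k) => /= <-; have := lE (lift ord0 k) => /= <-.
  by rewrite !nth_frame // -!cE; case: (lab k).
exists s; split=> //; apply: eq_from_tnth => k; rewrite tnth_mktuple; apply: val_inj.
have := lE (lift ord0 k); rewrite /chain_level /= (nth_map [tuple of nseq M false]); last first.
  by rewrite size_tuple; exact: ltn_ord.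
rewrite -(tnth_nth _ sg k) => <-; rewrite /= /frame /mkseq -val_enum_ord -map_comp.
exact: eq_map.
Qed.

End Build.
End Chains.

(** * Cauchy identities *)

Lemma tuple_of_size (T : Type) M (t : seq T) : size t = M -> exists b : M.-tuple T, t = b.
Proof. by move=> /eqP st; exists (Tuple st). Qed.

Section PathSums.
Local Open Scope ring_scope.
Variables (R : comNzRingType) (L : Type) (M : nat) (K : L -> seq bool -> seq bool -> R).
Implicit Types (t u : seq bool).

Fixpoint path_sum (ls : seq L) t u : R :=
  if ls is l :: ls' then \sum_(b : M.-tuple bool) K l t b * path_sum ls' b u
  else (t == u)%:R.

Lemma big_tuple_cons (T : finType) k (P : pred (k.+1.-tuple T)) (F : k.+1.-tuple T -> R) :
  \sum_(s | P s) F s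
  = \sum_(b : T) \sum_(s : k.-tuple T | P [tuple of b :: s]) F [tuple of b :: s].
Proof.
rewrite pair_big_dep /=.
rewrite (reindex (fun x : T * k.-tuple T => [tuple of x.1 :: x.2])) //=.
exists (fun s => (thead s, [tuple of behead s])) => [[b s] _|s _] /=.
  by rewrite theadE; congr (_, _); apply: val_inj.
by rewrite -tuple_eta.
Qed.

(** Turns the sum over chains into an iterated matrix product, which [path_sum_cat] can then cut
    between the two alphabets. *)
Lemma path_sumE k (ls : k.-tuple L) t u :
  \sum_(s : k.-tuple (M.-tuple bool) | nth [::] (t :: map val s) k == u)
     \prod_(i < k) K (tnth ls i) (nth [::] (t :: map val s) i) (nth [::] (t :: map val s) i.+1)
  = path_sum ls t u.
Proof.
elim: k ls t => [|k IH] ls t.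
  rewrite (tuple0 ls) /=; under eq_bigr do rewrite big_ord0.
  have E (s : 0.-tuple (M.-tuple bool)) : (nth [::] (t :: map val s) 0 == u) = (t == u) by [].
  rewrite (eq_bigl _ _ E); case: eqP => _; last by rewrite big_pred0.
  by rewrite (big_pred1 [tuple]) // => s; apply/esym/eqP; apply: tuple0.
case/tupleP: ls => l ls; rewrite big_tuple_cons /=; apply: eq_bigr => b _.
rewrite -IH big_distrr /=; apply: eq_bigr => s _.
rewrite big_ord_recl tnth0 /=; congr (_ * _); apply: eq_bigr => i _.
by rewrite tnthS.
Qed.

Lemma path_sum_cat ls ls' t u : size t = M ->
  path_sum (ls ++ ls') t u = \sum_(b : M.-tuple bool) path_sum ls t b * path_sum ls' b u.
Proof.
elim: ls t => [|l ls IH] t st /=.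
  have [b0 ->] := tuple_of_size st.
  rewrite (bigD1 b0) //= eqxx mul1r big1 ?addr0 // => b bt.
  by rewrite eq_sym (negbTE (bt : b != b0 :> seq bool)) mul0r.
under [RHS]eq_bigr do rewrite big_distrl /=.
rewrite exchange_big /=; apply: eq_bigr => b _; rewrite IH ?size_tuple // big_distrr /=.
by apply: eq_bigr => b' _; rewrite mulrA.
Qed.

End PathSums.

Section Operators.
Local Open Scope ring_scope.
Variables (p : nat) (R : comNzRingType) (q : R) (M : nat).
Notation n := p.+1.
Implicit Types (t u : seq bool) (ls : seq (R + R)) (phi : seq bool -> R).

Definition rowops ls phi : seq bool -> R := foldr (rowop p q M) phi ls.

Lemma rowopD l phi psi t :
  rowop p q M l (fun b => phi b + psi b) t = rowop p q M l phi t + rowop p q M l psi t.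
Proof. by case: l => z; apply: stepsD. Qed.

Lemma rowopZ l k phi t : rowop p q M l (fun b => k * phi b) t = k * rowop p q M l phi t.
Proof. by case: l => z; apply: stepsZ. Qed.

Lemma rowops_eq ls phi psi t : (forall b, size b = size t -> phi b = psi b) ->
  rowops ls phi t = rowops ls psi t.
Proof.
move=> E; suff: forall b, size b = size t -> rowops ls phi b = rowops ls psi b by apply.
elim: ls => //= c s IH b sb; apply: rowop_eq => b' sb'.
by apply: IH; rewrite sb'.
Qed.

Lemma rowopsD ls phi psi t :
  rowops ls (fun b => phi b + psi b) t = rowops ls phi t + rowops ls psi t.
Proof.
elim: ls t => //= c s IH t; rewrite -rowopD; apply: rowop_eq => b _; exact: IH.
Qed.

Lemma rowopsZ ls k phi t : rowops ls (fun b => k * phi b) t = k * rowops ls phi t.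
Proof.
elim: ls t => //= c s IH t; rewrite -rowopZ; apply: rowop_eq => b _; exact: IH.
Qed.

Lemma rowops_expand ls phi t : size t = M ->
  rowops ls phi t = \sum_(b : M.-tuple bool) rowops ls (delta R b) t * phi b.
Proof.
move=> st.
have H (r : seq (M.-tuple bool)) : rowops ls (fun u => \sum_(b <- r) phi b * delta R b u) t
    = \sum_(b <- r) rowops ls (delta R b) t * phi b.
  elim: r => [|b r IH].
    rewrite big_nil -[RHS](mul0r (rowops ls (fun=> 0) t)) -rowopsZ.
    by apply: rowops_eq => b _; rewrite big_nil mul0r.
  rewrite big_cons -IH mulrC -rowopsZ -rowopsD.
  by apply: rowops_eq => u _; rewrite big_cons.
rewrite -H; apply: rowops_eq => u; rewrite st => su.
have [b0 ->] := tuple_of_size su.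
rewrite (bigD1 b0) //= /delta eqxx mulr1 big1 ?addr0 // => b bt.
by rewrite eq_sym (negbTE (bt : b != b0 :> seq bool)) mulr0.
Qed.

Lemma row_sum_rowop l t b : size t = M -> size b = M ->
  row_sum q l (nseq n false) t b = rowop p q M l (delta R b) t.
Proof.
move=> st sb; rewrite row_sumE ?st ?sb //; case: l => z.
  by apply: rowH_stepsE; rewrite st.
by apply: rowV_stepsE; rewrite st.
Qed.

End Operators.

Section CauchySum.
Local Open Scope ring_scope.
Variables (p : nat) (A A' B B' : finType).
Notation n := p.+1.
Notation Lab := (rows A A' B B').
Notation N := #|{: Lab}|.
Notation q := (var_q A A' B B').
Notation poly := {mpoly {poly int}[N]}.
Notation param := (@row_var A A' B B').
Notation X l := (row_param (@var_x A A' B B') (@var_y A A' B B') l).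
Notation W l := (row_param (@var_w A A' B B') (@var_z A A' B B') l).

(** The two bounds make room for [state_window] on the left and on the right, for all [N] rows. The
    states that contribute to [m] then correspond to finitely many chains. *)
Lemma cauchy_sum (I : rel Lab) (mu nu : intpart) r h M (m : 'X_{1..N}) :
  (size mu <= r)%N -> (size nu <= r)%N -> (r <= h)%N -> fits h M mu -> fits h M nu ->
  (N * ((mdeg m).+1 * n) <= h - r)%N ->
  (nth 0%N mu 0 + h + N * ((mdeg m).+1 * n) <= M)%N ->
  finite_set [set s : {classic state n A A' B B'} | compatible mu nu I r s /\ (cauchy_weight I s)@_m != 0] /\
  cauchy_Z n mu nu I r m
  = (path_sum M (@row_kernel p A A' B B') (sort_tuple I (enum_tuple {: Lab})) (bits h M mu) (bits h M nu))@_m.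
Proof.
move=> smu snu rh fmu fnu Hh HM.
pose ch := (N.-tuple (M.-tuple bool))%type.
pose lev (sg : ch) := chain_level mu h sg.
pose wt (sg : ch) := chain_weight p I mu h sg.
(* A nonzero coefficient is demanded because [build_state] needs a chain of nonzero weight; the
   chains left out contribute 0. *)
pose P (sg : ch) := (lev sg N == bits h M nu) && ((wt sg)@_m != 0).
pose good (s : state n A A' B B') (sg : ch) := [/\ compatible mu nu I r s, in_window (origin r h) M s, forall k, slid s k,
     forall k, row_conserved p (row_in I s k) (row_out I s k) (path_at I s k)
     & chain_of r h M s = sg].
have wt_nz sg : P sg -> wt sg != 0.
  by move=> /andP[_]; apply: contraNneq => ->; rewrite mcoeff0.
have [g gP] : exists g : ch -> state n A A' B B', forall sg, P sg -> good (g sg) sg.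
  suff H sg : exists s, P sg -> good s sg by have [g gP] := boolp.choice H; exists g.
  case: (boolP (P sg)) => [Psg|_]; last by exists (State (fun _ _ => Up) (fun _ _ => nseq_tuple n Lft)).
  have [/eqP l1 _] := andP Psg.
  by have [s sP] := build_state smu snu rh fmu fnu l1 (wt_nz sg Psg); exists s.
have -> : (path_sum M (@row_kernel p A A' B B') (sort_tuple I (enum_tuple {: Lab})) (bits h M mu)
    (bits h M nu))@_m = \sum_(sg | P sg) (wt sg)@_m.
  rewrite -path_sumE raddf_sum big_mkcondr /=; apply: eq_bigr => sg _.
  by case: eqP => // ->.
apply: (fps_sum_finite (g := g)) => [sg Psg|sg sg' Psg Psg' E|s comp wm].
- have [comp w sl cons E] := gP sg Psg; split=> //.
  have far k := compatible_far k comp.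
  have wE := chain_weightE smu snu rh fmu fnu comp w sl cons far; rewrite E in wE.
  rewrite (cauchy_weight_prod w sl cons far) -?wE // => k c.
  (* A vertex outside the window has weight 1, and one inside is a factor of a nonzero product. *)
  have nz := wt_nz sg Psg; rewrite /wt wE in nz.
  case: (ltP c (origin r h)) => c1; first by rewrite (vw_outside w) ?oner_neq0 //; left.
  case: (leP (origin r h + M%:Z) c) => c2; first by rewrite (vw_outside w) ?oner_neq0 //; right.
  have eM : (absz (c - origin r h)%R < M)%N by lia.
  apply: contraNneq nz => z; rewrite (bigD1 k) //= (bigD1 (Ordinal eM)) //=.
  by have -> : origin r h + (absz (c - origin r h)%R)%:Z = c; [lia | rewrite z !mul0r].
- by have [_ _ _ _ <-] := gP sg Psg; have [_ _ _ _ <-] := gP sg' Psg'; rewrite E.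
have nz k c : vw I s k c != 0.
  apply: contraNneq wm => z; rewrite /cauchy_weight /state_weight asboolF ?mcoeff0 //.
  by move=> /(_ (k, c)); rewrite -/(vw I s k c) z eqxx.
have sl k : slid s k by apply: nonzero_slid.
have cons k : row_conserved p (row_in I s k) (row_out I s k) (path_at I s k).
  exact: nonzero_conserved.
have far k := compatible_far k comp.
have w : in_window (origin r h) M s.
  move=> j; apply: windowed_widen (state_window comp nz smu wm j); rewrite /origin.
    have jN : (j <= N)%N by rewrite -ltnS; apply: ltn_ord.
    have := leq_mul jN (leqnn ((mdeg m).+1 * n)); lia.
  have jN : (j <= N)%N by rewrite -ltnS; apply: ltn_ord.
  have := leq_mul jN (leqnn ((mdeg m).+1 * n)); lia.
have wE : cauchy_weight I s = wt (chain_of r h M s).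
  by rewrite /wt (chain_weightE smu snu rh fmu fnu comp w sl cons far) (cauchy_weight_prod w).
have Ps : P (chain_of r h M s).
  rewrite /P -wE wm andbT /lev; have := chain_levelE smu snu rh fmu fnu comp ord_max => /= ->.
  rewrite -(frame_boundary smu snu rh fmu fnu snu); apply/eqP; congr frame; apply: funext => c.
  by rewrite /level; have [_ -> _] := comp.
exists (chain_of r h M s) => //; have [comp' w' sl' cons' E] := gP _ Ps.
apply: (state_ext smu snu rh fmu fnu) w w' sl sl' cons cons' far _ _ => [k|j]; first exact: compatible_far comp'.
by rewrite -(chain_levelE smu snu rh fmu fnu comp) -(chain_levelE smu snu rh fmu fnu comp') E.
Qed.

End CauchySum.

Section RowCounts.
Local Open Scope ring_scope.
Variables (p : nat) (R : comNzRingType) (q : R) (M : nat).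

Lemma count_move c t : can_step p c t -> count id (move p c t) = count id t.
Proof. by move=> ct; have := cnt_move 0 ct; rewrite /cnt !drop0 /= addn0. Qed.

Lemma rowop_count l phi psi t : (forall b, count id b = count id t -> phi b = psi b) ->
  rowop p q M l phi t = rowop p q M l psi t.
Proof.
suff H z s : (forall b, count id b = count id t -> phi b = psi b) ->
    steps p q z s phi t = steps p q z s psi t by case: l => z; apply: H.
move=> E; suff: forall b, count id b = count id t -> steps p q z s phi b = steps p q z s psi b by apply.
elim: s => //= c s IH b sb; rewrite /step IH //; case: ifP => // cb.
by rewrite IH // count_move.
Qed.

(** Row operators preserve the number of particles. This discards the words at the middle level that
    are not Maya diagrams with the right number of particles. *)
Lemma rowops_delta_count ls t u : count id t != count id u ->
  rowops p q M ls (delta R u) t = 0.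
Proof.
move=> tu; rewrite -[RHS](mul0r (rowops p q M ls (delta R u) t)) -rowopsZ.
suff H b : count id b = count id t -> rowops p q M ls (delta R u) b
    = rowops p q M ls (fun b => 0 * delta R u b) b by apply: H.
elim: ls b => [|l ls IH] b bt /=.
  by rewrite mul0r /delta; case: (eqVneq b u) tu => // <-; rewrite bt eqxx.
by apply: rowop_count => b' b'b; apply: IH; rewrite b'b.
Qed.

End RowCounts.

Section RowOrders.
Variables (A A' B B' : finType) (precA : rel (A + A')) (precB : rel (B + B')).
Hypotheses (hA : is_total_order precA) (hB : is_total_order precB).
Notation Lab := (rows A A' B B').

Lemma order_IA_total : is_total_order (order_IA precA precB).
Proof.
case: hA hB => rA aA tA oA [rB aB tB oB]; split.
- by case.
- by case=> [a|b] [a'|b'] //= H; congr (_ _); [apply: aA | apply: aB].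
- by case=> [a|b] [a'|b'] [a''|b''] //=; [apply: tA | apply: tB].
- by case=> [a|b] [a'|b'] //=.
Qed.

Lemma order_IB_total : is_total_order (order_IB precA precB).
Proof.
case: hA hB => rA aA tA oA [rB aB tB oB]; split.
- by case.
- by case=> [a|b] [a'|b'] //= H; congr (_ _); [apply: aA | apply: aB].
- by case=> [a|b] [a'|b'] [a''|b''] //=; [apply: tA | apply: tB].
- by case=> [a|b] [a'|b'] //=.
Qed.

Lemma labels_sorted (T : finType) (prec : rel T) : is_total_order prec ->
  pairwise prec (sort prec (enum T)).
Proof. by case=> _ _ tr tot; rewrite -sorted_pairwise ?sort_sorted. Qed.

Lemma perm_labels : perm_eq
  (map inl (labels precA) ++ map inr (labels precB) : seq Lab) (enum {: Lab}).
Proof.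
apply: uniq_perm; rewrite ?enum_uniq //; last first.
  move=> [a|b]; rewrite mem_cat !mem_enum; apply/orP; [left|right];
    by rewrite mem_map ?mem_sort ?mem_enum // => ? ? [].
rewrite cat_uniq !map_inj_uniq; try by move=> ? ? [].
rewrite !sort_uniq !enum_uniq /= andbT; apply/hasPn => _ /mapP[b _ ->].
by apply/negP => /mapP[].
Qed.

Lemma sort_total (T : finType) (le : rel T) (s : seq T) : is_total_order le ->
  pairwise le s -> perm_eq s (enum T) -> sort le (enum T) = s.
Proof.
case=> _ an tr tot ps pe; apply: (sorted_eq tr an); first exact: sort_sorted.
  by rewrite sorted_pairwise.
by rewrite perm_sort perm_sym.
Qed.

Lemma sort_IA : sort (order_IA precA precB) (enum {: Lab})
  = map inl (labels precA) ++ map inr (labels precB).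
Proof.
apply: sort_total perm_labels; first exact: order_IA_total.
rewrite pairwise_cat !pairwise_map; apply/and3P; split; try exact: labels_sorted; apply/allrelP.
by move=> _ _ /mapP[a _ ->] /mapP[b _ ->].
Qed.

Lemma sort_IB : sort (order_IB precA precB) (enum {: Lab})
  = map inr (labels precB) ++ map inl (labels precA).
Proof.
apply: sort_total; first exact: order_IB_total.
  rewrite pairwise_cat !pairwise_map; apply/and3P; split; try exact: labels_sorted; apply/allrelP.
  by move=> _ _ /mapP[a _ ->] /mapP[b _ ->].
by rewrite perm_catC perm_labels.
Qed.

End RowOrders.

Section PathOperators.
Local Open Scope ring_scope.
Variables (p : nat) (A A' B B' : finType) (M : nat).
Notation n := p.+1.
Notation Lab := (rows A A' B B').
Notation N := #|{: Lab}|.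
Notation q := (var_q A A' B B').
Notation R := {mpoly {poly int}[N]}.
Notation kernel := (@row_kernel p A A' B B').
Notation X := (row_param (@var_x A A' B B') (@var_y A A' B B')).
Notation W := (row_param (@var_w A A' B B') (@var_z A A' B B')).
Implicit Types (t u : seq bool).

Lemma path_sum_up ls t u : size t = M ->
  path_sum M kernel (map inl ls) t u = rowops p q M (map X ls) (delta R u) t.
Proof.
elim: ls t => //= l ls IH t st.
rewrite -[RHS]/(rowops p q M [:: X l] (rowops p q M (map X ls) (delta R u)) t) rowops_expand //.
apply: eq_bigr => b _; rewrite IH ?size_tuple //; congr (_ * _).
exact: row_sum_rowop (size_tuple b).
Qed.

(** Read upside down, a row leads from its lower configuration to its upper one, so the matrix
    coefficient goes from [u] to [t] and the operators appear in reverse order. *)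
Lemma path_sum_down_rev ls t u : size t = M -> size u = M ->
  path_sum M kernel (map inr ls) t u = rowops p q M (rev (map W ls)) (delta R t) u.
Proof.
move=> + su; elim: ls t => [|l ls IH] t st /=; first by rewrite /delta eq_sym.
rewrite rev_cons /rowops foldr_rcons -/(rowops p q M _ _) rowops_expand //.
apply: eq_bigr => b _; rewrite IH ?size_tuple // mulrC; congr (_ * _).
exact: row_sum_rowop (size_tuple b) st.
Qed.

Lemma path_sum_down ls t u : size t = M -> size u = M ->
  path_sum M kernel (map inr ls) t u = rowops p q M (map W ls) (delta R t) u.
Proof.
move=> st su; rewrite path_sum_down_rev // /rowops rowops_rev ?su //.
by rewrite /var_q mpolyC_eq0 polyX_eq0.
Qed.

End PathOperators.

(** * Sums over partitions as sums over words *)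

Section PartitionSums.
Local Open Scope ring_scope.
Variables (k h M : nat) (m : 'X_{1..k}) (F : {classic intpart} -> {mpoly {poly int}[k]}).
Variable V : seq bool -> {poly int}.

Lemma fps_sum_partitions :
  (forall la : intpart, fits h M la -> (F la)@_m = V (bits h M la)) ->
  (forall la : intpart, (F la)@_m != 0 -> fits h M la) ->
  finite_set [set la | [set: {classic intpart}]%classic la /\ (F la)@_m != 0] /\
  fps_sum [set: {classic intpart}]%classic F m = \sum_(b : M.-tuple bool | count id b == h) V b.
Proof.
move=> FV Ff.
have [g gP] : exists g : M.-tuple bool -> intpart, forall b : M.-tuple bool, count id b == h ->
    fits h M (g b) /\ bits h M (g b) = b.
  suff H (b : M.-tuple bool) : exists la, count id b == h -> fits h M la /\ bits h M la = b.
    by have [g gP] := boolp.choice H; exists g.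
  case: eqP => [bh|_]; last by exists (IntPart (isT : sorted geq [::] && (0%N \notin [::]))).
  by have [la] := bits_surj (size_tuple b) bh; exists la.
apply: (fps_sum_finite (g := g)) => [b bh|b b' bh b'h E|la _ /Ff fla].
- by have [f1 <-] := gP b bh; rewrite -FV.
- have [_ E1] := gP b bh; have [_ E2] := gP b' b'h.
  by apply: val_inj; rewrite /= -E1 E E2.
pose b : M.-tuple bool := Tuple (introT eqP (size_bits h M la)).
have bh : count id b == h by have := cnt_bits0 fla; rewrite /cnt drop0 /= => ->.
by exists b => //; have [f1 E] := gP b bh; apply: bits_inj fla f1 _; rewrite E.
Qed.

End PartitionSums.

(** * Degree bounds for super LLT polynomials *)

Section LLTOrder.
Local Open Scope ring_scope.
Variables (n k : nat) (A A' : finType) (prec : rel (A + A')) (R : comNzRingType).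
Variables (q : {mpoly R[k]}) (x : A -> {mpoly R[k]}) (y : A' -> {mpoly R[k]}).
Hypotheses (ox : forall a, order_ge 1 (x a)) (oy : forall b, order_ge 1 (y b)).
Implicit Types (la mu : intpart).

Lemma order_geXn e (P : {mpoly R[k]}) j : order_ge e P -> order_ge (j * e) (P ^+ j).
Proof.
move=> oP; elim: j => [|j IH]; first by rewrite mul0n; apply: order_ge0.
by rewrite exprS mulSn; apply: order_geM.
Qed.

Definition skew_size la mu : nat :=
  #|diagram (size la) (nth 0%N la 0) la :\: diagram (size la) (nth 0%N la 0) mu|.

(** Every ribbon has [n] cells and carries a factor [x] or [- y] without constant term, so the
    number of ribbons bounds the degree from below. *)
Lemma super_LLT_order la mu d : (d * n <= skew_size la mu)%N -> (0 < n)%N ->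
  order_ge d (super_LLT n la mu prec q x y).
Proof.
move=> dn n0 m md; rewrite raddf_sum big1 //= => T /asboolP [_ part rib _ _ _].
have cardT : skew_size la mu = (#|tiles T| * n)%N.
  by apply: card_uniform_partition part => S /rib[].
have dT : (d <= #|tiles T|)%N by rewrite -(leq_pmul2r n0) -cardT.
have tilesE : #|tiles T| = (\sum_(a : A) #|tiles_with T (inl a)| + \sum_(b : A') #|tiles_with T (inr b)|)%N.
  rewrite -(big_sumType _ predT (fun l => #|tiles_with T l|)) /=.
  transitivity (\sum_(S in tiles T) 1)%N; first by rewrite sum1_card.
  rewrite (eq_bigr (fun l => \sum_(S | T S == Some l) 1)%N); last first.
    by move=> l _; rewrite sum1_card; apply: eq_card => S; rewrite inE.
  rewrite (exchange_big_dep (mem (tiles T))) /= => [|l S _ /eqP TS]; last by rewrite inE TS.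
  apply: eq_bigr => S; rewrite inE; case TS: (T S) => [l|//] _.
  by rewrite (big_pred1 l) // => l'; rewrite eq_sym (inj_eq Some_inj).
have ord : order_ge #|tiles T| (q ^+ tableau_spin T * (\prod_(a : A) x a ^+ #|tiles_with T (inl a)|)
     * (\prod_(b : A') (- y b) ^+ #|tiles_with T (inr b)|)).
  rewrite tilesE -mulrA; apply: (@order_geM _ _ 0) => //; apply: order_geM.
    by apply: order_ge_prod => a; rewrite -[X in order_ge X]muln1; apply: order_geXn.
  by apply: order_ge_prod => b; rewrite -[X in order_ge X]muln1; apply/order_geXn/order_geN.
by apply: ord; apply: leq_trans md dT.
Qed.

(** The cells of the first row suffice here, and those of the first column in [skew_size_col];
    together they turn a bound on the degree into a window for [la]. *)
Lemma skew_size_row la mu : (nth 0%N la 0 - nth 0%N mu 0 <= skew_size la mu)%N.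
Proof.
case: (posnP (nth 0%N la 0)) => [->|la0]; first by rewrite sub0n.
have s0 : (0 < size la)%N by rewrite -part_gt0.
have lt (i : 'I_(nth 0%N la 0 - nth 0%N mu 0)) : (nth 0%N mu 0 + i < nth 0%N la 0)%N.
  by have := ltn_ord i; lia.
pose f i := (Ordinal s0, Ordinal (lt i)).
have finj : injective f by move=> i j [/addnI E]; apply: val_inj.
rewrite -[X in (X <= _)%N]card_ord -(card_imset predT finj); apply: subset_leq_card.
apply/fintype.subsetP => _ /imsetP[i _ ->]; rewrite !inE /= lt andbT; lia.
Qed.

Lemma skew_size_col la mu : (size la - size mu <= skew_size la mu)%N.
Proof.
have lt (i : 'I_(size la - size mu)) : (size mu + i < size la)%N.
  by have := ltn_ord i; lia.
case: (posnP (size la)) => [->|s0]; first by rewrite sub0n.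
have la0 : (0 < nth 0%N la 0)%N by rewrite part_gt0.
pose f i := (Ordinal (lt i), Ordinal la0).
have finj : injective f by move=> i j [/addnI E]; apply: val_inj.
rewrite -[X in (X <= _)%N]card_ord -(card_imset predT finj); apply: subset_leq_card.
apply/fintype.subsetP => _ /imsetP[i _ ->]; rewrite !inE /= (part_gt0 la) lt andbT -leqNgt.
by rewrite nth_default // leq_addr.
Qed.

Lemma super_LLT_included la mu : super_LLT n la mu prec q x y != 0 -> part_included mu la.
Proof.
move=> nz; apply: contrapT => ninc; case/eqP: nz; apply: big1 => T /asboolP[inc].
by case: ninc.
Qed.

Lemma fits_included h M la mu : fits h M la -> part_included mu la -> fits h M mu.
Proof.
move=> /andP[s f] inc; rewrite /fits (leq_trans _ f) ?leq_add2r ?inc // andbT.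
apply: leq_trans s; rewrite leqNgt; apply/negP => lt.
by have := leq_trans (etrans (part_gt0 _ _) lt) (inc _); rewrite part_gt0 ltnn.
Qed.

End LLTOrder.

Section CauchyIdentities.
Local Open Scope ring_scope.
Variables (p : nat) (mu nu : intpart) (A A' B B' : finType).
Variables (precA : rel (A + A')) (precB : rel (B + B')) (r : nat).
Hypotheses (hA : is_total_order precA) (hB : is_total_order precB).
Hypotheses (smu : (size mu <= r)%N) (snu : (size nu <= r)%N).
Notation n := p.+1.
Notation Lab := (rows A A' B B').
Notation N := #|{: Lab}|.
Notation R := {mpoly {poly int}[N]}.
Notation IA := (order_IA precA precB).
Notation IB := (order_IB precA precB).
Notation GX := (LLT_XY n B B' precA).
Notation GW := (LLT_WZ n A A' precB).
Notation X := (row_param (@var_x A A' B B') (@var_y A A' B B')).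
Notation W := (row_param (@var_w A A' B B') (@var_z A A' B B')).
Notation q := (var_q A A' B B').
Implicit Types (m : 'X_{1..N}) (la : intpart).

(** Where the coefficient of [m] is concerned, the window grows by at most [spread m] per row, and
    [la] exceeds [mu] by fewer than [spread m] cells in the first identity. So [N * spread m] leaves
    room for the states and the additional [spread m] for the partitions. *)
Definition spread m : nat := ((mdeg m).+1 * n)%N.
Definition rows_bound m : nat := (r + (N * spread m + spread m))%N.
Definition cols_bound m : nat :=
  (rows_bound m + nth 0 mu 0 + nth 0 nu 0 + (N * spread m + spread m))%N.
Notation h := rows_bound.
Notation M := cols_bound.

Lemma mu_fits m : fits (h m) (M m) mu.
Proof. rewrite /fits /cols_bound /rows_bound; move: smu; lia. Qed.

Lemma nu_fits m : fits (h m) (M m) nu.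
Proof. rewrite /fits /cols_bound /rows_bound; move: snu; lia. Qed.

Lemma window_large m : [/\ (r <= h m)%N, (N * ((mdeg m).+1 * n) <= h m - r)%N &
  (nth 0%N mu 0 + h m + N * ((mdeg m).+1 * n) <= M m)%N].
Proof. rewrite /cols_bound /rows_bound /spread; split; lia. Qed.

Lemma GX_steps m la ka : fits (h m) (M m) la -> fits (h m) (M m) ka ->
  GX la ka = rowops p q (M m) (map X (labels precA)) (delta R (bits (h m) (M m) la)) (bits (h m) (M m) ka).
Proof. exact: super_LLT_steps. Qed.

Lemma GW_steps m la ka : fits (h m) (M m) la -> fits (h m) (M m) ka ->
  GW la ka = rowops p q (M m) (map W (labels precB)) (delta R (bits (h m) (M m) la)) (bits (h m) (M m) ka).
Proof. exact: super_LLT_steps. Qed.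

(** The factor [GX la mu] alone bounds [la]: with [spread m] cells or more in the skew shape, it
    would start in a degree above [mdeg m]. *)
Lemma GX_fits m la : (GX la mu * GW la nu)@_m != 0 -> fits (h m) (M m) la.
Proof.
move=> nz; have lt : (skew_size la mu < spread m)%N.
  rewrite ltnNge; apply: contraNN nz => le; apply/eqP.
  have oG : order_ge (mdeg m).+1 (GX la mu).
    by apply: super_LLT_order le _ => // a; apply: order_geX.
  by have := order_geM oG (order_ge0 (GW la nu)); rewrite addn0; apply.
have := skew_size_row la mu; have := skew_size_col la mu.
rewrite /fits /cols_bound /rows_bound; move: smu lt; lia.
Qed.

Lemma GX_sub_fits m la : (GX nu la * GW mu la)@_m != 0 -> fits (h m) (M m) la.
Proof.
move=> nz; apply: fits_included (nu_fits m) _.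
apply: (@super_LLT_included n _ _ _ precA _ q (@var_x A A' B B') (@var_y A A' B B')).
by apply: contraNneq nz => H; rewrite [X in X * _]H mul0r mcoeff0.
Qed.

Lemma count_bits m la : fits (h m) (M m) la -> count id (bits (h m) (M m) la) = h m.
Proof. by move=> /cnt_bits0; rewrite /cnt drop0. Qed.

Lemma cauchy_IA m :
  [/\ finite_set [set s : {classic state n A A' B B'} | compatible mu nu IA r s /\ (cauchy_weight IA s)@_m != 0],
     finite_set [set la : {classic intpart} | [set: {classic intpart}]%classic la /\ (GX la mu * GW la nu)@_m != 0] &
     cauchy_Z n mu nu IA r m
     = fps_sum [set: {classic intpart}]%classic (fun la : {classic intpart} => GX la mu * GW la nu) m].
Proof.
have [rh Hh HM] := window_large m.
have [fin ->] := cauchy_sum IA smu snu rh (mu_fits m) (nu_fits m) Hh HM.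
have [fin' ->] := @fps_sum_partitions _ (h m) (M m) m (fun la => GX la mu * GW la nu)
  (fun b => (rowops p q (M m) (map X (labels precA)) (delta R b) (bits (h m) (M m) mu)
    * rowops p q (M m) (map W (labels precB)) (delta R b) (bits (h m) (M m) nu))@_m)
  ltac:(by move=> la fla /=; rewrite (GX_steps fla (mu_fits m)) (GW_steps fla (nu_fits m))) (@GX_fits m).
split=> //; rewrite /= sort_IA // path_sum_cat ?size_bits // raddf_sum [RHS]big_mkcond.
apply: eq_bigr => b _ /=; rewrite path_sum_up ?size_bits // path_sum_down ?size_bits ?size_tuple //.
case: eqP => // /eqP bh; rewrite rowops_delta_count ?mul0r ?mcoeff0 //.
by rewrite count_bits ?mu_fits // eq_sym.
Qed.

Lemma cauchy_IB m :
  [/\ finite_set [set s : {classic state n A A' B B'} | compatible mu nu IB r s /\ (cauchy_weight IB s)@_m != 0],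
     finite_set [set la : {classic intpart} | [set: {classic intpart}]%classic la /\ (GX nu la * GW mu la)@_m != 0] &
     cauchy_Z n mu nu IB r m
     = fps_sum [set: {classic intpart}]%classic (fun la : {classic intpart} => GX nu la * GW mu la) m].
Proof.
have [rh Hh HM] := window_large m.
have [fin ->] := cauchy_sum IB smu snu rh (mu_fits m) (nu_fits m) Hh HM.
have [fin' ->] := @fps_sum_partitions _ (h m) (M m) m (fun la => GX nu la * GW mu la)
  (fun b => (rowops p q (M m) (map X (labels precA)) (delta R (bits (h m) (M m) nu)) b
    * rowops p q (M m) (map W (labels precB)) (delta R (bits (h m) (M m) mu)) b)@_m)
  ltac:(by move=> la fla /=; rewrite (GX_steps (nu_fits m) fla) (GW_steps (mu_fits m) fla)) (@GX_sub_fits m).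
split=> //; rewrite /= sort_IB // path_sum_cat ?size_bits // raddf_sum [RHS]big_mkcond.
(* With the rows of [B] and [B'] on top, the operators lead from the middle word to those of [mu]
   and [nu], so [la] is now the inner partition. *)
apply: eq_bigr => b _ /=; rewrite path_sum_up ?size_tuple // path_sum_down ?size_bits ?size_tuple // mulrC.
case: eqP => // /eqP bh; rewrite rowops_delta_count ?mul0r ?mcoeff0 //.
by rewrite count_bits ?nu_fits.
Qed.

End CauchyIdentities.

Theorem proposition7p2 (n : nat) (hn : (0 < n)%N) (mu nu : intpart)
    (dA dA' dB dB' : Order.disp_t)
    (A : finOrderType dA) (A' : finOrderType dA')
    (B : finOrderType dB) (B' : finOrderType dB')
    (precA : rel (A + A')) (precB : rel (B + B'))
    (hA : is_total_order precA) (hAr : respects_orders precA)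
    (hB : is_total_order precB) (hBr : respects_orders precB)
    (r : nat) (hmu : (size mu <= r)%N) (hnu : (size nu <= r)%N) :
  let IA := order_IA precA precB in
  let IB := order_IB precA precB in
  let GX (la ka : intpart) := LLT_XY n B B' precA la ka in
  let GW (la ka : intpart) := LLT_WZ n A A' precB la ka in
  let termA (la : {classic intpart}) := (GX la mu * GW la nu)%R in
  let termB (la : {classic intpart}) := (GX nu la * GW mu la)%R in
  [/\ cauchy_summable n mu nu IA r, fps_summable [set: {classic intpart}]%classic termA
    & cauchy_Z n mu nu IA r = fps_sum [set: {classic intpart}]%classic termA] /\
  [/\ cauchy_summable n mu nu IB r, fps_summable [set: {classic intpart}]%classic termB
    & cauchy_Z n mu nu IB r = fps_sum [set: {classic intpart}]%classic termB].
Proof.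
case: n hn => // p _ IA IB GX GW termA termB.
have HA := cauchy_IA p hA hB hmu hnu; have HB := cauchy_IB p hA hB hmu hnu.
split; split=> [m|m|]; try by [case: (HA m) | case: (HB m)].
  by apply: funext => m; case: (HA m).
by apply: funext => m; case: (HB m).
Qed.
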